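(* Let $k$ be a field and let $N\subseteq M$ be a strongly separable, irreducible extension of $k$-algebras of depth 2 (all notions as in the context), with Jones tower $N\subseteq M\subseteq M_1\subseteq M_2$ and second centralizers $A=C_{M_1}(N)$, $B=C_{M_2}(M)$. Then $A$ and $B$ carry structures of involutive (i.e. $S^2=\mathrm{id}$) semisimple Hopf algebras over $k$ which are dual to one another, and there are a left $B$-module algebra action of $B$ on $M_1$ and a left $A$-module algebra action of $A$ on $M$ such that $M_2\cong M_1\# B$ and $M_1\cong M\# A$ as algebras.
   Context: For a subalgebra $S$ of an algebra $R$, $C_R(S)=\{r\in R: rs=sr \text{ for all } s\in S\}$. An extension $N\subseteq M$ of unital $k$-algebras ($N$ a unital subalgebra) is a strongly separable, irreducible extension if $C_M(N)=k1$ and there are an $N$-$N$-bimodule map $E:M\to N$ and elements $x_1,\dots,x_n,y_1,\dots,y_n\in M$ with $\sum_i E(mx_i)y_i=m=\sum_i x_iE(y_im)$ for all $m\in M$, $E(1)\neq 0$ and $\sum_i x_iy_i\neq 0$. As a standing normalization, $E$ is rescaled so that $E(1)=1$; then $\sum_i x_iy_i=\lambda^{-1}1$ for a nonzero $\lambda\in k$. Basic construction: given algebras $S\subseteq R$, an $S$-bimodule map $E_S:R\to S$ with $E_S(1)=1$ and elements $r_i,s_i\in R$ with $\sum_iE_S(rr_i)s_i=r=\sum_ir_iE_S(s_ir)$ for all $r$ and $\sum_ir_is_i=\lambda^{-1}1$, let $R_1=R\otimes_SR$ with multiplication $(a\otimes b)(c\otimes d)=aE_S(bc)\otimes d$ and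 unit $\sum_ir_i\otimes s_i$; $R$ is identified with a subalgebra of $R_1$ via $r\mapsto\sum_i rr_i\otimes s_i$; the Jones idempotent is $e=1\otimes1$; and $E_R:R_1\to R$, $a\otimes b\mapsto\lambda ab$. Then $E_R$ is an $R$-bimodule map with $E_R(1)=1$, and the elements $\lambda^{-1}r_i\otimes1$, $1\otimes s_i$ satisfy the same conditions with the same $\lambda$ (and $R_1\cong\mathrm{End}(R_S)$). Applying this to $(N\subseteq M,E)$ gives $M_1$, $e_1$, $E_M:M_1\to M$; applying it to $(M\subseteq M_1,E_M)$ gives $M_2$, $e_2$, $E_{M_1}:M_2\to M_1$. Depth 2 means: $M_1$ is a free right $M$-module with a basis contained in $A=C_{M_1}(N)$, and $M_2$ is a free right $M_1$-module with a basis contained in $B=C_{M_2}(M)$. For a Hopf algebra $H$, a left $H$-module algebra $R$ satisfies $h\cdot(rr')=(h_{(1)}\cdot r)(h_{(2)}\cdot r')$ and $h\cdot 1=\varepsilon(h)1$; the smash product $R\#H$ is $R\otimes H$ with multiplication $(r\#h)(r'\#h')=r(h_{(1)}\cdot r')\#h_{(2)}h'$. *)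

(* Defs.v *)
From Stdlib Require Import ClassicalEpsilon.
From Stdlib Require List.
From mathcomp Require Import all_boot all_algebra.

Set Implicit Arguments.
Unset Strict Implicit.
Unset Printing Implicit Defensive.

Import GRing.Theory.
Local Open Scope ring_scope.

(* A k-algebra presented as a carrier subset of an ambient type together    *)
(* with its operations (the algebras below are subalgebras of function      *)
(* algebras, so no bundled structure is needed).                            *)
Record salg (k : fieldType) := SAlg {
  car : Type;
  smem : car -> Prop;
  szero : car;
  sadd : car -> car -> car;
  sscale : k -> car -> car;
  smul : car -> car -> car;
  sone : car }.

Arguments car {k} s.
Arguments smem {k} s _.
Arguments szero {k} s.
Arguments sadd {k} s _ _.
Arguments sscale {k} s _ _.
Arguments smul {k} s _ _.
Arguments sone {k} s.

Definition ssum (k : fieldType) (V : salg k) (s : seq (car V)) : car V :=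
  foldr (sadd V) (szero V) s.

Arguments ssum {k} V s.

Definition lin_fun (k : fieldType) (V : salg k) (phi : car V -> k) : Prop :=
  forall (a b : car V) (c : k), smem V a -> smem V b ->
    phi (sadd V a b) = phi a + phi b /\ phi (sscale V c a) = c * phi a.

Arguments lin_fun {k} V phi.

Definition lin_map (k : fieldType) (V W : salg k) (f : car V -> car W) : Prop :=
  forall (a b : car V) (c : k), smem V a -> smem V b ->
    f (sadd V a b) = sadd W (f a) (f b) /\ f (sscale V c a) = sscale W c (f a).

Arguments lin_map {k} V W f.

(* Elements of the tensor product V (x)_k W are represented by finite sums
   sum_i v_i (x) w_i, i.e. lists of pairs; two such sums denote the same
   tensor iff all pairs of linear functionals agree on them (over a field
   this is exactly equality in V (x)_k W). *)
Definition tens_in (k : fieldType) (V W : salg k) (t : seq (car V * car W)) : Prop :=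
  List.Forall (fun p => smem V p.1 /\ smem W p.2) t.

Arguments tens_in {k} V W t.

Definition tens_eq (k : fieldType) (V W : salg k) (t t' : seq (car V * car W)) : Prop :=
  forall (phi : car V -> k) (psi : car W -> k), lin_fun V phi -> lin_fun W psi ->
    \sum_(p <- t) phi p.1 * psi p.2 = \sum_(p <- t') phi p.1 * psi p.2.

Arguments tens_eq {k} V W t t'.

Definition is_hopf (k : fieldType) (H : salg k)
  (D : car H -> seq (car H * car H)) (eps : car H -> k) (S : car H -> car H) : Prop :=
  [/\ (forall a, smem H a -> tens_in H H (D a) /\ smem H (S a)),
      (forall a b c, smem H a -> smem H b ->
         tens_eq H H (D (sadd H a b)) (D a ++ D b) /\
         tens_eq H H (D (sscale H c a)) [seq (sscale H c p.1, p.2) | p <- D a]),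
      lin_fun H eps /\ lin_map H H S
    & [/\
      (forall a phi psi chi, smem H a -> lin_fun H phi -> lin_fun H psi -> lin_fun H chi ->
         \sum_(p <- D a) (\sum_(q <- D p.1) phi q.1 * psi q.2) * chi p.2 =
         \sum_(p <- D a) phi p.1 * (\sum_(q <- D p.2) psi q.1 * chi q.2)),
      (forall a, smem H a ->
         ssum _ [seq sscale H (eps p.1) p.2 | p <- D a] = a /\
         ssum _ [seq sscale H (eps p.2) p.1 | p <- D a] = a),
      (forall a b, smem H a -> smem H b ->
         tens_eq H H (D (smul H a b)) [seq (smul H p.1 q.1, smul H p.2 q.2) | p <- D a, q <- D b]
         /\ eps (smul H a b) = eps a * eps b),
      tens_eq H H (D (sone H)) [:: (sone H, sone H)] /\ eps (sone H) = 1
    &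
      (forall a, smem H a ->
         ssum _ [seq smul H (S p.1) p.2 | p <- D a] = sscale H (eps a) (sone H) /\
         ssum _ [seq smul H p.1 (S p.2) | p <- D a] = sscale H (eps a) (sone H))]].

Arguments is_hopf {k} H D eps S.

Definition involutive_antipode (k : fieldType) (H : salg k) (S : car H -> car H) : Prop :=
  forall a, smem H a -> S (S a) = a.

Arguments involutive_antipode {k} H S.

Definition left_ideal (k : fieldType) (H : salg k) (I : car H -> Prop) : Prop :=
  [/\ (forall x, I x -> smem H x), I (szero H),
      (forall x y, I x -> I y -> I (sadd H x y)),
      (forall c x, I x -> I (sscale H c x))
    & (forall h x, smem H h -> I x -> I (smul H h x))].

Arguments left_ideal {k} H I.

Definition semisimple_alg (k : fieldType) (H : salg k) : Prop :=
  forall I, left_ideal H I -> exists J, [/\ left_ideal H J,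
     (forall x, I x -> J x -> x = szero H)
   & (forall x, smem H x -> exists y z, [/\ I y, J z & x = sadd H y z])].

Arguments semisimple_alg {k} H.

Definition fin_dim (k : fieldType) (H : salg k) : Prop :=
  exists (d : nat) (e : 'I_d -> car H), (forall i, smem H (e i)) /\
    forall a, smem H a -> exists c : 'I_d -> k,
      a = ssum _ [seq sscale H (c i) (e i) | i <- enum 'I_d].

Arguments fin_dim {k} H.

Definition hopf_dual (k : fieldType) (A B : salg k)
  (DA : car A -> seq (car A * car A)) (epsA : car A -> k) (SA : car A -> car A)
  (DB : car B -> seq (car B * car B)) (epsB : car B -> k) (SB : car B -> car B)
  (p : car A -> car B -> k) : Prop :=
  [/\ fin_dim A,
      (forall b, smem B b -> lin_fun A (fun a => p a b)) /\
      (forall a, smem A a -> lin_fun B (p a)),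
      (forall a, smem A a -> (forall b, smem B b -> p a b = 0) -> a = szero A) /\
      (forall b, smem B b -> (forall a, smem A a -> p a b = 0) -> b = szero B),
      (forall a a' b, smem A a -> smem A a' -> smem B b ->
         p (smul A a a') b = \sum_(q <- DB b) p a q.1 * p a' q.2) /\
      (forall a b b', smem A a -> smem B b -> smem B b' ->
         p a (smul B b b') = \sum_(q <- DA a) p q.1 b * p q.2 b')
    & (forall a b, smem A a -> smem B b ->
         p (sone A) b = epsB b /\ p a (sone B) = epsA a) /\
      (forall a b, smem A a -> smem B b -> p (SA a) b = p a (SB b))].

Arguments hopf_dual {k} A B DA epsA SA DB epsB SB p.

Definition module_alg (k : fieldType) (H R : salg k)
  (DH : car H -> seq (car H * car H)) (epsH : car H -> k)
  (act : car H -> car R -> car R) : Prop :=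
  [/\ (forall h r, smem H h -> smem R r -> smem R (act h r)),
      (forall h h' r c, smem H h -> smem H h' -> smem R r ->
         act (sadd H h h') r = sadd R (act h r) (act h' r) /\
         act (sscale H c h) r = sscale R c (act h r)),
      (forall h r r' c, smem H h -> smem R r -> smem R r' ->
         act h (sadd R r r') = sadd R (act h r) (act h r') /\
         act h (sscale R c r) = sscale R c (act h r)),
      (forall h h' r, smem H h -> smem H h' -> smem R r ->
         act (smul H h h') r = act h (act h' r)) /\
      (forall r, smem R r -> act (sone H) r = r)
    & (forall h r r', smem H h -> smem R r -> smem R r' ->
         act h (smul R r r') = ssum _ [seq smul R (act q.1 r) (act q.2 r') | q <- DH h]) /\
      (forall h, smem H h -> act h (sone R) = sscale R (epsH h) (sone R))].

Arguments module_alg {k} H R DH epsH act.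

(* f : R x H -> T is k-bilinear and the induced map R # H -> T is an
   isomorphism of algebras, R # H being the smash product. *)
Definition smash_iso (k : fieldType) (R H T : salg k)
  (DH : car H -> seq (car H * car H)) (act : car H -> car R -> car R)
  (f : car R -> car H -> car T) : Prop :=
  [/\ (forall r h, smem R r -> smem H h -> smem T (f r h)),
      (forall r r' h c, smem R r -> smem R r' -> smem H h ->
         f (sadd R r r') h = sadd T (f r h) (f r' h) /\
         f (sscale R c r) h = sscale T c (f r h)),
      (forall r h h' c, smem R r -> smem H h -> smem H h' ->
         f r (sadd H h h') = sadd T (f r h) (f r h') /\
         f r (sscale H c h) = sscale T c (f r h)),
      (forall t, tens_in R H t -> ssum _ [seq f p.1 p.2 | p <- t] = szero T -> tens_eq R H t [::]) /\
      (forall x, smem T x -> exists t, tens_in R H t /\ x = ssum _ [seq f p.1 p.2 | p <- t])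
    &
      (forall r h r' h', smem R r -> smem H h -> smem R r' -> smem H h' ->
         smul T (f r h) (f r' h') =
         ssum _ [seq f (smul R r (act q.1 r')) (smul H q.2 h') | q <- DH h])
      /\ f (sone R) (sone H) = sone T].

Arguments smash_iso {k} R H T DH act f.

Definition is_unital_subalg (k : fieldType) (M : algType k) (N : M -> Prop) : Prop :=
  [/\ N 1, (forall a b, N a -> N b -> N (a + b) /\ N (a * b)),
      (forall a, N a -> N (- a)) & (forall (c : k) a, N a -> N (c *: a))].

Definition centralizer_trivial (k : fieldType) (M : algType k) (N : M -> Prop) : Prop :=
  forall r : M, (forall n, N n -> r * n = n * r) -> exists c : k, r = c%:A.

Definition strongly_sep_irred (k : fieldType) (M : algType k) (N : M -> Prop)
  (E : M -> M) (m : nat) (x y : 'I_m -> M) : Prop :=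
  [/\ centralizer_trivial N,
      (forall a, N (E a)) /\ (forall a b, E (a + b) = E a + E b),
      (forall n n' a, N n -> N n' -> E (n * a * n') = n * E a * n'),
      (forall a, \sum_(i < m) E (a * x i) * y i = a /\ \sum_(i < m) x i * E (y i * a) = a)
    & E 1 != 0 /\ \sum_(i < m) x i * y i != 0].

Definition Malg (k : fieldType) (M : algType k) : salg k :=
  @SAlg k M (fun _ => True) 0 +%R ( *:%R) *%R 1.

(* M1 = M (x)_N M, realised as End(M_N) (right N-linear endomorphisms of M),*)
(* with M embedded by left multiplication.                                  *)
Definition Lmul (k : fieldType) (M : algType k) (r : M) : M -> M := fun a => r * a.

Definition M1set (k : fieldType) (M : algType k) (N : M -> Prop) (f : M -> M) : Prop :=
  (forall a b, f (a + b) = f a + f b) /\ (forall a n, N n -> f (a * n) = f a * n).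

Definition zero1 (k : fieldType) (M : algType k) : M -> M := fun _ => 0.
Definition add1 (k : fieldType) (M : algType k) (f g : M -> M) : M -> M := fun a => f a + g a.
Definition scale1 (k : fieldType) (M : algType k) (c : k) (f : M -> M) : M -> M :=
  fun a => c *: f a.

Definition Aset (k : fieldType) (M : algType k) (N : M -> Prop) (f : M -> M) : Prop :=
  M1set N f /\ (forall n, N n -> f \o Lmul n = Lmul n \o f).

Definition M1alg (k : fieldType) (M : algType k) (N : M -> Prop) : salg k :=
  @SAlg k (M -> M) (M1set N) (@zero1 k M) (@add1 k M) (@scale1 k M)
        (fun f g => f \o g) (fun a => a).

Definition Aalg (k : fieldType) (M : algType k) (N : M -> Prop) : salg k :=
  @SAlg k (M -> M) (Aset N) (@zero1 k M) (@add1 k M) (@scale1 k M)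
        (fun f g => f \o g) (fun a => a).

(* M2 = M1 (x)_M M1, realised as End(M1_M); an element is a map on M -> M
   that vanishes outside M1 (so that Leibniz equality is equality in M2).
   M1 is embedded by left composition. *)
Definition M2set (k : fieldType) (M : algType k) (N : M -> Prop)
    (F : (M -> M) -> (M -> M)) : Prop :=
  [/\ (forall f, ~ M1set N f -> F f = @zero1 k M),
      (forall f, M1set N f -> M1set N (F f)),
      (forall f g, M1set N f -> M1set N g -> F (add1 f g) = add1 (F f) (F g))
    & (forall f a, M1set N f -> F (f \o Lmul a) = F f \o Lmul a)].

Definition zero2 (k : fieldType) (M : algType k) : (M -> M) -> (M -> M) :=
  fun _ => @zero1 k M.
Definition add2 (k : fieldType) (M : algType k) (F G : (M -> M) -> (M -> M)) :
  (M -> M) -> (M -> M) := fun f => add1 (F f) (G f).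
Definition scale2 (k : fieldType) (M : algType k) (c : k) (F : (M -> M) -> (M -> M)) :
  (M -> M) -> (M -> M) := fun f => scale1 c (F f).
Definition L1 (k : fieldType) (M : algType k) (N : M -> Prop) (r : M -> M) :
  (M -> M) -> (M -> M) :=
  fun f => if excluded_middle_informative (M1set N f) then r \o f else @zero1 k M.
Definition one2 (k : fieldType) (M : algType k) (N : M -> Prop) :
  (M -> M) -> (M -> M) := L1 N (fun a => a).

Definition Bset (k : fieldType) (M : algType k) (N : M -> Prop)
    (F : (M -> M) -> (M -> M)) : Prop :=
  M2set N F /\ (forall a : M, F \o L1 N (Lmul a) = L1 N (Lmul a) \o F).

Definition M2alg (k : fieldType) (M : algType k) (N : M -> Prop) : salg k :=
  @SAlg k ((M -> M) -> (M -> M)) (M2set N) (@zero2 k M) (@add2 k M) (@scale2 k M)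
        (fun F G => F \o G) (one2 N).

Definition Balg (k : fieldType) (M : algType k) (N : M -> Prop) : salg k :=
  @SAlg k ((M -> M) -> (M -> M)) (Bset N) (@zero2 k M) (@add2 k M) (@scale2 k M)
        (fun F G => F \o G) (one2 N).

Definition depth2 (k : fieldType) (M : algType k) (N : M -> Prop) : Prop :=
  (exists (d : nat) (u : 'I_d -> M -> M),
     [/\ (forall j, Aset N (u j)),
         (forall f, M1set N f -> exists c : 'I_d -> M,
            f = \big[@add1 k M/@zero1 k M]_(j < d) (u j \o Lmul (c j)))
       & (forall c : 'I_d -> M,
            \big[@add1 k M/@zero1 k M]_(j < d) (u j \o Lmul (c j)) = @zero1 k M ->
            forall j, c j = 0)]) /\
  (exists (d : nat) (v : 'I_d -> (M -> M) -> (M -> M)),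
     [/\ (forall j, Bset N (v j)),
         (forall F, M2set N F -> exists c : 'I_d -> M -> M,
            (forall j, M1set N (c j)) /\
            F = \big[@add2 k M/@zero2 k M]_(j < d) (v j \o L1 N (c j)))
       & (forall c : 'I_d -> M -> M, (forall j, M1set N (c j)) ->
            \big[@add2 k M/@zero2 k M]_(j < d) (v j \o L1 N (c j)) = @zero2 k M ->
            forall j, c j = @zero1 k M)]).

(* Main.v *)
(* Depth 2 makes M_1 both a free right and a free left M-module on A, so that
   a (m m') = sum a_(1)(m) a_(2)(m') for a in A and m, m' in M defines a coproduct
   on A; the counit is a |-> a(1), and the antipode is the transpose for the form
   E(m m').  A left inverse of the identity in the finite dimensional convolution
   algebra is two-sided, so A is a Hopf algebra.  The expectation E, seen in A, is
   an integral of A and E_M restricts to an integral of the dual, so A is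
   semisimple and cosemisimple.  The M-bimodule endomorphisms of M_1 are determined by
   their restrictions to A, which are the maps a |-> a_(1) b(a_(2)) with b in the dual of A;
   this identifies B with that dual.  All actions are evaluations.

   That S^2 = 1 is the Etingof-Gelaki theorem.  In characteristic 0 it is the theorem
   of Larson and Radford, proved by traces.  In characteristic p one lifts A to
   characteristic 0: averaging over the integrals contracts the complexes that contain
   the obstructions, so A lifts, up to Frobenius twists, to a ring Q with p^N = 0 for
   each N; the product of these rings has a quotient domain of characteristic 0. *)
From Stdlib Require ClassicalEpsilon.
Require Import Defs.
From HB Require Import structures.
From mathcomp Require Import all_boot all_algebra all_fingroup ring zify.
From mathcomp Require Import boolp classical_sets.
From mathcomp.multinomials Require monalg.
Set Implicit Arguments.
Unset Strict Implicit.
Unset Printing Implicit Defensive.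
Import GRing.Theory.
Local Open Scope ring_scope.

(** * Structure constants and Sweedler sums *)

(** Hopf algebras are carried by structure constants on row vectors over any commutative ring, since
    the lifts live over rings with torsion and zero divisors. Every axiom is a scalar identity,
    obtained by pairing with a functional, so exchanging [mu] and [nu] is duality. The unit and the
    counit are a basis vector and hold strictly throughout the deformation; only associativity,
    coassociativity and compatibility meet obstructions.

    The field k may be imperfect, so Witt vectors are replaced by quotients Z[k]/I^N of a monoid
    ring, I being the kernel of evaluation in k. The price is that each step of the lift twists the
    structure constants by an endomorphism of k. This is harmless: the goal is to contradict a
    nonzero entry of S^2 - 1, and field endomorphisms are injective. The integrals are not lifted:
    tr(S^2) is the inverse of their pairing, its lift is again a unit, and the trace formula for
    integrals recovers them in characteristic 0.

    S^2 = 1 serves a second time in M_2 = M_1 # B, whose inverse needs a_(2) S(a_(1)) and S(a_(2))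
    a_(1) to collapse. *)

Section Coordinates.
Variables (F : comNzRingType) (n : nat).
Local Notation V := 'rV[F]_n.+1.
Local Notation tensor := ('I_n.+1 -> 'I_n.+1 -> V).
Implicit Types (a b : V) (m mu nu : tensor).

Definition ev (i : 'I_n.+1) : V := delta_mx 0 i.
Definition pr a (f : V) : F := \sum_i a 0 i * f 0 i.
Definition pm m a b : V := \sum_i \sum_j (a 0 i * b 0 j) *: m i j.
(* Sweedler notation: [sw nu a B] is the sum of [B a_(1) a_(2)], the coproduct
   being the transpose of the product [pm nu] of the dual space. *)
Definition sw nu a (B : V -> V -> F) : F :=
  \sum_i \sum_j pr a (nu i j) * B (ev i) (ev j).

Definition lin (f : V -> F) := forall c x y, f (c *: x + y) = c * f x + f y.
Definition vlin (f : V -> V) := forall c x y, f (c *: x + y) = c *: f x + f y.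

Lemma ev_sum a : a = \sum_i a 0 i *: ev i.
Proof. exact: row_sum_delta. Qed.

Lemma evE i j : ev i 0 j = (j == i)%:R.
Proof. by rewrite mxE eqxx. Qed.

Lemma prC a f : pr a f = pr f a.
Proof. by apply: eq_bigr => i _; rewrite mulrC. Qed.

Lemma pr_evl i f : pr (ev i) f = f 0 i.
Proof.
rewrite /pr (bigD1 i) //= evE eqxx mul1r big1 ?addr0 // => j /negPf ji.
by rewrite evE ji mul0r.
Qed.

Lemma pr_evr i f : pr f (ev i) = f 0 i.
Proof. by rewrite prC pr_evl. Qed.

Lemma pr_ext a b : (forall f, pr a f = pr b f) -> a = b.
Proof. by move=> h; apply/rowP=> i; rewrite -!pr_evr h. Qed.

Lemma lin0 f : lin f -> f 0 = 0.
Proof. by move=> hf; have := hf (-1) 0 0; rewrite scaler0 addr0 mulN1r addNr. Qed.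
Lemma linD f : lin f -> forall x y, f (x + y) = f x + f y.
Proof. by move=> hf x y; rewrite -[x]scale1r hf mul1r scale1r. Qed.
Lemma linZ f : lin f -> forall c x, f (c *: x) = c * f x.
Proof. by move=> hf c x; rewrite -[c *: x]addr0 hf lin0 // addr0. Qed.
Lemma lin_sum f : lin f -> forall I (r : seq I) (P : pred I) (v : I -> V),
  f (\sum_(i <- r | P i) v i) = \sum_(i <- r | P i) f (v i).
Proof. by move=> hf I r P v; apply: big_morph; [exact: linD | exact: lin0]. Qed.
Lemma lin_ev f : lin f -> forall a, f a = \sum_i a 0 i * f (ev i).
Proof.
by move=> hf a; rewrite {1}(ev_sum a) lin_sum //; apply: eq_bigr => i _; rewrite linZ.
Qed.
Lemma vlin0 f : vlin f -> f 0 = 0.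
Proof. by move=> hf; have := hf (-1) 0 0; rewrite scaler0 addr0 scaleN1r addNr. Qed.
Lemma vlinD f : vlin f -> forall x y, f (x + y) = f x + f y.
Proof. by move=> hf x y; rewrite -[x]scale1r hf !scale1r. Qed.
Lemma vlinZ f : vlin f -> forall c x, f (c *: x) = c *: f x.
Proof. by move=> hf c x; rewrite -[c *: x]addr0 hf vlin0 // addr0. Qed.
Lemma vlin_sum f : vlin f -> forall I (r : seq I) (P : pred I) (v : I -> V),
  f (\sum_(i <- r | P i) v i) = \sum_(i <- r | P i) f (v i).
Proof. by move=> hf I r P v; apply: big_morph; [exact: vlinD | exact: vlin0]. Qed.
Lemma vlin_ev f : vlin f -> forall a, f a = \sum_i a 0 i *: f (ev i).
Proof.
by move=> hf a; rewrite {1}(ev_sum a) vlin_sum //; apply: eq_bigr => i _; rewrite vlinZ.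
Qed.

Lemma lin_ext f g : lin f -> lin g -> (forall i, f (ev i) = g (ev i)) -> f =1 g.
Proof. by move=> hf hg h a; rewrite lin_ev // [RHS]lin_ev //; apply: eq_bigr => i _; rewrite h. Qed.

Lemma lin_id_pr f : lin (fun x => pr x f).
Proof.
move=> c x y; rewrite /pr mulr_sumr -big_split /=; apply: eq_bigr => i _.
by rewrite !mxE mulrDl mulrA.
Qed.
Lemma prZl k a f : pr (k *: a) f = k * pr a f.
Proof. by rewrite (linZ (lin_id_pr f)). Qed.
Lemma prZr k a f : pr f (k *: a) = k * pr f a.
Proof. by rewrite prC prZl prC. Qed.
Lemma vlin_id : vlin (fun x => x). Proof. by []. Qed.
Lemma lin_comp f g : lin f -> vlin g -> lin (fun x => f (g x)).
Proof. by move=> hf hg c x y; rewrite hg hf. Qed.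
Lemma lin_prl g f : vlin g -> lin (fun x => pr (g x) f).
Proof. by move=> hg c x y; rewrite hg lin_id_pr. Qed.
Lemma lin_prr g f : vlin g -> lin (fun x => pr f (g x)).
Proof. by move=> hg c x y; rewrite !(prC f); apply: lin_prl. Qed.
Lemma lin_mulr (f : V -> F) k : lin f -> lin (fun x => f x * k).
Proof. by move=> hf c x y; rewrite hf mulrDl mulrA. Qed.
Lemma lin_mull (f : V -> F) k : lin f -> lin (fun x => k * f x).
Proof. by move=> hf c x y; rewrite hf mulrDr mulrCA. Qed.
Lemma lin_add (f g : V -> F) : lin f -> lin g -> lin (fun x => f x + g x).
Proof. by move=> hf hg c x y; rewrite hf hg mulrDr addrACA. Qed.
Lemma lin_opp (f : V -> F) : lin f -> lin (fun x => - f x).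
Proof. by move=> hf c x y; rewrite hf opprD mulrN. Qed.
Lemma lin_bigsum I (r : seq I) (P : pred I) (G : V -> I -> F) :
  (forall i, lin (fun x => G x i)) -> lin (fun x => \sum_(i <- r | P i) G x i).
Proof.
move=> hG c x y; rewrite mulr_sumr -big_split /=.
by apply: eq_bigr => i _; apply: hG.
Qed.
Lemma vlin_pml m g b : vlin g -> vlin (fun x => pm m (g x) b).
Proof.
move=> hg c x y; rewrite hg /pm scaler_sumr -big_split /=.
apply: eq_bigr => i _; rewrite scaler_sumr -big_split /=.
by apply: eq_bigr => j _; rewrite !mxE mulrDl scalerDl scalerA mulrA.
Qed.
Lemma vlin_pmr m g b : vlin g -> vlin (fun x => pm m b (g x)).
Proof.
move=> hg c x y; rewrite hg /pm scaler_sumr -big_split /=.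
apply: eq_bigr => i _; rewrite scaler_sumr -big_split /=.
by apply: eq_bigr => j _; rewrite !mxE mulrDr scalerDl scalerA mulrCA.
Qed.
Lemma vlin_mx g (A : 'M[F]_n.+1) : vlin g -> vlin (fun x => g x *m A).
Proof. by move=> hg c x y; rewrite hg mulmxDl scalemxAl. Qed.
Lemma vlin_add g h : vlin g -> vlin h -> vlin (fun x => g x + h x).
Proof. by move=> hg hh c x y; rewrite hg hh scalerDr addrACA. Qed.
Lemma vlin_sub g h : vlin g -> vlin h -> vlin (fun x => g x - h x).
Proof. by move=> hg hh c x y; rewrite hg hh scalerBr opprD addrACA. Qed.
Lemma vlin_scale g k : vlin g -> vlin (fun x => k *: g x).
Proof. by move=> hg c x y; rewrite hg scalerDr !scalerA mulrC. Qed.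
Lemma lin_swarg nu g B : vlin g -> lin (fun x => sw nu (g x) B).
Proof.
move=> hg; rewrite /sw; apply: lin_bigsum => i; apply: lin_bigsum => j.
by apply: lin_mulr; apply: lin_prl.
Qed.
Lemma lin_swbody nu a (B : V -> V -> V -> F) :
  (forall u v, lin (fun x => B x u v)) -> lin (fun x => sw nu a (B x)).
Proof.
move=> hB; rewrite /sw; apply: lin_bigsum => i; apply: lin_bigsum => j.
by apply: lin_mull.
Qed.

Lemma eq_sw nu a B B' : (forall x y, B x y = B' x y) -> sw nu a B = sw nu a B'.
Proof. by move=> h; apply: eq_bigr => i _; apply: eq_bigr => j _; rewrite h. Qed.

Lemma sw_pr nu a f g : sw nu a (fun x y => pr x f * pr y g) = pr a (pm nu f g).
Proof.
have h : lin (pr a) by apply: lin_prr; apply: vlin_id.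
rewrite /pm lin_sum //; apply: eq_bigr => i _; rewrite lin_sum //.
by apply: eq_bigr => j _; rewrite linZ // !pr_evl mulrC.
Qed.

Lemma sw_swap nu nu' a b (B : V -> V -> V -> V -> F) :
  sw nu a (fun x y => sw nu' b (fun z w => B x y z w)) =
  sw nu' b (fun z w => sw nu a (fun x y => B x y z w)).
Proof.
rewrite /sw.
under eq_bigr => i _ do under eq_bigr => j _ do
  (rewrite mulr_sumr; under eq_bigr => k _ do rewrite mulr_sumr).
under [RHS]eq_bigr => i _ do under eq_bigr => j _ do
  (rewrite mulr_sumr; under eq_bigr => k _ do rewrite mulr_sumr).
under eq_bigr => i _ do rewrite exchange_big.
rewrite exchange_big; apply: eq_bigr => i _ /=.
under eq_bigr => k _ do rewrite exchange_big.
rewrite exchange_big; apply: eq_bigr => j _ /=.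
by apply: eq_bigr => k _; apply: eq_bigr => l _; rewrite mulrCA.
Qed.

Lemma sw_mull nu a k B : sw nu a (fun x y => k * B x y) = k * sw nu a B.
Proof.
rewrite /sw mulr_sumr; apply: eq_bigr => i _; rewrite mulr_sumr.
by apply: eq_bigr => j _; rewrite mulrCA.
Qed.
Lemma sw_mulr nu a k B : sw nu a (fun x y => B x y * k) = sw nu a B * k.
Proof. by rewrite mulrC -sw_mull; apply: eq_sw => x y; rewrite mulrC. Qed.
Lemma sw_add nu a B B' : sw nu a (fun x y => B x y + B' x y) = sw nu a B + sw nu a B'.
Proof.
rewrite /sw -big_split; apply: eq_bigr => i _ /=; rewrite -big_split.
by apply: eq_bigr => j _ /=; rewrite mulrDr.
Qed.
Lemma sw_opp nu a B : sw nu a (fun x y => - B x y) = - sw nu a B.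
Proof. by rewrite -mulN1r -sw_mull; apply: eq_sw => x y; rewrite mulN1r. Qed.
Lemma sw_0 nu a : sw nu a (fun _ _ => 0) = 0.
Proof. by rewrite /sw big1 // => i _; rewrite big1 // => j _; rewrite mulr0. Qed.

(** [lact m f a] is the functional z |-> f(a z), and [ract m a f] is z |-> f(z a). For [nu], with
    vectors and functionals exchanged, [lact nu a f] is the sum of f(a_(1)) a_(2) and [ract nu f a]
    the sum of a_(1) f(a_(2)). *)
Definition lact m (f : V) a : V := \row_i pr (pm m a (ev i)) f.
Definition ract m a (f : V) : V := \row_i pr (pm m (ev i) a) f.

Lemma pr_row (f : V -> F) : lin f -> forall z, pr z (\row_i f (ev i)) = f z.
Proof. by move=> hf z; rewrite (lin_ev hf); apply: eq_bigr => i _; rewrite mxE. Qed.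

Lemma pr_lact m z f a : pr z (lact m f a) = pr (pm m a z) f.
Proof. by rewrite /lact (pr_row (f := fun z => pr (pm m a z) f)) //; apply: lin_prl; apply: vlin_pmr. Qed.
Lemma pr_ract m z f a : pr z (ract m a f) = pr (pm m z a) f.
Proof. by rewrite /ract (pr_row (f := fun z => pr (pm m z a) f)) //; apply: lin_prl; apply: vlin_pml. Qed.

Lemma vlin_lactl m g a : vlin g -> vlin (fun x => lact m (g x) a).
Proof. by move=> hg c x y; apply/rowP=> i; rewrite !mxE hg !(prC (pm _ _ _)) lin_id_pr. Qed.
Lemma vlin_lactr m g f : vlin g -> vlin (fun x => lact m f (g x)).
Proof.
move=> hg c x y; apply/rowP=> i; rewrite !mxE.
by have /= -> := vlin_pml m (ev i) hg c x y; rewrite lin_id_pr.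
Qed.
Lemma vlin_ractl m g f : vlin g -> vlin (fun x => ract m (g x) f).
Proof.
move=> hg c x y; apply/rowP=> i; rewrite !mxE.
by have /= -> := vlin_pmr m (ev i) hg c x y; rewrite lin_id_pr.
Qed.
Lemma vlin_ractr m g a : vlin g -> vlin (fun x => ract m a (g x)).
Proof. by move=> hg c x y; apply/rowP=> i; rewrite !mxE hg !(prC (pm _ _ _)) lin_id_pr. Qed.

Lemma pm_ev m i j : pm m (ev i) (ev j) = m i j.
Proof.
rewrite /pm (bigD1 i) //= (bigD1 j) //= !evE !eqxx mul1r scale1r.
rewrite big1 ?addr0 ?big1 ?addr0 // => [k /negPf hk|k /negPf hk].
  by rewrite big1 // => l _; rewrite evE hk mul0r scale0r.
by rewrite !evE hk mulr0 scale0r.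
Qed.
End Coordinates.

(** The step through hypotheses of the context handles abstract multilinear forms. For its sake the
    sections below restate linearity of such a form after precomposition with a [vlin] map (the
    local facts [l1], [l2], ...). *)
Ltac lin_step :=
  first
  [ assumption
  | match goal with H : forall _, _ |- _ => apply H end
  | apply vlin_id
  | apply vlin_pml | apply vlin_pmr | apply vlin_mx
  | apply vlin_lactl | apply vlin_lactr | apply vlin_ractl | apply vlin_ractr
  | apply vlin_sub | apply vlin_add | apply vlin_scale
  | apply lin_prl | apply lin_prr
  | apply lin_swarg
  | apply lin_mulr | apply lin_mull | apply lin_add | apply lin_opp
  | apply lin_swbody; intros
  | apply lin_bigsum; intros ].
Ltac lin_tac := intros; solve [repeat lin_step].

(** * Hopf algebras in coordinates *)

Section Bialgebra.
Variables (F : comNzRingType) (n : nat).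
Local Notation V := 'rV[F]_n.+1.
Local Notation tensor := ('I_n.+1 -> 'I_n.+1 -> V).
Local Notation o := (ev F (ord0 : 'I_n.+1)).

(* The unit and the counit are both the first basis vector: bases are chosen
   with [e_0 = 1] and the other vectors in the kernel of the counit. *)
Record bialg (mu nu : tensor) : Prop := Bialg {
  muA : forall a b c, pm mu (pm mu a b) c = pm mu a (pm mu b c);
  nuA : forall f g h, pm nu (pm nu f g) h = pm nu f (pm nu g h);
  mu1l : forall a, pm mu o a = a;
  mu1r : forall a, pm mu a o = a;
  nu1l : forall f, pm nu o f = f;
  nu1r : forall f, pm nu f o = f;
  epsM : forall a b, pr (pm mu a b) o = pr a o * pr b o;
  oneM : forall f g, pr o (pm nu f g) = pr o f * pr o g;
  mu_nu : forall a b f g, pr (pm mu a b) (pm nu f g) =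
    sw nu a (fun a1 a2 => sw nu b (fun b1 b2 =>
      pr (pm mu a1 b1) f * pr (pm mu a2 b2) g)) }.

Record hopf (mu nu : tensor) (S : 'M[F]_n.+1) : Prop := Hopf {
  hopf_bialg : bialg mu nu;
  antil : forall a f, sw nu a (fun x y => pr (pm mu (x *m S) y) f) = pr a o * pr o f;
  antir : forall a f, sw nu a (fun x y => pr (pm mu x (y *m S)) f) = pr a o * pr o f }.

(* Normalized two-sided integrals of the algebra and of its dual, that is,
   semisimplicity and cosemisimplicity. *)
Record hopf_int (mu nu : tensor) (S : 'M[F]_n.+1) (t tau : V) (lam li : F) : Prop :=
  HopfInt {
  hint_hopf : hopf mu nu S;
  int_left : forall a, pm mu a t = pr a o *: t;
  int_right : forall a, pm mu t a = pr a o *: t;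
  int1 : pr t o = 1;
  cointl : forall f, pm nu f tau = pr o f *: tau;
  cointr : forall f, pm nu tau f = pr o f *: tau;
  coint1 : pr o tau = 1;
  int_lam : pr t tau = lam;
  lamV : lam * li = 1 }.

Lemma pr_mx (a f : V) (S : 'M[F]_n.+1) : pr (a *m S) f = pr a (f *m S^T).
Proof.
rewrite /pr; under eq_bigr => i _ do rewrite mxE mulr_suml.
rewrite exchange_big; apply: eq_bigr => i _ /=; rewrite mxE mulr_sumr.
by apply: eq_bigr => j _; rewrite mxE mulrAC mulrA.
Qed.

Lemma sw_compat_ev (mu nu : tensor) a b f g :
  sw nu a (fun a1 a2 => sw nu b (fun b1 b2 =>
      pr (pm mu a1 b1) f * pr (pm mu a2 b2) g)) =
  \sum_i \sum_j \sum_k \sum_l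
     pr a (nu i j) * pr b (nu k l) * (pr f (mu i k) * pr g (mu j l)).
Proof.
rewrite /sw; apply: eq_bigr => i _; apply: eq_bigr => j _.
rewrite mulr_sumr; apply: eq_bigr => k _; rewrite mulr_sumr.
by apply: eq_bigr => l _; rewrite !pm_ev mulrA !(prC (mu _ _)).
Qed.

(** The axioms come in dual pairs and [mu_nu] is symmetric in the structure constants, so exchanging
    the tensors gives the dual bialgebra. Through this, [hopf_swap] and [hopf_int_swap], results on
    the product become results on the coproduct. *)
Lemma bialg_swap mu nu : bialg mu nu -> bialg nu mu.
Proof.
case=> h1 h2 h3 h4 h5 h6 h7 h8 h9; split=> //.
- by move=> a b; rewrite prC h8 !(prC o).
- by move=> a b; rewrite prC h7 !(prC o).
move=> f g a b; rewrite prC h9 !sw_compat_ev.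
apply: eq_bigr => i _.
rewrite exchange_big /=.
apply: eq_bigr => j _; apply: eq_bigr => k _; apply: eq_bigr => l _.
by rewrite mulrC.
Qed.


Lemma lin_dual (f : V -> F) (v : V) : lin f -> \sum_i pr v (ev F i) * f (ev F i) = f v.
Proof. by move=> hf; rewrite [RHS]lin_ev //; apply: eq_bigr => i _; rewrite pr_evr. Qed.

Lemma sw_anti_ev (mu nu : tensor) (S : 'M[F]_n.+1) a f :
  sw nu a (fun x y => pr (pm mu (x *m S) y) f) =
  \sum_i \sum_j \sum_k pr a (nu i j) * (S i k * pr f (mu k j)).
Proof.
apply: eq_bigr => i _; apply: eq_bigr => j _; rewrite -mulr_sumr; congr (_ * _).
have hl : lin (fun x => pr (pm mu x (ev F j)) f) by lin_tac.
rewrite (lin_ev hl); apply: eq_bigr => k _.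
by rewrite pm_ev prC -rowE mxE.
Qed.

Lemma anti_swap (mu nu : tensor) (S : 'M[F]_n.+1) a f :
  sw nu a (fun x y => pr (pm mu (x *m S) y) f) =
  sw mu f (fun x y => pr (pm nu (x *m S^T) y) a).
Proof.
rewrite !sw_anti_ev.
under [RHS]eq_bigr => i _ do rewrite exchange_big /=.
rewrite [RHS]exchange_big /=.
under [RHS]eq_bigr => i _ do rewrite exchange_big /=.
apply: eq_bigr => i _; apply: eq_bigr => j _; apply: eq_bigr => k _.
by rewrite mxE mulrCA mulrA mulrC.
Qed.

Lemma antir_ev (mu nu : tensor) (S : 'M[F]_n.+1) a f :
  sw nu a (fun x y => pr (pm mu x (y *m S)) f) =
  \sum_i \sum_j \sum_k pr a (nu i j) * (S j k * pr f (mu i k)).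
Proof.
apply: eq_bigr => i _; apply: eq_bigr => j _; rewrite -mulr_sumr; congr (_ * _).
have hl : lin (fun x => pr (pm mu (ev F i) x) f) by lin_tac.
rewrite (lin_ev hl); apply: eq_bigr => k _.
by rewrite pm_ev prC -rowE mxE.
Qed.

Lemma antir_swap (mu nu : tensor) (S : 'M[F]_n.+1) a f :
  sw nu a (fun x y => pr (pm mu x (y *m S)) f) =
  sw mu f (fun x y => pr (pm nu x (y *m S^T)) a).
Proof.
rewrite !antir_ev; apply: eq_bigr => i _.
rewrite [RHS]exchange_big; apply: eq_bigr => j _; apply: eq_bigr => k _.
by rewrite mxE mulrCA mulrA mulrC.
Qed.

Lemma hopf_swap mu nu S : hopf mu nu S -> hopf nu mu S^T.
Proof.
case=> hb hl hr; split; first exact: bialg_swap.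
  by move=> a f; rewrite -anti_swap hl mulrC !(prC o).
by move=> a f; rewrite -antir_swap hr mulrC !(prC o).
Qed.

Lemma hopf_int_swap mu nu S t tau lam li :
  hopf_int mu nu S t tau lam li -> hopf_int nu mu S^T tau t lam li.
Proof.
case=> hh h1 h2 h3 h4 h5 h6 h7 h8; split; rewrite ?(prC tau) ?(prC _ t) //.
- exact: hopf_swap.
- by move=> a; rewrite h4 prC.
- by move=> a; rewrite h5 prC.
- by move=> a; rewrite h1 prC.
- by move=> a; rewrite h2 prC.
Qed.

Lemma bilin_ev (B : V -> V -> F) u v :
  (forall y, lin (fun x => B x y)) -> (forall x, lin (B x)) ->
  B u v = \sum_i \sum_j pr u (ev F i) * pr v (ev F j) * B (ev F i) (ev F j).
Proof.
move=> h1 h2; rewrite (lin_ev (h1 v)); apply: eq_bigr => i _.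
rewrite (lin_ev (h2 _)) mulr_sumr; apply: eq_bigr => j _.
by rewrite !pr_evr mulrA.
Qed.

Section Sweedler.
Variables (mu nu : tensor) (hb : bialg mu nu).

Lemma sw_coassoc a (T : V -> V -> V -> F) :
  sw nu a (fun x y => sw nu x (fun x1 x2 => T x1 x2 y)) =
  sw nu a (fun x y => sw nu y (fun y1 y2 => T x y1 y2)).
Proof.
have aux (B : V -> V -> F) v :
    sw nu v B = \sum_i \sum_j pr v (pm nu (ev F i) (ev F j)) * B (ev F i) (ev F j).
  by apply: eq_bigr => i _; apply: eq_bigr => j _; rewrite pm_ev.
rewrite !aux.
under eq_bigr => i _ do under eq_bigr => j _ do
  (rewrite aux mulr_sumr; under eq_bigr => k _ do rewrite mulr_sumr).
under [RHS]eq_bigr => i _ do under eq_bigr => j _ do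
  (rewrite aux mulr_sumr; under eq_bigr => k _ do rewrite mulr_sumr).
have dist (G : 'I_n.+1 -> V) (H : V -> F) (v : V) : lin H ->
    \sum_i pr (ev F i) v * H (ev F i) = H v.
  by move=> hH; rewrite -[RHS](lin_dual _ hH); apply: eq_bigr => i _; rewrite prC.
transitivity (\sum_j \sum_k \sum_l
   pr a (pm nu (pm nu (ev F k) (ev F l)) (ev F j)) * T (ev F k) (ev F l) (ev F j)).
  rewrite exchange_big /=; apply: eq_bigr => j _.
  rewrite exchange_big /=; apply: eq_bigr => k _.
  rewrite exchange_big /=; apply: eq_bigr => l _.
  under eq_bigr => i _ do rewrite mulrA.
  rewrite -mulr_suml; congr (_ * _).
  have hl : lin (fun x => pr a (pm nu x (ev F j))) by lin_tac.
  by rewrite -[RHS](lin_dual _ hl); apply: eq_bigr => i _; rewrite mulrC prC.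
transitivity (\sum_i \sum_k \sum_l
   pr a (pm nu (ev F i) (pm nu (ev F k) (ev F l))) * T (ev F i) (ev F k) (ev F l)).
  rewrite exchange_big /=; apply: eq_bigr => k _.
  rewrite exchange_big /=; apply: eq_bigr => l _.
  by apply: eq_bigr => j _; rewrite (nuA hb).
apply: eq_bigr => i _.
rewrite [RHS]exchange_big /=; apply: eq_bigr => k _.
rewrite [RHS]exchange_big /=; apply: eq_bigr => l _.
under [RHS]eq_bigr => j _ do rewrite mulrA.
rewrite -mulr_suml; congr (_ * _).
have hl : lin (fun x => pr a (pm nu (ev F i) x)) by lin_tac.
by rewrite -[LHS](lin_dual _ hl); apply: eq_bigr => j _; rewrite mulrC; congr (_ * _); apply: prC.
Qed.

Lemma sw_counitl a (g : V -> F) : lin g -> sw nu a (fun x y => pr x o * g y) = g a.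
Proof.
move=> hg; rewrite /sw (bigD1 ord0) //= [X in _ + X]big1 => [|i i0].
  rewrite addr0 -[RHS](lin_dual _ hg); apply: eq_bigr => j _.
  by rewrite pr_evl evE eqxx mul1r -pm_ev (nu1l hb).
by rewrite big1 // => j _; rewrite pr_evl evE (negPf i0) mul0r mulr0.
Qed.

Lemma sw_counitr a (g : V -> F) : lin g -> sw nu a (fun x y => g x * pr y o) = g a.
Proof.
move=> hg; rewrite /sw exchange_big /= (bigD1 ord0) //= [X in _ + X]big1 => [|i i0].
  rewrite addr0 -[RHS](lin_dual _ hg); apply: eq_bigr => j _.
  by rewrite pr_evl evE eqxx mulr1 -pm_ev (nu1r hb).
by rewrite big1 // => j _; rewrite pr_evl evE (negPf i0) !mulr0.
Qed.

Lemma sw_mul a b (B : V -> V -> F) :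
  (forall y, lin (fun x => B x y)) -> (forall x, lin (B x)) ->
  sw nu (pm mu a b) B =
  sw nu a (fun a1 a2 => sw nu b (fun b1 b2 => B (pm mu a1 b1) (pm mu a2 b2))).
Proof.
move=> h1 h2; rewrite /(sw nu (pm mu a b)).
under eq_bigr => i _ do under eq_bigr => j _ do rewrite -pm_ev (mu_nu hb) mulrC.
under [RHS]eq_sw => x y do under eq_sw => z w do rewrite (bilin_ev _ _ h1 h2).
have swsum c (G : 'I_n.+1 -> V -> V -> F) :
    sw nu c (fun x y => \sum_i G i x y) = \sum_i sw nu c (G i).
  rewrite /sw; under eq_bigr => i _ do under eq_bigr => j _ do rewrite mulr_sumr.
  under eq_bigr => i _ do rewrite exchange_big /=.
  by rewrite exchange_big.
under [RHS]eq_sw => x y do (rewrite swsum; under eq_bigr => i _ do rewrite swsum).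
rewrite swsum; apply: eq_bigr => i _; rewrite swsum; apply: eq_bigr => j _.
rewrite -sw_mull; apply: eq_sw => x y; rewrite -sw_mull; apply: eq_sw => z w.
by rewrite mulrC.
Qed.

Lemma sw_one (B : V -> V -> F) :
  (forall y, lin (fun x => B x y)) -> (forall x, lin (B x)) ->
  sw nu o B = B o o.
Proof.
move=> h1 h2; rewrite [RHS](bilin_ev _ _ h1 h2).
apply: eq_bigr => i _; apply: eq_bigr => j _.
by rewrite -pm_ev (oneM hb).
Qed.

End Sweedler.
End Bialgebra.

(** * Antipodes and integrals *)

Section HopfTheory.
Variables (F : comNzRingType) (n : nat).
Local Notation V := 'rV[F]_n.+1.
Local Notation tensor := ('I_n.+1 -> 'I_n.+1 -> V).
Local Notation o := (ev F (ord0 : 'I_n.+1)).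

Lemma sw_sum (nu : tensor) c I (r : seq I) (P : pred I) (G : I -> V -> V -> F) :
  sw nu c (fun x y => \sum_(i <- r | P i) G i x y) = \sum_(i <- r | P i) sw nu c (G i).
Proof.
rewrite /sw; under eq_bigr => i _ do under eq_bigr => j _ do rewrite mulr_sumr.
under eq_bigr => i _ do rewrite exchange_big /=.
by rewrite exchange_big.
Qed.

Section Antipode.
Variables (mu nu : tensor) (S : 'M[F]_n.+1) (hh : hopf mu nu S).
Let hb := hopf_bialg hh.
Local Notation "a ** b" := (pm mu a b) (at level 40, left associativity).
Local Notation "\S a" := (a *m S) (at level 35, right associativity).

Lemma sw_antil a (g : V -> F) : lin g ->
  sw nu a (fun x y => g (\S x ** y)) = pr a o * g o.
Proof.
move=> hg; rewrite -(pr_row hg) -(antil hh); apply: eq_sw => x y.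
by rewrite pr_row.
Qed.

Lemma sw_antir a (g : V -> F) : lin g ->
  sw nu a (fun x y => g (x ** \S y)) = pr a o * g o.
Proof.
move=> hg; rewrite -(pr_row hg) -(antir hh); apply: eq_sw => x y.
by rewrite pr_row.
Qed.

Lemma pr_oo : pr o o = 1 :> F.
Proof. by rewrite pr_evl evE eqxx. Qed.

Lemma anti_one : \S o = o.
Proof.
apply: pr_ext => f; have := antil hh o f.
by rewrite (sw_one hb); [rewrite (mu1r hb) pr_oo mul1r|lin_tac|lin_tac].
Qed.

(** The sum of S(a_(1) b_(1)) a_(2) b_(2) S(b_(3)) S(a_(3)) collapses to S(a b) from the right and
    to S(b) S(a) from the left. *)
Lemma anti_mul a b : \S (a ** b) = \S b ** \S a.
Proof.
apply: pr_ext => f.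
pose Q (a1 a2 a3 b1 b2 b3 : V) :=
  pr (\S (a1 ** b1) ** a2 ** (b2 ** \S b3) ** \S a3) f.
transitivity (sw nu a (fun a1 r => sw nu r (fun a2 a3 => sw nu b (fun b1 s =>
  sw nu s (fun b2 b3 => Q a1 a2 a3 b1 b2 b3))))).
  under eq_sw => a1 r.
    under eq_sw => a2 a3.
      under eq_sw => b1 s.
        rewrite (sw_antir s (g := fun v => pr (\S (a1 ** b1) ** a2 ** v ** \S a3) f)); last by lin_tac.
        rewrite mulrC (mu1r hb); over.
      rewrite (sw_counitr hb _ (g := fun b1 => pr (\S (a1 ** b1) ** a2 ** \S a3) f)); last by lin_tac.
      rewrite (muA hb); over.
    rewrite (sw_antir r (g := fun v => pr (\S (a1 ** b) ** v) f)); last by lin_tac.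
    rewrite mulrC (mu1r hb); over.
  by rewrite (sw_counitr hb _ (g := fun a1 => pr (\S (a1 ** b)) f)); last by lin_tac.
rewrite -(sw_coassoc hb).
transitivity (sw nu a (fun r a3 => sw nu b (fun s b3 =>
  sw nu r (fun a1 a2 => sw nu s (fun b1 b2 => Q a1 a2 a3 b1 b2 b3))))).
  apply: eq_sw => r a3; rewrite [RHS]sw_swap; apply: eq_sw => a1 a2.
  by rewrite [RHS](sw_coassoc hb).
under eq_sw => r a3.
  under eq_sw => s b3.
    under eq_sw => a1 a2 do under eq_sw => b1 b2 do
      rewrite /Q !(muA hb) -(muA hb a2) -(muA hb (\S (a1 ** b1))).
    have /= <- := @sw_mul _ _ _ _ hb r s (fun x y => pr (\S x ** y ** (\S b3 ** \S a3)) f); [|lin_tac..].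
    rewrite (sw_antil _ (g := fun v => pr (v ** (\S b3 ** \S a3)) f)); last by lin_tac.
    rewrite (mu1l hb) (epsM hb) -mulrA mulrCA; over.
  rewrite (sw_counitl hb _ (g := fun b3 => pr r o * pr (\S b3 ** \S a3) f)); last by lin_tac.
  over.
by rewrite (sw_counitl hb _ (g := fun a3 => pr (\S b ** \S a3) f)); last by lin_tac.
Qed.
End Antipode.

Section Antipode2.
Variables (mu nu : tensor) (S : 'M[F]_n.+1) (hh : hopf mu nu S).
Let hb := hopf_bialg hh.
Let hs := hopf_swap hh.
Local Notation "a ** b" := (pm mu a b) (at level 40, left associativity).
Local Notation "\S a" := (a *m S) (at level 35, right associativity).


(** This is [anti_mul] for the dual Hopf algebra, read through transposition. *)
Lemma sw_anti a (B : V -> V -> F) :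
  (forall y, lin (fun x => B x y)) -> (forall x, lin (B x)) ->
  sw nu (\S a) B = sw nu a (fun x y => B (\S y) (\S x)).
Proof.
move=> h1 h2; under [RHS]eq_sw => x y do rewrite (bilin_ev _ _ h1 h2).
rewrite sw_sum; apply: eq_bigr => i _; rewrite sw_sum; apply: eq_bigr => j _.
rewrite -pm_ev pr_mx (anti_mul hs) -sw_pr -sw_mulr; apply: eq_sw => x y.
by rewrite !pr_mx mulrC [in RHS]mulrC (mulrC (pr y _)).
Qed.
End Antipode2.

Section Integrals.
Variables (mu nu : tensor) (S : 'M[F]_n.+1) (t tau : V) (lam li : F).
Hypothesis hi : hopf_int mu nu S t tau lam li.
Let hh := hint_hopf hi.
Let hb := hopf_bialg hh.
Local Notation "a ** b" := (pm mu a b) (at level 40, left associativity).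
Local Notation "\S a" := (a *m S) (at level 35, right associativity).

Lemma lam_inj (x y : F) : lam * x = lam * y -> x = y.
Proof.
by move=> h; rewrite -[x]mul1r -[y]mul1r -(lamV hi) (mulrC lam) -!mulrA h. Qed.

Lemma sw_cointl z (g : V -> F) : lin g ->
  sw nu z (fun x y => g x * pr y tau) = pr z tau * g o.
Proof.
move=> hg; under eq_sw => x y do rewrite -(pr_row hg).
by rewrite sw_pr (cointl hi) prZr pr_row // mulrC.
Qed.

Lemma sw_cointr z (g : V -> F) : lin g ->
  sw nu z (fun x y => pr x tau * g y) = pr z tau * g o.
Proof.
move=> hg; under eq_sw => x y do rewrite -(pr_row hg).
by rewrite sw_pr (cointr hi) prZr pr_row // mulrC.
Qed.

Section Casimir.
Variable B : V -> V -> F.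
Hypotheses (h1 : forall y, lin (fun x => B x y)) (h2 : forall x, lin (B x)).
Let l1 g y : vlin g -> lin (fun x => B (g x) y).
Proof. exact: (lin_comp (h1 y)). Qed.
Let l2 g x : vlin g -> lin (fun y => B x (g y)).
Proof. exact: (lin_comp (h2 x)). Qed.

(** Write a as a_(1) eps(a_(2)) and absorb eps(a_(2)) into t a_(2). The coproduct of t a_(2) then
    yields a_(1) S(a_(2)) S(t_(1)) and t_(2) a_(3), and a_(1) S(a_(2)) cancels. [sw_casimir'] is the
    same with t on the other side. *)
Lemma sw_casimir a :
  sw nu t (fun x y => B (a ** \S x) y) = sw nu t (fun x y => B (\S x) (y ** a)).
Proof.
transitivity (sw nu a (fun a1 a2 => sw nu (t ** a2) (fun x y => B (a1 ** \S x) y))).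
  under [RHS]eq_sw => a1 a2.
    rewrite (int_right hi) (linZ (f := fun u => sw nu u (fun x y => B (a1 ** \S x) y))).
      by rewrite mulrC; over.
    by lin_tac.
  by rewrite (sw_counitr hb _ (g := fun a1 => sw nu t (fun x y => B (a1 ** \S x) y)));
    last by lin_tac.
under eq_sw => a1 a2 do (rewrite (sw_mul hb); [|lin_tac|lin_tac]; rewrite sw_swap).
rewrite -(sw_coassoc hb).
under eq_sw => r a3.
  rewrite sw_swap; under eq_sw => x y.
    under eq_sw => a1 a2 do rewrite (anti_mul hh) -(muA hb).
    rewrite (sw_antir hh r (g := fun v => B (v ** \S x) (y ** a3))); last by lin_tac.
    rewrite (mu1l hb); over.
  rewrite sw_mull; over.
by rewrite (sw_counitl hb _ (g := fun a3 => sw nu t (fun x y => B (\S x) (y ** a3))));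
  last by lin_tac.
Qed.

Lemma sw_casimir' a :
  sw nu t (fun x y => B (a ** x) (\S y)) = sw nu t (fun x y => B x (\S y ** a)).
Proof.
transitivity (sw nu a (fun r a3 => sw nu (r ** t) (fun x y => B x (\S y ** a3)))).
  under [RHS]eq_sw => r a3 do (rewrite (sw_mul hb); [|lin_tac|lin_tac]).
  rewrite (sw_coassoc hb).
  under [RHS]eq_sw => a1 s.
    rewrite sw_swap; under eq_sw => x y.
      under eq_sw => a2 a3 do rewrite (anti_mul hh) (muA hb).
      rewrite (sw_antil hh s (g := fun v => B (a1 ** x) (\S y ** v))); last by lin_tac.
      rewrite (mu1r hb); over.
    rewrite sw_mull mulrC; over.
  by rewrite (sw_counitr hb _ (g := fun a1 => sw nu t (fun x y => B (a1 ** x) (\S y))));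
    last by lin_tac.
under eq_sw => r a3.
  rewrite (int_left hi) (linZ (f := fun u => sw nu u (fun x y => B x (\S y ** a3)))).
    by over.
  by lin_tac.
by rewrite (sw_counitl hb _ (g := fun a3 => sw nu t (fun x y => B x (\S y ** a3))));
  last by lin_tac.
Qed.
End Casimir.

Section Dual.
Variable g : V -> F.
Hypothesis hg : lin g.
Let lg k : vlin k -> lin (fun x => g (k x)).
Proof. exact: lin_comp. Qed.

(** Strong invariance of the cointegral: invariance applied to a_(2) b produces a_(2) b_(1) and
    a_(3) b_(2), after which S(a_(1)) a_(2) cancels. [sw_tau2] is the mirror image. *)
Lemma sw_tau1 a b : sw nu a (fun a1 a2 => g (\S a1) * pr (a2 ** b) tau) =
  sw nu b (fun b1 b2 => g b1 * pr (a ** b2) tau).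
Proof.
transitivity (sw nu a (fun a1 r => sw nu (r ** b) (fun x y => g (\S a1 ** x) * pr y tau))).
  apply: eq_sw => a1 r; rewrite (sw_cointl _ (g := fun x => g (\S a1 ** x))); last by lin_tac.
  by rewrite (mu1r hb) mulrC.
under eq_sw => a1 r do (rewrite (sw_mul hb); [|lin_tac|lin_tac]).
rewrite -(sw_coassoc hb).
under eq_sw => r a3.
  rewrite sw_swap; under eq_sw => b1 b2.
    under eq_sw => a1 a2 do rewrite -(muA hb).
    rewrite (sw_antil hh r (g := fun v => g (v ** b1) * pr (a3 ** b2) tau)); last by lin_tac.
    rewrite (mu1l hb); over.
  rewrite sw_mull; over.
by rewrite (sw_counitl hb _ (g := fun a3 => sw nu b (fun b1 b2 => g b1 * pr (a3 ** b2) tau)));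
  last by lin_tac.
Qed.

Lemma sw_tau2 a b : sw nu a (fun a1 a2 => pr (a1 ** b) tau * g a2) =
  sw nu b (fun b1 b2 => pr (a ** b1) tau * g (\S b2)).
Proof.
transitivity (sw nu b (fun r b3 => sw nu (a ** r) (fun x y => pr x tau * g (y ** \S b3)))).
  under [RHS]eq_sw => r b3 do (rewrite (sw_mul hb); [|lin_tac|lin_tac]; rewrite sw_swap).
  rewrite (sw_coassoc hb).
  under [RHS]eq_sw => b1 s.
    rewrite sw_swap; under eq_sw => a1 a2.
      under eq_sw => b2 b3 do rewrite (muA hb).
      rewrite (sw_antir hh s (g := fun v => pr (a1 ** b1) tau * g (a2 ** v))); last by lin_tac.
      rewrite (mu1r hb); over.
    rewrite sw_mull mulrC; over.
  by rewrite (sw_counitr hb _ (g := fun b1 => sw nu a (fun a1 a2 => pr (a1 ** b1) tau * g a2)));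
    last by lin_tac.
apply: eq_sw => r b3; rewrite (sw_cointr _ (g := fun x => g (x ** \S b3))); last by lin_tac.
by rewrite (mu1l hb).
Qed.

Lemma sw_int_l b : sw nu t (fun x y => g (\S x) * pr (y ** b) tau) = lam * g b.
(* For a = t, strong invariance says that the S(t_(1)) and t_(2) are dual bases, up to [lam], of the
   form tau(a b). As [lam] is invertible, elements can be compared and traces computed through this
   form. *)
Proof.
rewrite sw_tau1; under eq_sw => x y do rewrite (int_right hi) prZl (int_lam hi) mulrA.
by rewrite sw_mulr (sw_counitr hb) // mulrC.
Qed.
Lemma sw_int_r a : sw nu t (fun x y => g x * pr (a ** y) tau) = lam * g (\S a).
Proof.
rewrite -sw_tau1; under eq_sw => x y do rewrite (int_left hi) prZl (int_lam hi) mulrA.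
by rewrite sw_mulr (sw_counitr hb _ (g := fun x => g (\S x))) 1?mulrC //; lin_tac.
Qed.
Lemma sw_int_r' b : sw nu t (fun x y => pr (x ** b) tau * g y) = lam * g (\S b).
Proof.
rewrite sw_tau2; under eq_sw => x y do rewrite (int_right hi) prZl (int_lam hi) (mulrC _ lam) -mulrA.
by rewrite sw_mull (sw_counitl hb _ (g := fun x => g (\S x))) //; lin_tac.
Qed.
End Dual.

Lemma int_anti : \S t = t.
Proof.
apply: pr_ext => f; apply: lam_inj.
have hf : lin (fun x => pr x f) by lin_tac.
rewrite -(sw_int_r hf); under eq_sw => x y do
  rewrite (int_right hi) prZl (int_lam hi) mulrA.
by rewrite sw_mulr (sw_counitr hb) // mulrC.
Qed.
End Integrals.

Section Integrals2.
Variables (mu nu : tensor) (S : 'M[F]_n.+1) (t tau : V) (lam li : F).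
Hypothesis hi : hopf_int mu nu S t tau lam li.
Let hh := hint_hopf hi.
Let hb := hopf_bialg hh.
Local Notation "a ** b" := (pm mu a b) (at level 40, left associativity).
Local Notation "\S a" := (a *m S) (at level 35, right associativity).

Lemma coint_anti a : pr (\S a) tau = pr a tau.
Proof. by rewrite pr_mx (int_anti (hopf_int_swap hi)). Qed.

Lemma sw_int_l' (g : V -> F) c : lin g ->
  sw nu t (fun x y => pr (c ** \S x) tau * g y) = lam * g c.
Proof.
move=> hg.
have h1 y : lin (fun x => pr x tau * g y) by lin_tac.
have h2 x : lin (fun y => pr x tau * g y) by lin_tac.
rewrite (sw_casimir hi h1 h2); under eq_sw => x y do rewrite coint_anti.
rewrite (sw_cointr hi _ (g := fun y => g (y ** c))); last first.
  by move=> k x y; rewrite (vlin_pml mu c (@vlin_id _ _)) hg.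
by rewrite (mu1l hb) (int_lam hi).
Qed.

(** S^2 is the Nakayama automorphism of the form tau(a b): [lam] times either side is the sum of
    tau(c S(t_(1))) tau(a t_(2)), evaluated by two of the dual basis formulas. *)
Lemma nakayama a c : pr (c ** \S \S a) tau = pr (a ** c) tau.
Proof.
apply: (lam_inj hi).
have hg : lin (fun x => pr (c ** \S x) tau) by lin_tac.
rewrite -(sw_int_r hi hg).
by rewrite (sw_int_l' (g := fun y => pr (a ** y) tau)) //; lin_tac.
Qed.

Lemma nakayama' b c : pr (\S \S b ** c) tau = pr (c ** b) tau.
Proof.
apply: (lam_inj hi).
have hg : lin (fun x => pr (\S x ** c) tau) by lin_tac.
have h1 y : lin (fun x => pr (x ** b) tau * pr y tau) by lin_tac.
have h2 x : lin (fun y => pr (x ** b) tau * pr y tau) by lin_tac.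
rewrite -(sw_int_r' hi hg) -(sw_casimir' hi h1 h2).
under eq_sw => x y do rewrite coint_anti.
rewrite (sw_cointl hi _ (g := fun x => pr (c ** x ** b) tau)); last by lin_tac.
by rewrite (mu1r hb) (int_lam hi).
Qed.

(** [nakayama] turns tau(y S^4(b)) into tau(S^2(b) y), and [nakayama'] turns this into tau(y b); the
    dual basis formula then separates b from S^4(b). *)
Lemma anti4 (b : V) : \S \S \S \S b = b.
Proof.
apply: pr_ext => f; apply: (lam_inj hi).
have hf : lin (fun x => pr x f) by lin_tac.
rewrite -!(sw_int_l hi hf); apply: eq_sw => x y; congr (_ * _).
by rewrite nakayama nakayama'.
Qed.

Definition trV (G : V -> V) : F := \sum_i pr (G (ev F i)) (ev F i).

Lemma lam_trV G : vlin G -> lam * trV G = sw nu t (fun x y => pr (y ** G (\S x)) tau).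
Proof.
move=> hG; rewrite /trV mulr_sumr.
have h i : lin (fun x => pr (G x) (ev F i)) by apply: lin_prl.
under eq_bigr => i _ do rewrite -(sw_int_l hi (h i)).
rewrite -sw_sum; apply: eq_sw => x y.
by rewrite (lin_dual (f := fun z => pr (y ** z) tau)) //; lin_tac.
Qed.

(** By the trace formula [lam] tr(S^2) is the sum of tau(t_(2) S^2(S(t_(1)))), that is of
    tau(S(t_(1)) t_(2)), which is 1 by the normalizations. So tr(S^2) is a unit. *)
Lemma trV_anti2 : trV (fun a : V => \S \S a) = li.
Proof.
apply: (lam_inj hi); rewrite lam_trV; last by lin_tac.
rewrite (lamV hi); under eq_sw => x y do rewrite nakayama.
rewrite (sw_antil hh t (g := fun x => pr x tau)); last by lin_tac.
by rewrite (int1 hi) mul1r (coint1 hi).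
Qed.

(** A right factor a of s_(1) alone becomes a factor a_(1) of all of s, at the cost of S(a_(2)) on
    the other leg. In [int_cyc] this lets [sw_casimir] act on the whole tail of t. *)
Lemma sw_mulr_anti (B : V -> V -> F) s a :
  (forall y, lin (fun x => B x y)) -> (forall x, lin (B x)) ->
  sw nu s (fun y z => B (y ** a) z) =
  sw nu a (fun a1 a2 => sw nu (s ** a1) (fun y z => B y (z ** \S a2))).
Proof.
move=> h1 h2.
have l1 g y : vlin g -> lin (fun x => B (g x) y) by exact: (lin_comp (h1 y)).
have l2 g x : vlin g -> lin (fun y => B x (g y)) by exact: (lin_comp (h2 x)).
under [RHS]eq_sw => a1 a2 do (rewrite (sw_mul hb); [|lin_tac|lin_tac]; rewrite sw_swap).
rewrite (sw_coassoc hb).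
under [RHS]eq_sw => u r.
  rewrite sw_swap; under eq_sw => y z.
    under eq_sw => v a2 do rewrite (muA hb).
    rewrite (sw_antir hh r (g := fun v => B (y ** u) (z ** v))); last by lin_tac.
    rewrite (mu1r hb); over.
  rewrite sw_mull mulrC; over.
by rewrite (sw_counitr hb _ (g := fun u => sw nu s (fun y z => B (y ** u) z))); last by lin_tac.
Qed.

(** The element c that represents the left side, the sum of tau(S(t_(1)) t_(3)) t_(2), satisfies c a
    = eps(a) c and eps(c) = 1; hence c = c t = t. It evaluates the last term in [dWP]. *)
Lemma int_cyc (g : V -> F) : lin g ->
  sw nu t (fun x r => sw nu r (fun y z => g y * pr (\S x ** z) tau)) = g t.
Proof.
pose C (g : V -> F) := sw nu t (fun x r => sw nu r (fun y z => g y * pr (\S x ** z) tau)).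
have lC (G : V -> V -> F) : (forall y, lin (fun x => G x y)) -> lin (fun x => C (G x)).
  by move=> hG; rewrite /C; lin_tac.
have key (h : V -> F) a : lin h -> C (fun y => h (y ** a)) = pr a o * C h.
  move=> lh; have hl k : vlin k -> lin (fun x => h (k x)) by exact: lin_comp.
  rewrite /C; under eq_sw => x r.
    rewrite (@sw_mulr_anti (fun y z => h y * pr (\S x ** z) tau)); [|lin_tac|lin_tac].
    over.
  rewrite sw_swap; under eq_sw => a1 a2.
    have /= <- := @sw_casimir _ _ _ _ _ _ _ hi
      (fun u v => sw nu v (fun y z => h y * pr (u ** (z ** \S a2)) tau)); [|lin_tac|lin_tac].
    under eq_sw => x r do under eq_sw => y z do
      rewrite (muA hb) -nakayama !(muA hb) -(muA hb _ z) -(anti_mul hh).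
    over.
  rewrite sw_swap -sw_mull; apply: eq_sw => x r.
  rewrite sw_swap -sw_mull; apply: eq_sw => y z.
  rewrite (sw_antil hh a (g := fun v => h y * pr (\S x ** z ** \S v) tau)); last by lin_tac.
  by rewrite (anti_one hh) (mu1r hb).
move=> hg; rewrite -/(C g).
pose c : V := \row_i C (fun y => pr y (ev F i)).
have cE h : lin h -> C h = h c.
  move=> hh1; rewrite [RHS](lin_ev hh1).
  rewrite /C; under eq_sw => x r do under eq_sw => y z do
    (rewrite (lin_ev hh1) mulr_suml).
  under eq_sw => x r do rewrite sw_sum.
  rewrite sw_sum; apply: eq_bigr => i _; rewrite mxE /C -sw_mulr.
  apply: eq_sw => x r; rewrite -sw_mulr; apply: eq_sw => y z.
  by rewrite pr_evr mulrAC.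
have ct : pm mu c t = c.
  apply: pr_ext => f; have hf : lin (fun x => pr x f) by lin_tac.
  rewrite -(cE _ hf) -[RHS]mul1r -(int1 hi) -key // [RHS]cE //; lin_tac.
have : pr c o = 1.
  have ho : lin (fun x => pr x o) by lin_tac.
  rewrite -(cE _ ho) /C; under eq_sw => x r do
    (rewrite (sw_counitl hb _ (g := fun z => pr (\S x ** z) tau)); last by lin_tac).
  rewrite (sw_antil hh t (g := fun z => pr z tau)); last by lin_tac.
  by rewrite (int1 hi) (coint1 hi) mulr1.
by move=> c1; rewrite (cE _ hg) -[in LHS]ct (int_left hi) c1 scale1r.
Qed.
End Integrals2.
End HopfTheory.

(** * Vanishing of the deformation cohomology *)

Section Cohomology.
Variables (F : comNzRingType) (n : nat).
Local Notation V := 'rV[F]_n.+1.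
Local Notation tensor := ('I_n.+1 -> 'I_n.+1 -> V).
Local Notation o := (ev F (ord0 : 'I_n.+1)).
Variables (mu nu : tensor) (S : 'M[F]_n.+1) (t tau : V) (lam li : F).
Hypothesis hi : hopf_int mu nu S t tau lam li.
Let hh := hint_hopf hi.
Let hb := hopf_bialg hh.
Local Notation "a ** b" := (pm mu a b) (at level 40, left associativity).
Local Notation "f *o g" := (pm nu f g) (at level 40, left associativity).
Local Notation "\S a" := (a *m S) (at level 35, right associativity).

Lemma lact_comp (f a b : V) : lact mu (lact mu f a) b = lact mu f (a ** b).
Proof. by apply: pr_ext => g; rewrite ![pr _ g]prC !pr_lact (muA hb). Qed.
Lemma ract_lact (f a b : V) : ract mu b (lact mu f a) = lact mu (ract mu b f) a.
Proof. by apply: pr_ext => g; rewrite ![pr _ g]prC !(pr_lact, pr_ract) (muA hb). Qed.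
Lemma lact1 (f : V) : lact mu f o = f.
Proof. by apply: pr_ext => g; rewrite ![pr _ g]prC pr_lact (mu1l hb). Qed.

Lemma lactE nu' (g : V -> F) (a f : V) : lin g ->
  g (lact nu' a f) = sw nu' a (fun x y => pr x f * g y).
Proof.
move=> hg; under eq_sw => x y do rewrite -(pr_row hg).
by rewrite sw_pr prC -pr_lact prC pr_row.
Qed.
Lemma ractE nu' (g : V -> F) (a f : V) : lin g ->
  g (ract nu' f a) = sw nu' a (fun x y => g x * pr y f).
Proof.
move=> hg; under eq_sw => x y do rewrite -(pr_row hg).
by rewrite sw_pr prC -pr_ract prC pr_row.
Qed.

Lemma lact_conv (g : V -> F) (f h r : V) : lin g ->
  sw nu r (fun u v => g (lact mu f u *o lact mu h v)) = g (lact mu (f *o h) r).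
Proof.
move=> hg; rewrite -(pr_row hg) prC pr_lact (mu_nu hb); apply: eq_sw => u v.
rewrite -(pr_row hg) prC -sw_pr; apply: eq_sw => x y.
by rewrite !pr_lact.
Qed.

Section Bilin.
Variable B : V -> V -> F.
Hypotheses (h1 : forall y, lin (fun x => B x y)) (h2 : forall x, lin (B x)).
Let l1 k y : vlin k -> lin (fun x => B (k x) y).
Proof. exact: (lin_comp (h1 y)). Qed.
Let l2 k x : vlin k -> lin (fun y => B x (k y)).
Proof. exact: (lin_comp (h2 x)). Qed.

Lemma sw_lact p q f : sw mu f (fun x y => B (lact nu p x) (lact nu q y)) =
  sw nu p (fun p1 p2 => sw nu q (fun q1 q2 => pr (p1 ** q1) f * B p2 q2)).
Proof.
under eq_sw => x y do rewrite (lactE _ _ _ (h1 _)).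
under eq_sw => x y do under eq_sw => p1 p2 do rewrite (lactE _ _ _ (h2 _)).
rewrite sw_swap; apply: eq_sw => p1 p2.
under eq_sw => x y do rewrite -sw_mull.
rewrite sw_swap; apply: eq_sw => q1 q2.
under eq_sw => x y do rewrite mulrA.
rewrite sw_mulr; congr (_ * _); rewrite prC -sw_pr.
by apply: eq_sw => x y; rewrite !(prC _ x) !(prC _ y).
Qed.

Lemma sw_ract p q f : sw mu f (fun x y => B (ract nu x p) (ract nu y q)) =
  sw nu p (fun p1 p2 => sw nu q (fun q1 q2 => B p1 q1 * pr (p2 ** q2) f)).
Proof.
under eq_sw => x y do rewrite (ractE _ _ _ (h1 _)).
under eq_sw => x y do under eq_sw => p1 p2 do rewrite (ractE _ _ _ (h2 _)).
rewrite sw_swap; apply: eq_sw => p1 p2.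
under eq_sw => x y do rewrite -sw_mulr.
rewrite sw_swap; apply: eq_sw => q1 q2.
under eq_sw => x y do rewrite -mulrA.
rewrite sw_mull; congr (_ * _); rewrite prC -sw_pr.
by apply: eq_sw => x y; rewrite !(prC _ x) !(prC _ y) mulrC.
Qed.
End Bilin.

(** Strong invariance of tau in the dual algebra: multiplying the functional z |-> tau(z S(b)) by f
    on the left gives the sum of f(b_(2)) times z |-> tau(z S(b_(1))). *)
Lemma conv_tau (g : V -> F) (f b : V) : lin g ->
  g (f *o ract mu (\S b) tau) = sw nu b (fun b1 b2 => g (ract mu (\S b1) tau) * pr b2 f).
Proof.
move=> hg; pose v : V := \row_i g (ev F i).
have gE z : g z = pr v z by rewrite prC pr_row.
rewrite gE -sw_pr.
transitivity (sw nu b (fun r b3 => sw nu (v ** \S r) (fun x y => pr (x ** b3) f * pr y tau))).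
  under [RHS]eq_sw => r b3.
    rewrite (sw_mul hb); [|lin_tac|lin_tac].
    rewrite sw_swap (sw_anti hh); [|lin_tac|lin_tac].
    over.
  rewrite (sw_coassoc hb).
  under [RHS]eq_sw => b1 r.
    under eq_sw => b2 b3 do under eq_sw => x y do rewrite (muA hb).
    rewrite sw_swap; under eq_sw => x y.
      rewrite (sw_antil hh r (g := fun u => pr (x ** u) f * pr (y ** \S b1) tau)); last by lin_tac.
      rewrite (mu1r hb); over.
    rewrite sw_mull mulrC; over.
  rewrite (sw_counitr hb _ (g := fun b => sw nu v (fun x y => pr x f * pr (y ** \S b) tau)));
    last by lin_tac.
  by apply: eq_sw => x y; rewrite pr_ract.
apply: eq_sw => r b3; rewrite (sw_cointl hi _ (g := fun x => pr (x ** b3) f)); last by lin_tac.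
by rewrite (mu1l hb) gE pr_ract.
Qed.

Lemma sw_coassoc4 a (T : V -> V -> V -> V -> F) :
  sw nu a (fun s p => sw nu s (fun x y => sw nu p (fun z w => T x y z w))) =
  sw nu a (fun x r => sw nu r (fun m w => sw nu m (fun y z => T x y z w))).
Proof.
rewrite (sw_coassoc hb); apply: eq_sw => x r.
by rewrite -(sw_coassoc hb).
Qed.

Section Hochschild.
Variable al : V -> V -> V -> V -> F.
Hypotheses (al1 : forall b c f, lin (fun a => al a b c f))
  (al2 : forall a c f, lin (fun b => al a b c f))
  (al3 : forall a b f, lin (fun c => al a b c f))
  (al4 : forall a b c, lin (fun f => al a b c f)).
Hypothesis cocycle : forall a b c d f, al b c d (lact mu f a) - al (a ** b) c d f
  + al a (b ** c) d f - al a b (c ** d) f + al a b c (ract mu d f) = 0.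
Let l1 g b c f : vlin g -> lin (fun a => al (g a) b c f).
Proof. exact: (lin_comp (al1 b c f)). Qed.
Let l4 g a b c : vlin g -> lin (fun f => al a b c (g f)).
Proof. exact: (lin_comp (al4 a b c)). Qed.

(* Averaging a Hochschild 3-cocycle over the integral contracts the complex. *)
Definition hochschild (b c f : V) : F :=
  sw nu t (fun x y => al y b c (lact mu f (\S x))).

(** Evaluate the cocycle identity at t_(2), a, b, c with S(t_(1)) acting on f and sum over t. The
    leading term collapses to [al a b c f] since S(t_(1)) t_(2) gives eps(t) = 1, and [sw_casimir]
    moves a out of the first slot of the next one. *)
Lemma hochschildP a b c f : al a b c f =
  hochschild b c (lact mu f a) - hochschild (a ** b) c f
  + hochschild a (b ** c) f - hochschild a b (ract mu c f).
Proof.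
have e1 : sw nu t (fun x y => al a b c (lact mu (lact mu f (\S x)) y)) = al a b c f.
  under eq_sw => x y do rewrite lact_comp.
  rewrite (sw_antil hh t (g := fun v => al a b c (lact mu f v))); last by lin_tac.
  by rewrite lact1 (int1 hi) mul1r.
have e2 : sw nu t (fun x y => al (y ** a) b c (lact mu f (\S x))) =
    hochschild b c (lact mu f a).
  have /= <- := @sw_casimir _ _ _ _ _ _ _ _ _ hi
     (fun u v => al v b c (lact mu f u)); [|lin_tac|lin_tac].
  by apply: eq_sw => x y; rewrite lact_comp.
have e4 : sw nu t (fun x y => al y a b (ract mu c (lact mu f (\S x)))) =
    hochschild a b (ract mu c f).
  by apply: eq_sw => x y; rewrite ract_lact.
rewrite -e1 -e2 -e4 /hochschild -!sw_opp -!sw_add; apply: eq_sw => x y.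
apply/eqP; rewrite -subr_eq0; apply/eqP.
by rewrite -[RHS](cocycle y a b c (lact mu f (\S x))); ring.
Qed.
End Hochschild.

Section Double.
Variable X : V -> V -> V -> V -> F.
Hypotheses (X1 : forall b f g, lin (fun a => X a b f g))
  (X2 : forall a f g, lin (fun b => X a b f g))
  (X3 : forall a b g, lin (fun f => X a b f g))
  (X4 : forall a b f, lin (fun g => X a b f g)).
Hypothesis Xmu : forall a b c f g,
  sw nu a (fun x y => X b c (lact mu f x) (lact mu g y)) - X (a ** b) c f g
  + X a (b ** c) f g - sw nu c (fun x y => X a b (ract mu x f) (ract mu y g)) = 0.
Hypothesis Xnu : forall f g h a b,
  sw mu f (fun x y => X (lact nu a x) (lact nu b y) g h) - X a b (f *o g) h
  + X a b f (g *o h) - sw mu h (fun x y => X (ract nu x a) (ract nu y b) f g) = 0.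
Let l1 k b f g : vlin k -> lin (fun a => X (k a) b f g).
Proof. exact: (lin_comp (X1 b f g)). Qed.
Let l2 k a f g : vlin k -> lin (fun b => X a (k b) f g).
Proof. exact: (lin_comp (X2 a f g)). Qed.
Let l3 k a b g : vlin k -> lin (fun f => X a b (k f) g).
Proof. exact: (lin_comp (X3 a b g)). Qed.
Let l4 k a b f : vlin k -> lin (fun g => X a b f (k g)).
Proof. exact: (lin_comp (X4 a b f)). Qed.

(* The same averaging for the compatibility defect [X] of a product and a coproduct:
   over [t] in the algebra direction, then over [tau] in the coalgebra direction. *)
Definition dY (a f g : V) : F := sw nu t (fun s t3 => sw nu s (fun t1 t2 =>
  X t3 a (lact mu f (\S t2)) (lact mu g (\S t1)))).
Definition dW (a f : V) : F := sw nu a (fun a1 a2 => dY a1 f (ract mu (\S a2) tau)).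

Lemma dY_alt a f g : dY a f g = sw nu t (fun s t3 => sw nu (\S s) (fun u v =>
  X t3 a (lact mu f u) (lact mu g v))).
Proof. by apply: eq_sw => s t3; rewrite (sw_anti hh) //; lin_tac. Qed.

(** In the algebra direction X is a Hochschild 2-cocycle with values in the tensor square of A under
    the diagonal actions. The averaging is that of [hochschildP]; S acts through its coproduct,
    which reverses the two legs. *)
Lemma dYP a b f g : X a b f g =
  sw nu a (fun x y => dY b (lact mu f x) (lact mu g y)) - dY (a ** b) f g
  + sw nu b (fun x y => dY a (ract mu x f) (ract mu y g)).
Proof.
have e1 : sw nu t (fun s t3 => sw nu (\S s) (fun u v => sw nu t3 (fun x y =>
    X a b (lact mu (lact mu f u) x) (lact mu (lact mu g v) y)))) = X a b f g.
  under eq_sw => s t3.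
    under eq_sw => u v do under eq_sw => x y do rewrite !lact_comp.
    have /= <- := @sw_mul _ _ _ _ hb (\S s) t3
      (fun u v => X a b (lact mu f u) (lact mu g v)); [|lin_tac|lin_tac].
    over.
  rewrite (sw_antil hh t (g := fun w => sw nu w (fun u v => X a b (lact mu f u) (lact mu g v))));
    last by lin_tac.
  by rewrite (int1 hi) mul1r (sw_one hb) ?lact1 //; lin_tac.
have e2 : sw nu t (fun s t3 => sw nu (\S s) (fun u v =>
    X (t3 ** a) b (lact mu f u) (lact mu g v))) =
    sw nu a (fun x y => dY b (lact mu f x) (lact mu g y)).
  have /= <- := @sw_casimir _ _ _ _ _ _ _ _ _ hi (fun w t3 => sw nu w (fun u v =>
     X t3 b (lact mu f u) (lact mu g v))); [|lin_tac|lin_tac].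
  under [RHS]eq_sw => x y do rewrite dY_alt.
  rewrite [RHS]sw_swap; apply: eq_sw => s t3.
  rewrite (sw_mul hb); [|lin_tac|lin_tac].
  by apply: eq_sw => x y; apply: eq_sw => u v; rewrite !lact_comp.
have e4 : sw nu t (fun s t3 => sw nu (\S s) (fun u v => sw nu b (fun x y =>
    X t3 a (ract mu x (lact mu f u)) (ract mu y (lact mu g v))))) =
    sw nu b (fun x y => dY a (ract mu x f) (ract mu y g)).
  under [RHS]eq_sw => x y do rewrite dY_alt.
  rewrite [RHS]sw_swap; apply: eq_sw => s t3.
  rewrite [RHS]sw_swap; apply: eq_sw => u v.
  by apply: eq_sw => x y; rewrite !ract_lact.
rewrite -e1 -e2 -e4 dY_alt -!sw_opp -!sw_add; apply: eq_sw => s t3.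
rewrite -!sw_opp -!sw_add; apply: eq_sw => u v.
apply/eqP; rewrite -subr_eq0; apply/eqP.
by rewrite -[RHS](Xmu t3 a b (lact mu f u) (lact mu g v)); ring.
Qed.


Lemma lin_dY1 k f g : vlin k -> lin (fun a => dY (k a) f g).
Proof. by move=> hk; rewrite /dY; lin_tac. Qed.
Lemma lin_dY2 k a g : vlin k -> lin (fun f => dY a (k f) g).
Proof. by move=> hk; rewrite /dY; lin_tac. Qed.
Lemma lin_dY3 k a f : vlin k -> lin (fun g => dY a f (k g)).
Proof. by move=> hk; rewrite /dY; lin_tac. Qed.

Lemma lin_dW1 k f : vlin k -> lin (fun a => dW (k a) f).
Proof. by move=> hk; rewrite /dW; lin_tac. Qed.
Lemma lin_dW2 k a : vlin k -> lin (fun f => dW a (k f)).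
Proof.
by move=> hk; rewrite /dW; apply: lin_swbody => x y; apply: lin_dY2.
Qed.

(** [dY], which would repair compatibility, is itself the coboundary of [dW] for the product [nu].
    To first order, changing [nu] by [dY] is therefore conjugation by a linear map, and this keeps
    coassociativity: the point of the second averaging. *)
Lemma dWP a f g :
  sw nu a (fun x y => pr x f * dW y g) - dW a (f *o g)
  + sw nu a (fun x y => dW x f * pr y g) = dY a f g.
Proof.
(* [J] averages [Xnu] over t, with the functional z |-> tau(z S(a_(2))) as third functional. Its
   four terms become those of the claim, in order, the last one giving [dY]. *)
pose J (G : V -> V -> V -> V -> V -> V -> F) :=
  sw nu a (fun a1 a2 => sw nu t (fun s p => sw nu (\S s) (fun u r =>
    sw nu r (fun v w => G p a1 (lact mu f u) (lact mu g v)
      (lact mu (ract mu (\S a2) tau) w) o)))).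
have eT1 : J (fun p q f g h _ => sw mu f (fun x y => X (lact nu p x) (lact nu q y) g h)) =
    sw nu a (fun x y => pr x f * dW y g).
  under [RHS]eq_sw => x y do rewrite /dW -sw_mull.
  rewrite -(sw_coassoc hb) /J; apply: eq_sw => a1 a2.
  set th := ract mu (\S a2) tau.
  under eq_sw => s p do under eq_sw => u r do under eq_sw => v w do
    (rewrite (@sw_lact (fun p q => X p q (lact mu g v) (lact mu th w))); [|lin_tac|lin_tac]).
  under eq_sw => s p.
    rewrite (sw_anti hh); [|lin_tac|lin_tac].
    under eq_sw => x y.
      under eq_sw => v w do under eq_sw => p1 p2 do under eq_sw => q1 q2 do rewrite pr_lact -(muA hb).
      rewrite sw_swap; over.
    over.
  rewrite sw_coassoc4 /dY -/th.
  transitivity (sw nu t (fun x p => sw nu (\S x) (fun v w => sw nu a1 (fun q1 q2 =>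
      pr q1 f * X p q2 (lact mu g v) (lact mu th w))))).
    apply: eq_sw => x r.
    under eq_sw => m p2.
      rewrite (sw_antil hh m (g := fun c => sw nu (\S x) (fun v w => sw nu a1 (fun q1 q2 =>
        pr (c ** q1) f * X p2 q2 (lact mu g v) (lact mu th w))))); last by lin_tac.
      under eq_sw => v w do under eq_sw => q1 q2 do rewrite (mu1l hb).
      over.
    by rewrite (sw_counitl hb _ (g := fun p2 => sw nu (\S x) (fun v w => sw nu a1 (fun q1 q2 =>
        pr q1 f * X p2 q2 (lact mu g v) (lact mu th w))))); last by lin_tac.
  under [RHS]eq_sw => x y do rewrite -sw_mull.
  rewrite [RHS]sw_swap; apply: eq_sw => x p.
  rewrite (sw_anti hh); [|lin_tac|lin_tac].
  under [RHS]eq_sw => x1 y1 do rewrite -sw_mull.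
  by rewrite [RHS]sw_swap.
have eT2 : J (fun p q f g h _ => X p q (f *o g) h) = dW a (f *o g).
  apply: eq_sw => a1 a2; rewrite dY_alt; apply: eq_sw => s p.
  rewrite -(sw_coassoc hb); apply: eq_sw => r w.
  by rewrite (lact_conv (g := fun z => X p a1 z _)); last by lin_tac.
have eT3 : J (fun p q f g h _ => X p q f (g *o h)) = sw nu a (fun x y => dW x f * pr y g).
  under [RHS]eq_sw => x y do rewrite /dW -sw_mulr.
  rewrite (sw_coassoc hb); apply: eq_sw => a1 a2.
  rewrite -(conv_tau (g := fun z => dY a1 f z)); last by apply: lin_dY3; apply: vlin_id.
  rewrite dY_alt; apply: eq_sw => s p; apply: eq_sw => u r.
  by rewrite (lact_conv (g := fun z => X p a1 _ z)); last by lin_tac.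
have eT4 : J (fun p q f g h _ => sw mu h (fun x y => X (ract nu x p) (ract nu y q) f g)) =
    dY a f g.
  pose K q1 c := sw nu t (fun s p => sw nu (\S s) (fun u r => sw nu r (fun v w =>
    sw nu p (fun p1 p2 => X p1 q1 (lact mu f u) (lact mu g v) * pr (w ** (p2 ** c)) tau)))).
  transitivity (sw nu a (fun a1 a2 => sw nu a1 (fun q1 q2 => K q1 (q2 ** \S a2)))).
    apply: eq_sw => a1 a2; rewrite /K.
    rewrite [RHS]sw_swap; apply: eq_sw => s p.
    rewrite [RHS]sw_swap; apply: eq_sw => u r.
    rewrite [RHS]sw_swap; apply: eq_sw => v w.
    rewrite [RHS]sw_swap (@sw_ract (fun p q => X p q (lact mu f u) (lact mu g v))); [|lin_tac|lin_tac].
    apply: eq_sw => p1 p2; apply: eq_sw => q1 q2.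
    by rewrite pr_lact pr_ract !(muA hb).
  rewrite (sw_coassoc hb).
  under eq_sw => q1 r.
    rewrite (sw_antir hh r (g := fun c => K q1 c)); last by rewrite /K; lin_tac.
    rewrite mulrC; over.
  rewrite (sw_counitr hb _ (g := fun q1 => K q1 o)); last by rewrite /K; lin_tac.
  rewrite /K; pose G m := sw nu m (fun y p1 => sw nu (\S y) (fun u v =>
    X p1 a (lact mu f u) (lact mu g v))).
  have lG : lin G by rewrite /G; lin_tac.
  (* What remains of tau pairs the outer parts of t around its middle part, which is the situation
     of [int_cyc]. *)
  rewrite dY_alt -[RHS](int_cyc hi lG).
  under eq_sw => s p.
    rewrite -(sw_coassoc hb) (sw_anti hh); [|lin_tac|lin_tac].
    under eq_sw => x y do rewrite sw_swap.
    over.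
  rewrite sw_coassoc4; apply: eq_sw => x r; apply: eq_sw => m z.
  rewrite -sw_mulr; apply: eq_sw => y p1; rewrite -sw_mulr; apply: eq_sw => u v.
  by rewrite (mu1r hb).
rewrite -eT1 -eT2 -eT3 -eT4 /J -!sw_opp -!sw_add; apply: eq_sw => a1 a2.
rewrite -!sw_opp -!sw_add; apply: eq_sw => s p.
rewrite -!sw_opp -!sw_add; apply: eq_sw => u r.
rewrite -!sw_opp -!sw_add; apply: eq_sw => v w.
apply/eqP; rewrite -subr_eq0; apply/eqP.
by rewrite -[RHS](Xnu (lact mu f u) (lact mu g v) (lact mu (ract mu (\S a2) tau) w) p a1); ring.
Qed.
End Double.
End Cohomology.

(** * Traces and integrals *)

Section Traces.
Variables (F : comNzRingType) (n : nat).
Local Notation V := 'rV[F]_n.+1.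
Local Notation tensor := ('I_n.+1 -> 'I_n.+1 -> V).
Local Notation o := (ev F (ord0 : 'I_n.+1)).

Lemma trV_comp (G H : V -> V) : vlin G -> vlin H ->
  trV (fun z => G (H z)) = trV (fun z => H (G z)).
Proof.
move=> hG hH; rewrite /trV.
have aux (A B : V -> V) : vlin A -> vlin B ->
  \sum_i pr (A (B (ev F i))) (ev F i) =
  \sum_i \sum_j pr (B (ev F i)) (ev F j) * pr (A (ev F j)) (ev F i).
  move=> hA hB; apply: eq_bigr => i _.
  by rewrite (lin_dual (f := fun z => pr (A z) (ev F i))) //; apply: lin_prl.
rewrite (aux _ _ hG hH) (aux _ _ hH hG) exchange_big.
by apply: eq_bigr => i _; apply: eq_bigr => j _; rewrite mulrC.
Qed.

Lemma trV_mx (M : 'M[F]_n.+1) : trV (fun z => z *m M) = \tr M.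
Proof. by apply: eq_bigr => i _; rewrite -rowE pr_evr mxE. Qed.

Lemma eq_trV (G H : V -> V) : (forall z, G z = H z) -> trV G = trV H.
Proof. by move=> h; apply: eq_bigr => i _; rewrite h. Qed.



Section HopfTrace.
Variables (mu nu : tensor) (S : 'M[F]_n.+1) (hh : hopf mu nu S).
Let hb := hopf_bialg hh.
Local Notation "a ** b" := (pm mu a b) (at level 40, left associativity).
Local Notation "f *o g" := (pm nu f g) (at level 40, left associativity).
Local Notation "\S a" := (a *m S) (at level 35, right associativity).

(** The operator is the sum of z |-> S(h_(2)) S^2([lact nu (h_(1) z) f]). Cyclicity of the trace
    moves multiplication by h_(1) next to S(h_(2)), and h_(1) S(h_(2)) gives eps(h). *)
Lemma trV_lact f h : trV (fun z => \S \S lact nu z (lact mu f h)) =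
  pr h o * trV (fun z => \S \S lact nu z f).
Proof.
have opE z g : pr (\S \S lact nu z (lact mu f h)) g =
    sw nu h (fun h1 h2 => pr (\S h2 ** \S \S lact nu (h1 ** z) f) g).
  rewrite (lactE _ _ _ (g := fun v => pr (\S \S v) g)); last by lin_tac.
  under [RHS]eq_sw => h1 h2.
    rewrite (lactE _ _ _ (g := fun v => pr (\S h2 ** \S \S v) g)); last by lin_tac.
    rewrite (sw_mul hb); [|lin_tac|lin_tac].
    under eq_sw => u v do under eq_sw => z1 z2 do
      rewrite !(anti_mul hh) -(muA hb) -(anti_mul hh).
    over.
  rewrite (sw_coassoc hb).
  under [RHS]eq_sw => u r.
    rewrite sw_swap; under eq_sw => z1 z2.
      rewrite (sw_antil hh r (g := fun c => pr (u ** z1) f * pr (\S c ** \S \S z2) g));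
        last by lin_tac.
      rewrite (anti_one hh) (mu1l hb); over.
    rewrite sw_mull mulrC; over.
  rewrite (sw_counitr hb _ (g := fun u => sw nu z (fun z1 z2 => pr (u ** z1) f * pr (\S \S z2) g)));
    last by lin_tac.
  by apply: eq_sw => z1 z2; rewrite pr_lact.
rewrite {1}/trV; under eq_bigr => i _ do rewrite opE.
transitivity (sw nu h (fun h1 h2 => trV (fun z => \S h2 ** \S \S lact nu (h1 ** z) f))).
  by rewrite /trV sw_sum.
under eq_sw => h1 h2.
  rewrite (trV_comp (G := fun z => \S h2 ** \S \S lact nu z f) (H := fun z => h1 ** z));
    [|by lin_tac..].
  rewrite (trV_comp (G := fun z => h1 ** (\S h2 ** z)) (H := fun z => \S \S lact nu z f));
    [|by lin_tac..].
  over.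
under eq_sw => h1 h2 do under eq_trV => z do rewrite -(muA hb).
rewrite (sw_antir hh h (g := fun v => trV (fun z => \S \S lact nu (v ** z) f))).
  by congr (_ * _); apply: eq_trV => z; rewrite (mu1l hb).
by rewrite /trV; apply: lin_bigsum => i; lin_tac.
Qed.

Lemma trV_ract f h : trV (fun z => \S \S ract nu (ract mu h f) z) =
  pr h o * trV (fun z => \S \S ract nu f z).
Proof.
have opE z g : pr (\S \S ract nu (ract mu h f) z) g =
    sw nu h (fun h1 h2 => pr ((\S \S ract nu f (z ** h2)) ** \S h1) g).
  rewrite (ractE _ _ _ (g := fun v => pr (\S \S v) g)); last by lin_tac.
  under [RHS]eq_sw => h1 h2.
    rewrite (ractE _ _ _ (g := fun v => pr ((\S \S v) ** \S h1) g)); last by lin_tac.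
    rewrite (sw_mul hb); [|lin_tac|lin_tac].
    rewrite sw_swap.
    under eq_sw => u v do under eq_sw => z1 z2 do
      rewrite !(anti_mul hh) (muA hb) -(anti_mul hh).
    over.
  rewrite -(sw_coassoc hb).
  under [RHS]eq_sw => r v.
    rewrite sw_swap; under eq_sw => z1 z2.
      rewrite (sw_antir hh r (g := fun c => pr (\S \S z1 ** \S c) g * pr (z2 ** v) f));
        last by lin_tac.
      rewrite (anti_one hh) (mu1r hb); over.
    rewrite sw_mull; over.
  rewrite (sw_counitl hb _ (g := fun v => sw nu z (fun z1 z2 => pr (\S \S z1) g * pr (z2 ** v) f)));
    last by lin_tac.
  by apply: eq_sw => z1 z2; rewrite pr_ract.
rewrite {1}/trV; under eq_bigr => i _ do rewrite opE.
transitivity (sw nu h (fun h1 h2 => trV (fun z => (\S \S ract nu f (z ** h2)) ** \S h1))).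
  by rewrite /trV sw_sum.
under eq_sw => h1 h2.
  rewrite (trV_comp (G := fun z => z ** \S h1) (H := fun z => \S \S ract nu f (z ** h2)));
    [|by lin_tac..].
  rewrite (trV_comp (G := fun z => \S \S ract nu f z) (H := fun z => z ** \S h1 ** h2));
    [|by lin_tac..].
  over.
under eq_sw => h1 h2 do under eq_trV => z do rewrite (muA hb).
rewrite (sw_antil hh h (g := fun v => trV (fun z => (\S \S ract nu f z) ** v))).
  by congr (_ * _); apply: eq_trV => z; rewrite (mu1r hb).
by rewrite /trV; apply: lin_bigsum => i; lin_tac.
Qed.

(** The trace formula for integrals: f is sent to the trace of S^2 composed with z |-> f(z_(1))
    z_(2). It makes sense over every commutative ring, and its counit is tr(S^2), so it can be
    normalized when tr(S^2) is a unit. *)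
Definition tr_intl : V := \row_i trV (fun z => \S \S lact nu z (ev F i)).
Definition tr_intr : V := \row_i trV (fun z => \S \S ract nu (ev F i) z).

Lemma pr_tr_intl f : pr tr_intl f = trV (fun z => \S \S lact nu z f).
Proof.
rewrite prC (pr_row (f := fun f => trV (fun z => \S \S lact nu z f))) //.
by rewrite /trV; apply: lin_bigsum => i; lin_tac.
Qed.
Lemma pr_tr_intr f : pr tr_intr f = trV (fun z => \S \S ract nu f z).
Proof.
rewrite prC (pr_row (f := fun f => trV (fun z => \S \S ract nu f z))) //.
by rewrite /trV; apply: lin_bigsum => i; lin_tac.
Qed.

Lemma tr_intlP h : h ** tr_intl = pr h o *: tr_intl.
Proof.
apply: pr_ext => f; rewrite -pr_lact pr_tr_intl trV_lact.
by rewrite -pr_tr_intl prZl.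
Qed.
Lemma tr_intrP h : tr_intr ** h = pr h o *: tr_intr.
Proof.
apply: pr_ext => f; rewrite -pr_ract pr_tr_intr trV_ract.
by rewrite -pr_tr_intr prZl.
Qed.

Lemma eps_tr_intl : pr tr_intl o = \tr (S *m S).
Proof.
rewrite pr_tr_intl -trV_mx; apply: eq_trV => z; rewrite mulmxA; congr (_ *m _ *m _).
by apply: pr_ext => f; rewrite prC pr_lact (nu1l hb) prC.
Qed.
Lemma eps_tr_intr : pr tr_intr o = \tr (S *m S).
Proof.
rewrite pr_tr_intr -trV_mx; apply: eq_trV => z; rewrite mulmxA; congr (_ *m _ *m _).
by apply: pr_ext => f; rewrite prC pr_ract (nu1r hb) prC.
Qed.

(** A normalized right integral r and a normalized left integral l coincide: r l equals l by left
    invariance and r by right invariance. *)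
Lemma tr_int_eq li D : D = \tr (S *m S) -> D * li = 1 ->
  let t := li *: tr_intl in
  [/\ forall a, a ** t = pr a o *: t, forall a, t ** a = pr a o *: t & pr t o = 1].
Proof.
move=> -> hD /=.
have e : li *: tr_intl = li *: tr_intr.
  have := tr_intlP (li *: tr_intr).
  rewrite prZl eps_tr_intr mulrC hD scale1r => e1.
  have := tr_intrP (li *: tr_intl).
  rewrite prZl eps_tr_intl mulrC hD scale1r => e2.
  rewrite -[in LHS]e1 -[in RHS]e2.
  by rewrite (vlinZ (vlin_pmr mu _ (@vlin_id F n))) (vlinZ (vlin_pml mu _ (@vlin_id F n))).
split.
- by move=> a; rewrite (vlinZ (vlin_pmr mu _ (@vlin_id F n))) tr_intlP !scalerA mulrC.
- move=> a; rewrite e (vlinZ (vlin_pml mu _ (@vlin_id F n))) tr_intrP !scalerA.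
  by rewrite (mulrC li).
by rewrite prZl eps_tr_intl mulrC.
Qed.

Definition regchar : V := \row_i trV (fun z => ev F i ** z).
Local Notation chi := regchar.

Lemma pr_chi a : pr a chi = trV (fun z => a ** z).
Proof.
rewrite (pr_row (f := fun a => trV (fun z => a ** z))) //.
by rewrite /trV; apply: lin_bigsum => i; lin_tac.
Qed.

(** The tensor square of the regular representation is a multiple of it: z (x) c |-> z_(1) (x) z_(2)
    c, with inverse u (x) v |-> u_(1) (x) S(u_(2)) v, turns the action on the first factor into the
    diagonal one. Traces are compared through this pair ([H] and [G]). *)
Lemma chi_conv : chi *o chi = n.+1%:R *: chi.
Proof.
apply: pr_ext => a; rewrite ![pr _ a]prC -sw_pr prZr.
pose H z c f g := sw nu z (fun p q => pr p f * pr (q ** c) g).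
have H2 z f g : lin (fun c => H z c f g) by rewrite /H; lin_tac.
have H1 c f g : lin (fun z => H z c f g) by rewrite /H; lin_tac.
have eH u v f g : sw nu a (fun x y => pr (x ** u) f * pr (y ** v) g) =
    sw nu u (fun w u3 => H (a ** w) (\S u3 ** v) f g).
  rewrite /H; under [RHS]eq_sw => w u3 do
    (rewrite (sw_mul hb); [|lin_tac|lin_tac]; rewrite sw_swap).
  rewrite (sw_coassoc hb).
  under [RHS]eq_sw => u1 r.
    rewrite sw_swap; under eq_sw => x y.
      under eq_sw => u2 u3 do rewrite (muA hb) -(muA hb u2).
      rewrite (sw_antir hh r (g := fun c => pr (x ** u1) f * pr (y ** (c ** v)) g)); last by lin_tac.
      rewrite (mu1l hb); over.
    rewrite sw_mull mulrC; over.
  by rewrite (sw_counitr hb _ (g := fun u1 => sw nu a (fun x y => pr (x ** u1) f * pr (y ** v) g)));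
    last by lin_tac.
transitivity (\sum_i \sum_j sw nu a (fun x y =>
    pr (x ** ev F i) (ev F i) * pr (y ** ev F j) (ev F j))).
  under eq_sw => x y do rewrite !pr_chi /trV mulr_suml.
  rewrite sw_sum; apply: eq_bigr => i _; under eq_sw => x y do rewrite mulr_sumr.
  by rewrite sw_sum.
under eq_bigr => i _ do under eq_bigr => j _ do rewrite eH.
transitivity (\sum_i \sum_j \sum_k \sum_l sw nu (ev F i) (fun w u3 =>
   pr (a ** w) (ev F k) * pr (\S u3 ** ev F j) (ev F l) * H (ev F k) (ev F l) (ev F i) (ev F j))).
  apply: eq_bigr => i _; apply: eq_bigr => j _.
  under eq_sw => w u3 do rewrite (@bilin_ev _ _ (fun z c => H z c (ev F i) (ev F j)) _ _ (fun y => H1 y _ _) (fun x => H2 x _ _)).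
  by rewrite sw_sum; apply: eq_bigr => k _; rewrite sw_sum.
under eq_bigr => i _ do under eq_bigr => j _ do
  under eq_bigr => k _ do under eq_bigr => l _ do rewrite sw_mulr.
pose G k l u v := sw nu u (fun w u3 => pr (a ** w) (ev F k) * pr (\S u3 ** v) (ev F l)).
have G1 k l v : lin (fun u => G k l u v) by rewrite /G; lin_tac.
have G2 k l u : lin (fun v => G k l u v) by rewrite /G; lin_tac.
transitivity (\sum_k \sum_l sw nu (ev F k) (fun p q => G k l p (q ** ev F l))).
  rewrite exchange_big /=; under eq_bigr => j _ do rewrite exchange_big /=.
  rewrite exchange_big /=; apply: eq_bigr => k _.
  under eq_bigr => i _ do under eq_bigr => j _ do idtac.
  transitivity (\sum_l \sum_i \sum_j G k l (ev F i) (ev F j) * H (ev F k) (ev F l) (ev F i) (ev F j)).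
    rewrite exchange_big /=; under eq_bigr => i _ do rewrite exchange_big /=.
    by rewrite exchange_big.
  apply: eq_bigr => l _.
  under [RHS]eq_sw => p q do rewrite (@bilin_ev _ _ (G k l) _ _ (fun y => G1 k l y) (fun x => G2 k l x)).
  rewrite sw_sum; apply: eq_bigr => i _; rewrite sw_sum; apply: eq_bigr => j _.
  by rewrite sw_mulr mulrC.
transitivity (\sum_k \sum_(l < n.+1) pr (a ** ev F k) (ev F k) * pr (ev F l) (ev F l)).
  apply: eq_bigr => k _; apply: eq_bigr => l _; rewrite /G (sw_coassoc hb).
  under eq_sw => w r.
    under eq_sw => u q do rewrite -(muA hb).
    rewrite (sw_antil hh r (g := fun c => pr (a ** w) (ev F k) * pr (c ** ev F l) (ev F l)));
      last by lin_tac.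
    rewrite (mu1l hb) mulrC; over.
  rewrite (sw_counitr hb _ (g := fun w => pr (a ** w) (ev F k) * pr (ev F l) (ev F l))) //.
  by lin_tac.
rewrite pr_chi mulr_sumr; apply: eq_bigr => k _; rewrite -mulr_sumr mulrC; congr (_ * _).
under eq_bigr => l _ do rewrite pr_evl evE eqxx.
by rewrite sumr_const card_ord.
Qed.
End HopfTrace.
End Traces.

(** * The Larson-Radford theorem *)

Lemma mxtrace_idem (F : fieldType) m (P : 'M[F]_m) : P *m P = P -> \tr P = (\rank P)%:R.
Proof.
move=> hP; rewrite -{1}(mulmx_base P) mxtrace_mulC.
suff -> : row_base P *m col_base P = 1%:M by rewrite mxtrace1.
have hr : row_free (row_base P) by apply: row_base_free.
have hc : row_full (col_base P) by apply: col_base_full.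
apply: (row_free_inj hr); apply: (row_full_inj hc).
by rewrite mul1mx -(mulmxA (row_base P)) mulmxA !mulmx_base hP.
Qed.

Section LarsonRadford.
Variables (F : fieldType) (n : nat).
Local Notation V := 'rV[F]_n.+1.
Local Notation tensor := ('I_n.+1 -> 'I_n.+1 -> V).
Local Notation o := (ev F (ord0 : 'I_n.+1)).

Lemma hopf_has_int (mu nu : tensor) (S : 'M[F]_n.+1) :
  hopf mu nu S -> \tr (S *m S) != 0 ->
  exists t tau lam li, hopf_int mu nu S t tau lam li.
Proof.
move=> hh hD; set D := \tr (S *m S) in hD.
have hD1 : D * D^-1 = 1 by rewrite mulfV.
have hD2 : D = \tr (S^T *m S^T) by rewrite -trmx_mul mxtrace_tr.
have [h1 h2 h3] := tr_int_eq hh (erefl D) hD1.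
have [h4 h5 h6] := tr_int_eq (hopf_swap hh) hD2 hD1.
set t := _ *: _ in h1 h2 h3; set tau := _ *: _ in h4 h5 h6.
exists t, tau, D^-1, D; split; rewrite ?mulVf //.
- by move=> f; rewrite h4 prC.
- by move=> f; rewrite h5 prC.
- by rewrite prC.
rewrite /t prZl pr_tr_intl; set T := trV _; suff -> : T = 1 by rewrite mulr1.
(* As tau is an integral of the dual, z |-> tau(z_(1)) z_(2) is the rank one map z |-> tau(z) 1. S^2
   fixes 1, so the trace is tau(1) = 1. *)
have e z : (lact nu z tau *m S) *m S = pr z tau *: o.
  have -> : lact nu z tau = pr z tau *: o.
    apply: pr_ext => f; rewrite prC pr_lact h5 prZl [RHS]prZl (prC f) (prC z); ring.
  by rewrite -!scalemxAl !(anti_one hh).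
rewrite /T /trV; under eq_bigr => i _ do rewrite e prZl mulrC.
by rewrite (lin_dual (f := fun z => pr z tau)) 1?prC //; lin_tac.
Qed.

Hypothesis char0 : [pchar F] =i pred0.

(* [X] is [n.+1] times an idempotent commuting with the involution [S^2], and
   [S^2 X] has the same trace as [S^2]; so [\tr S^2] is a nonzero integer multiple of
   [n.+1], whence the involution [S^2] is [1] or [-1], and it fixes the unit. *)
Theorem larson_radford (mu nu : tensor) (S : 'M[F]_n.+1) t tau lam li :
  hopf_int mu nu S t tau lam li -> S *m S = 1%:M.
Proof.
move=> hi; have hh := hint_hopf hi; have hb := hopf_bialg hh.
pose chi := regchar mu.
pose X := \matrix_(i < n.+1) lact nu (ev F i) chi.
have XE z : z *m X = lact nu z chi.
  rewrite {1}(ev_sum z) mulmx_suml [RHS](vlin_ev (f := fun z => lact nu z chi)); last by lin_tac.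
  by apply: eq_bigr => i _; rewrite -scalemxAl -rowE rowK.
have ext (A B : 'M[F]_n.+1) : (forall z : V, z *m A = z *m B) -> A = B.
  by move=> h; apply/row_matrixP => i; rewrite !rowE h.
set s := S *m S.
have s2 : s *m s = 1%:M by apply: ext => z; rewrite mulmx1 /s !mulmxA (anti4 hi).
have sE (z : V) : z *m s = z *m S *m S by rewrite mulmxA.
have sM a b : pm mu a b *m s = pm mu (a *m s) (b *m s) by rewrite !sE !(anti_mul hh).
have X2 : X *m X = n.+1%:R *: X.
  apply: ext => z; rewrite mulmxA !XE (lact_comp (hopf_int_swap hi)) (chi_conv hh).
  have hl : vlin (fun x => lact nu z x) by lin_tac.
  by rewrite (vlinZ hl) -scalemxAr XE.
have chis a : pr (a *m s) chi = pr a chi.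
  rewrite !pr_chi; transitivity (trV (fun z => pm mu a (z *m s) *m s)).
    by apply: eq_trV => z; rewrite sM -mulmxA s2 mulmx1.
  rewrite (trV_comp (G := fun z => z *m s) (H := fun z => pm mu a (z *m s))); [|lin_tac..].
  by apply: eq_trV => z; rewrite -mulmxA s2 mulmx1.
have sX : s *m X = X *m s.
  apply: ext => z; rewrite !mulmxA XE -(mulmxA z) -/s XE; apply: pr_ext => f.
  rewrite prC pr_lact prC -sw_pr sE (sw_anti hh); [|lin_tac..].
  rewrite (sw_anti hh); [|lin_tac..].
  have hl : lin (fun v => pr (v *m S *m S) f) by lin_tac.
  rewrite (lactE _ _ _ hl); apply: eq_sw => x y.
  by rewrite -(chis x) sE.
(* This trace is the pairing of [tr_intl] with the regular character. [tr_intl] is tr(S^2) times t,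
   and the regular character takes the value 1 at t, since t acts as the rank one map z |-> eps(z)
   t. *)
have trX : \tr (X *m s) = \tr s.
  transitivity (pr (tr_intl nu S) chi).
    by rewrite pr_tr_intl -trV_mx; apply: eq_trV => z; rewrite !mulmxA XE.
  have -> : tr_intl nu S = \tr s *: t.
    have := tr_intlP hh t; rewrite (int1 hi) scale1r => <-.
    by rewrite (int_right hi) (eps_tr_intl hh).
  rewrite prZl pr_chi; under eq_trV => z do rewrite (int_right hi).
  rewrite /trV; under eq_bigr => i _ do rewrite prZl mulrC.
  by rewrite (lin_dual (f := fun z => pr z o)) ?(int1 hi) ?mulr1 //; lin_tac.
have trs0 : \tr s != 0.
  have -> : \tr s = li.
    by rewrite -(trV_anti2 hi) -trV_mx; apply: eq_trV => z; rewrite mulmxA.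
  by apply/eqP => h0; have := lamV hi; rewrite h0 mulr0 => /eqP; rewrite eq_sym oner_eq0.
have natr_inj m k : m%:R = k%:R :> F -> m = k.
  have c0 := (pcharf0P F).1 char0.
  wlog le : m k / (m <= k)%N => [hw e|].
    by case/orP: (leq_total m k) => le; [|symmetry]; apply: hw.
  move/esym/eqP; rewrite -subr_eq0 -natrB // c0 => /eqP h.
  by apply/eqP; rewrite eqn_leq le -subn_eq0 h.
have two0 : 2%:R != 0 :> F by rewrite ((pcharf0P F).1 char0).
have d0 : n.+1%:R != 0 :> F by rewrite ((pcharf0P F).1 char0).
pose ep := 2%:R^-1 *: (1%:M + s); pose em := 2%:R^-1 *: (1%:M - s).
pose f := n.+1%:R^-1 *: X.
have ff : f *m f = f by rewrite /f -scalemxAl -scalemxAr X2 !scalerA -mulrA mulVf // mulr1.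
have splits : ep + em = 1%:M.
  by rewrite /ep /em -scalerDr addrACA subrr addr0 -mulr2n -[_%:M *+ 2]scaler_nat scalerA mulVf // scale1r.
have diff : ep - em = s.
  rewrite /ep /em -scalerBr opprD opprK addrACA subrr add0r -mulr2n -[s *+ 2]scaler_nat.
  by rewrite scalerA mulVf // scale1r.
have es : ep *m s = ep by rewrite /ep -scalemxAl mulmxDl mul1mx s2 addrC.
have epp : ep *m ep = ep.
  by rewrite {2}/ep -scalemxAr mulmxDr mulmx1 es -mulr2n -[ep *+ 2]scaler_nat scalerA mulVf // scale1r.
have emE : em = 1%:M - ep by rewrite -splits addrC addKr.
have emm : em *m em = em.
  by rewrite emE mulmxBr mulmx1 mulmxBl mul1mx epp subrr subr0.
have fs : f *m s = s *m f by rewrite /f -scalemxAl -scalemxAr sX.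
have fep : f *m ep = ep *m f.
  by rewrite /ep -scalemxAr -scalemxAl mulmxDr mulmxDl mulmx1 mul1mx fs.
have fem : f *m em = em *m f by rewrite emE mulmxBr mulmxBl mulmx1 mul1mx fep.
have idf e : e *m e = e -> f *m e = e *m f -> (f *m e) *m (f *m e) = f *m e.
  by move=> ee fe; rewrite {1}fe mulmxA -(mulmxA e) ff -fe -mulmxA ee.
have t1 : \tr s = (\rank ep)%:R - (\rank em)%:R.
  by rewrite -!mxtrace_idem // -raddfB diff.
have t2 : n.+1%:R = (\rank ep)%:R + (\rank em)%:R :> F.
  by rewrite -!mxtrace_idem // -mxtraceD splits mxtrace1.
have t3 : \tr s = n.+1%:R * ((\rank (f *m ep))%:R - (\rank (f *m em))%:R).
  rewrite -!mxtrace_idem ?idf // -(raddfB (@mxtrace F n.+1)) /= -mulmxBr diff -trX /f -scalemxAl mxtraceZ.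
  by rewrite mulrA mulfV // mul1r.
set p := \rank ep in t1 t2; set q := \rank em in t1 t2.
set r1 := \rank _ in t3; set r2 := \rank _ in t3.
have e2 : n.+1 = (p + q)%N by apply: natr_inj; rewrite natrD.
have e3 : (p + n.+1 * r2 = q + n.+1 * r1)%N.
  apply: natr_inj; rewrite !natrD !natrM; apply/eqP; rewrite -subr_eq0.
  have /eqP := t3; rewrite t1 -subr_eq0 => /eqP h; apply/eqP; rewrite -[RHS]h; ring.
have pq : p <> q by move=> e; move: trs0; rewrite t1 e subrr eqxx.
(* p - q is a nonzero multiple of p + q, which leaves no room for both ranks to be positive. *)
have : (p = 0 \/ q = 0)%N.
  rewrite e2 in e3; case: (ltngtP r1 r2) => h; last by case: pq; move: e3; rewrite h => /addIn.
    by left; have := leq_mul (leqnn (p + q)) h; lia.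
  by right; have := leq_mul (leqnn (p + q)) h; lia.
have os : o *m s = o by rewrite sE !(anti_one hh).
case=> /eqP; rewrite mxrank_eq0 => /eqP z.
  have : o *m s = - o by rewrite -diff z sub0r -[em]add0r -z splits mulmxN mulmx1.
  rewrite os => /eqP; rewrite eq_sym -subr_eq0 -opprD oppr_eq0 -mulr2n => /eqP h.
  by have := congr1 (fun v : V => v 0 ord0) h; rewrite !mxE !eqxx /= => /eqP; rewrite (negPf two0).
by rewrite -diff z subr0 -[ep]addr0 -z splits.
Qed.
End LarsonRadford.

(** * Lifting modulo the next power of p *)

Section MapCoordinates.
Variables (F G : comNzRingType) (phi : {rmorphism F -> G}) (n : nat).
Local Notation "a ^^" := (map_mx phi a) (at level 2, format "a ^^").
Definition mapt (m : 'I_n.+1 -> 'I_n.+1 -> 'rV[F]_n.+1) i j := (m i j)^^.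

Lemma map_ev i : (ev F i : 'rV_n.+1)^^ = ev G i.
Proof. exact: map_delta_mx. Qed.
Lemma map_pr (a f : 'rV[F]_n.+1) : phi (pr a f) = pr a^^ f^^.
Proof. by rewrite rmorph_sum; apply: eq_bigr => i _; rewrite rmorphM !mxE. Qed.
Lemma map_pm m (a b : 'rV[F]_n.+1) : (pm m a b)^^ = pm (mapt m) a^^ b^^.
Proof.
rewrite /pm map_mx_sum; apply: eq_bigr => i _; rewrite map_mx_sum.
by apply: eq_bigr => j _; rewrite map_mxZ rmorphM !mxE.
Qed.
Lemma map_sw m (a : 'rV[F]_n.+1) B B' :
  (forall x y, phi (B x y) = B' x^^ y^^) -> phi (sw m a B) = sw (mapt m) a^^ B'.
Proof.
move=> h; rewrite /sw rmorph_sum; apply: eq_bigr => i _; rewrite rmorph_sum.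
by apply: eq_bigr => j _; rewrite rmorphM map_pr h !map_ev.
Qed.
Lemma map_lact m (a f : 'rV[F]_n.+1) : (lact m f a)^^ = lact (mapt m) f^^ a^^.
Proof. by apply/rowP=> i; rewrite !mxE map_pr map_pm map_ev. Qed.
Lemma map_ract m (a f : 'rV[F]_n.+1) : (ract m a f)^^ = ract (mapt m) a^^ f^^.
Proof. by apply/rowP=> i; rewrite !mxE map_pr map_pm map_ev. Qed.
End MapCoordinates.

Section Ext4.
Variables (F : comNzRingType) (n : nat).
Local Notation V := 'rV[F]_n.+1.
Local Notation I := 'I_n.+1.
Definition ext4 (T : I -> I -> I -> I -> F) (a b c f : V) : F :=
  \sum_i \sum_j \sum_k \sum_l
    pr a (ev F i) * (pr b (ev F j) * (pr c (ev F k) * (pr f (ev F l) * T i j k l))).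
Variable T : I -> I -> I -> I -> F.
Lemma ext4_1 b c f : lin (fun a => ext4 T a b c f).
Proof. by rewrite /ext4; lin_tac. Qed.
Lemma ext4_2 a c f : lin (fun b => ext4 T a b c f).
Proof. by rewrite /ext4; lin_tac. Qed.
Lemma ext4_3 a b f : lin (fun c => ext4 T a b c f).
Proof. by rewrite /ext4; lin_tac. Qed.
Lemma ext4_4 a b c : lin (fun f => ext4 T a b c f).
Proof. by rewrite /ext4; lin_tac. Qed.

Lemma ext4_ev i j k l : ext4 T (ev F i) (ev F j) (ev F k) (ev F l) = T i j k l.
Proof.
have pick (H : I -> F) r : \sum_s pr (ev F r) (ev F s) * H s = H r.
  rewrite (bigD1 r) //= pr_evl evE eqxx mul1r big1 ?addr0 // => s /negPf sr.
  by rewrite pr_evl evE eq_sym sr mul0r.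
rewrite /ext4.
under eq_bigr => i' _ do under eq_bigr => j' _ do under eq_bigr => k' _ do
  rewrite -mulr_sumr -mulr_sumr -mulr_sumr pick.
under eq_bigr => i' _ do under eq_bigr => j' _ do
  rewrite -mulr_sumr -mulr_sumr pick.
by under eq_bigr => i' _ do rewrite -mulr_sumr pick; rewrite pick.
Qed.
End Ext4.

Section Divisible.
Variables (F : comNzRingType) (n : nat).
Local Notation V := 'rV[F]_n.+1.

Lemma eq_lin4 (A B : V -> V -> V -> V -> F) :
  (forall b c f, lin (fun a => A a b c f)) -> (forall a c f, lin (fun b => A a b c f)) ->
  (forall a b f, lin (fun c => A a b c f)) -> (forall a b c, lin (fun f => A a b c f)) ->
  (forall b c f, lin (fun a => B a b c f)) -> (forall a c f, lin (fun b => B a b c f)) ->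
  (forall a b f, lin (fun c => B a b c f)) -> (forall a b c, lin (fun f => B a b c f)) ->
  (forall i j k l, A (ev F i) (ev F j) (ev F k) (ev F l) = B (ev F i) (ev F j) (ev F k) (ev F l)) ->
  forall a b c f, A a b c f = B a b c f.
Proof.
move=> a1 a2 a3 a4 b1 b2 b3 b4 h a b c f.
apply: (lin_ext (a1 b c f) (b1 b c f)) => i.
apply: (lin_ext (a2 _ c f) (b2 _ c f)) => j.
apply: (lin_ext (a3 _ _ f) (b3 _ _ f)) => k.
by apply: (lin_ext (a4 _ _ _) (b4 _ _ _)) => l.
Qed.

(** Quotients by q are not unique in a ring with torsion; chosen on basis vectors only and extended,
    they form a multilinear quotient. *)
Lemma divisible4 (q : F) (A : V -> V -> V -> V -> F) :
  (forall b c f, lin (fun a => A a b c f)) -> (forall a c f, lin (fun b => A a b c f)) ->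
  (forall a b f, lin (fun c => A a b c f)) -> (forall a b c, lin (fun f => A a b c f)) ->
  (forall a b c f, exists y, A a b c f = q * y) ->
  exists U, forall a b c f, A a b c f = q * ext4 U a b c f.
Proof.
move=> a1 a2 a3 a4 h.
pose U i j k l := projT1 (cid (h (ev F i) (ev F j) (ev F k) (ev F l))).
exists U; apply: eq_lin4 => //.
- by rewrite /ext4; lin_tac.
- by rewrite /ext4; lin_tac.
- by rewrite /ext4; lin_tac.
- by rewrite /ext4; lin_tac.
move=> i j k l.
by rewrite ext4_ev /U; case: cid.
Qed.
End Divisible.

Lemma map_ext4 (F G : comNzRingType) (phi : {rmorphism F -> G}) n
  (T : 'I_n.+1 -> 'I_n.+1 -> 'I_n.+1 -> 'I_n.+1 -> F) a b c f :
  phi (ext4 T a b c f) =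
  ext4 (fun i j k l => phi (T i j k l)) (map_mx phi a) (map_mx phi b) (map_mx phi c) (map_mx phi f).
Proof.
rewrite /ext4 rmorph_sum; apply: eq_bigr => i _; rewrite rmorph_sum; apply: eq_bigr => j _.
rewrite rmorph_sum; apply: eq_bigr => k _; rewrite rmorph_sum; apply: eq_bigr => l _.
by rewrite !rmorphM !map_pr !map_ev.
Qed.

Lemma compat_swap (F : comNzRingType) n (mu nu : 'I_n.+1 -> 'I_n.+1 -> 'rV[F]_n.+1) a b f g :
  sw nu a (fun a1 a2 => sw nu b (fun b1 b2 => pr (pm mu a1 b1) f * pr (pm mu a2 b2) g)) =
  sw mu f (fun f1 f2 => sw mu g (fun g1 g2 => pr (pm nu f1 g1) a * pr (pm nu f2 g2) b)).
Proof.
rewrite !sw_compat_ev; apply: eq_bigr => i _; rewrite exchange_big /=.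
apply: eq_bigr => j _; apply: eq_bigr => k _; apply: eq_bigr => l _.
by rewrite mulrC.
Qed.

Section Lifting.
Variables (Q k : comNzRingType) (proj : {rmorphism Q -> k}) (n : nat).
Hypothesis proj_surj : forall c, exists x, proj x = c.
Variable q : Q.
Hypotheses (proj_q : proj q = 0) (q_tors : forall z, q * z = 0 -> proj z = 0).
Local Notation tensor R := ('I_n.+1 -> 'I_n.+1 -> 'rV[R]_n.+1).
Local Notation "a ^^" := (map_mx proj a) (at level 2, format "a ^^").
Local Notation o := (ev Q (ord0 : 'I_n.+1)).

Definition dvq z := exists y, z = q * y.
(* The defects that a Frobenius lift makes divisible by one more power of [p]. *)
Definition dvK z := exists2 y, proj y = 0 & z = q * y.

Lemma dvq0 : dvq 0. Proof. by exists 0; rewrite mulr0. Qed.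
Lemma dvqD x y : dvq x -> dvq y -> dvq (x + y).
Proof. by case=> a -> [b ->]; exists (a + b); rewrite mulrDr. Qed.
Lemma dvqM x y : dvq x -> dvq (x * y).
Proof. by case=> a ->; exists (a * y); rewrite mulrA. Qed.
Lemma dvqMl x y : dvq x -> dvq (y * x).
Proof. by rewrite mulrC; exact: dvqM. Qed.
Lemma dvqN x : dvq x -> dvq (- x).
Proof. by case=> a ->; exists (- a); rewrite mulrN. Qed.
Lemma dvK0 : dvK 0. Proof. by exists 0; rewrite ?rmorph0 ?mulr0. Qed.
Lemma dvKD x y : dvK x -> dvK y -> dvK (x + y).
Proof.
by case=> a ha -> [b hb ->]; exists (a + b); rewrite ?mulrDr // rmorphD ha hb addr0.
Qed.
Lemma dvKM x y : dvK x -> dvK (x * y).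
Proof. by case=> a ha ->; exists (a * y); rewrite ?mulrA // rmorphM ha mul0r. Qed.
Lemma dvKMl x y : dvK x -> dvK (y * x).
Proof. by rewrite mulrC; exact: dvKM. Qed.
Lemma dvKN x : dvK x -> dvK (- x).
Proof. by case=> a ha ->; exists (- a); rewrite ?mulrN // rmorphN ha oppr0. Qed.
Lemma dvK_q x : dvq x -> dvK (q * x).
Proof. by case=> a ->; exists (q * a); rewrite // rmorphM proj_q mul0r. Qed.
Lemma dvK_sw m (a : 'rV[Q]_n.+1) B : (forall x y, dvK (B x y)) -> dvK (sw m a B).
Proof.
move=> h; rewrite /sw; elim/big_rec: _ => [|i x _ hx]; first exact: dvK0.
apply: dvKD => //; elim/big_rec: _ => [|j y _ hy]; first exact: dvK0.
by apply: dvKD => //; apply: dvKMl.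
Qed.
Lemma dvK_proj z : dvK (q * z) -> proj z = 0.
Proof.
case=> y hy e; have : q * (z - y) = 0 by rewrite mulrBr e subrr.
by move/q_tors; rewrite rmorphB hy subr0.
Qed.

(** The first basis vector is a strict unit, and its coordinate is multiplicative. Corrections with
    vanishing entries at index 0 preserve this, so these axioms are never deformed. *)
Definition normal (m : tensor Q) := [/\ forall j, m ord0 j = ev Q j, forall j, m j ord0 = ev Q j
  & forall i j, m i j 0 ord0 = ((i == ord0) && (j == ord0))%:R].

Definition asc (m : tensor Q) a b c f : Q :=
  pr (pm m (pm m a b) c) f - pr (pm m a (pm m b c)) f.
Definition cpt (mu nu : tensor Q) a b f g : Q := pr (pm mu a b) (pm nu f g) -
  sw nu a (fun a1 a2 => sw nu b (fun b1 b2 => pr (pm mu a1 b1) f * pr (pm mu a2 b2) g)).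

Lemma cpt_swap mu nu a b f g : cpt mu nu a b f g = cpt nu mu f g a b.
Proof. by rewrite /cpt compat_swap prC. Qed.

Lemma normal_1l m a : normal m -> pm m o a = a.
Proof.
case=> h _ _; rewrite [RHS]ev_sum.
rewrite (vlin_ev (f := fun a => pm m o a)); last by lin_tac.
by apply: eq_bigr => i _; rewrite pm_ev h.
Qed.
Lemma normal_1r m a : normal m -> pm m a o = a.
Proof.
case=> _ h _; rewrite [RHS]ev_sum.
rewrite (vlin_ev (f := fun a => pm m a o)); last by lin_tac.
by apply: eq_bigr => i _; rewrite pm_ev h.
Qed.
Lemma normal_eps m a b : normal m -> pr (pm m a b) o = pr a o * pr b o.
Proof.
case=> _ _ h.
apply: (lin_ext (f := fun a => pr (pm m a b) o) (g := fun a => pr a o * pr b o)) => [||i]; [lin_tac..|].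
apply: (lin_ext (f := fun b => pr (pm m (ev Q i) b) o)
  (g := fun b => pr (ev Q i) o * pr b o)) => [||j]; [lin_tac..|].
by rewrite pm_ev pr_evr h !pr_evl !evE -natrM mulnb.
Qed.

Lemma vsurj (v : 'rV[k]_n.+1) : exists u, v = u^^.
Proof.
exists (\row_i projT1 (cid (proj_surj (v 0 i)))).
by apply/rowP=> i; rewrite !mxE; case: cid.
Qed.

(** Entries at index 0 are lifted by 0 itself and not by an arbitrary preimage, so that a correction
    built from them respects [normal]. *)
Definition lift_tensor (B : 'I_n.+1 -> 'I_n.+1 -> 'rV[k]_n.+1) i j : 'rV[Q]_n.+1 :=
  \row_l if (i == ord0) || (j == ord0) || (l == ord0) then 0
         else projT1 (cid (proj_surj (B i j 0 l))).

Section Product.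
Variables (m : tensor Q) (nub : tensor k) (S : 'M[k]_n.+1) (t tau : 'rV[k]_n.+1) (lam li : k).
Hypotheses (hi : hopf_int (mapt proj m) nub S t tau lam li) (nm : normal m).
Hypothesis asq : forall a b c f, dvq (asc m a b c f).

(** The associator is q times a form whose reduction is a Hochschild 3-cocycle of the reduced
    algebra. [hochschildP] writes it as a coboundary, and adding q times a lift of the cochain
    leaves an associator in q ker([proj]). *)
Lemma correct_product : exists B : tensor Q,
  [/\ (forall j, B ord0 j = 0), (forall j, B j ord0 = 0), (forall i j, B i j 0 ord0 = 0)
    & forall a b c f, dvK (asc (fun i j => m i j + q *: B i j) a b c f)].
Proof.
have [T TE] : exists T, forall a b c f, asc m a b c f = q * ext4 T a b c f.
  by apply: divisible4; rewrite // /asc; lin_tac.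
pose al := ext4 (fun i j l r => proj (T i j l r)).
have alE a b c f : al a^^ b^^ c^^ f^^ = proj (ext4 T a b c f) by rewrite map_ext4.
have al1 b c f : lin (fun a => al a b c f) by apply: ext4_1.
have al2 a c f : lin (fun b => al a b c f) by apply: ext4_2.
have al3 a b f : lin (fun c => al a b c f) by apply: ext4_3.
have al4 a b c : lin (fun f => al a b c f) by apply: ext4_4.
have cocycle a b c d f : al b c d (lact (mapt proj m) f a) - al (pm (mapt proj m) a b) c d f
  + al a (pm (mapt proj m) b c) d f - al a b (pm (mapt proj m) c d) f
  + al a b c (ract (mapt proj m) d f) = 0.
  have [{}a ->] := vsurj a; have [{}b ->] := vsurj b; have [{}c ->] := vsurj c.
  have [{}d ->] := vsurj d; have [{}f ->] := vsurj f.
  rewrite -!map_pm -map_lact -map_ract !alE -!(rmorphD, rmorphB).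
  (* Times q, this is the identity between the five associators of four factors, valid for any
     bilinear product; [q_tors] cancels q after reduction. *)
  apply: q_tors; rewrite !(mulrDr, mulrBr, mulrN) -!TE /asc !pr_lact !pr_ract; ring.
have al0 (b c f : 'rV[k]_n.+1) : al b (ev k ord0) c f = 0.
  have [{}b ->] := vsurj b; have [{}c ->] := vsurj c; have [{}f ->] := vsurj f.
  rewrite -(map_ev proj) alE; apply: q_tors; rewrite -TE /asc.
  by rewrite (normal_1l _ nm) (normal_1r _ nm) subrr.
have al0' (b c f : 'rV[k]_n.+1) : al b c (ev k ord0) f = 0.
  have [{}b ->] := vsurj b; have [{}c ->] := vsurj c; have [{}f ->] := vsurj f.
  by rewrite -(map_ev proj) alE; apply: q_tors; rewrite -TE /asc !(normal_1r _ nm) subrr.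
have al0'' (a b c : 'rV[k]_n.+1) : al a b c (ev k ord0) = 0.
  have [{}b ->] := vsurj b; have [{}c ->] := vsurj c; have [{}a ->] := vsurj a.
  rewrite -(map_ev proj) alE; apply: q_tors; rewrite -TE /asc.
  by rewrite !(normal_eps _ _ nm) mulrA subrr.
clearbody al.
pose be := hochschild (mapt proj m) nub S t al.
have l1 g b c f : vlin g -> lin (fun a => al (g a) b c f) by exact: (lin_comp (al1 b c f)).
have l2 g a c f : vlin g -> lin (fun b => al a (g b) c f) by exact: (lin_comp (al2 a c f)).
have l3 g a b f : vlin g -> lin (fun c => al a b (g c) f) by exact: (lin_comp (al3 a b f)).
have l4 g a b c : vlin g -> lin (fun f => al a b c (g f)) by exact: (lin_comp (al4 a b c)).
have be1 g c f : vlin g -> lin (fun b => be (g b) c f).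
  by move=> hg; apply: lin_swbody => x y; apply: l2.
have be2 g b f : vlin g -> lin (fun c => be b (g c) f).
  by move=> hg; apply: lin_swbody => x y; apply: l3.
have be3 g b c : vlin g -> lin (fun f => be b c (g f)).
  by move=> hg; apply: lin_swbody => x y; apply: l4; lin_tac.
(* The averaged cochain is normalized because the cocycle is, so [lift_tensor] loses nothing at
   index 0. *)
have be0 j l : be (ev k ord0) (ev k j) (ev k l) = 0.
  by rewrite /be /hochschild; under eq_sw => x y do rewrite al0; exact: sw_0.
have be0' j l : be (ev k j) (ev k ord0) (ev k l) = 0.
  by rewrite /be /hochschild; under eq_sw => x y do rewrite al0'; exact: sw_0.
have be0'' i j : be (ev k i) (ev k j) (ev k ord0) = 0.
  rewrite /be /hochschild; under eq_sw => x y.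
    have -> : lact (mapt proj m) (ev k ord0) (x *m S) = pr (x *m S) (ev k ord0) *: ev k ord0.
      apply: pr_ext => g; rewrite prC pr_lact prZl (epsM (hopf_bialg (hint_hopf hi))).
      by rewrite (prC g).
    by rewrite (linZ (al4 _ _ _)) al0'' mulr0; over.
  exact: sw_0.
have beP a b c f : al a b c f = be b c (lact (mapt proj m) f a)
  - be (pm (mapt proj m) a b) c f + be a (pm (mapt proj m) b c) f
  - be a b (ract (mapt proj m) c f) by exact: (hochschildP hi al1 al4 cocycle).
clearbody be.
pose B := lift_tensor (fun i j => \row_l be (ev k i) (ev k j) (ev k l)).
have BE a b f : proj (pr (pm B a b) f) = be a^^ b^^ f^^.
  rewrite map_pr map_pm.
  apply: (lin_ext (f := fun a => pr (pm (mapt proj B) a b^^) f^^)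
    (g := fun a => be a b^^ f^^)) => [||i]; [lin_tac..|].
  apply: (lin_ext (f := fun b => pr (pm (mapt proj B) (ev k i) b) f^^)
    (g := fun b => be (ev k i) b f^^)) => [||j]; [lin_tac..|].
  apply: (lin_ext (f := fun f => pr (pm (mapt proj B) (ev k i) (ev k j)) f)
    (g := fun f => be (ev k i) (ev k j) f)) => [||l]; [lin_tac..|].
  rewrite pm_ev pr_evr !mxE; case: eqP => [->|_] /=; first by rewrite rmorph0 be0.
  case: eqP => [->|_] /=; first by rewrite rmorph0 be0'.
  case: eqP => [->|_] /=; first by rewrite rmorph0 be0''.
  by case: cid.
exists B; split.
- by move=> j; apply/rowP=> l; rewrite !mxE eqxx.
- by move=> j; apply/rowP=> l; rewrite !mxE eqxx orbT.
- by move=> i j; rewrite !mxE eqxx orbT.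
move=> a b c f.
have pmD x y : pm (fun i j => m i j + q *: B i j) x y = pm m x y + q *: pm B x y.
  rewrite /pm scaler_sumr -big_split /=; apply: eq_bigr => i _.
  rewrite scaler_sumr -big_split /=; apply: eq_bigr => j _.
  by rewrite scalerDr !scalerA [q * _]mulrC.
have key : proj (ext4 T a b c f + pr (pm B (pm m a b) c) f + pr (pm m (pm B a b) c) f
     - pr (pm m a (pm B b c)) f - pr (pm B a (pm m b c)) f) = 0.
  rewrite -(pr_ract m (pm B a b)) -(pr_lact m (pm B b c)) !(rmorphD, rmorphN) !BE !map_pm map_ract map_lact -alE.
  by rewrite beP; ring.
pose Rest := pr (pm B (pm B a b) c) f - pr (pm B a (pm B b c)) f.
exists (ext4 T a b c f + pr (pm B (pm m a b) c) f + pr (pm m (pm B a b) c) f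
     - pr (pm m a (pm B b c)) f - pr (pm B a (pm m b c)) f + q * Rest).
  by rewrite rmorphD key rmorphM proj_q mul0r addr0.
rewrite mulrDr !(mulrBr, mulrDr) -TE /asc !pmD.
have lD (x y z : 'rV[Q]_n.+1) : pr (x + q *: y) z = pr x z + q * pr y z by rewrite (linD (lin_id_pr z)) prZl.
have mDl x y z (m' : tensor Q) : pm m' (x + q *: y) z = pm m' x z + q *: pm m' y z.
  by have l := vlin_pml m' z (@vlin_id Q n); rewrite (vlinD l) (vlinZ l).
have mDr x y z (m' : tensor Q) : pm m' z (x + q *: y) = pm m' z x + q *: pm m' z y.
  by have l := vlin_pmr m' z (@vlin_id Q n); rewrite (vlinD l) (vlinZ l).
by rewrite !(mDl, mDr, lD) /Rest; ring.
Qed.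
End Product.

Section Coproduct.
Implicit Types mu nu : tensor Q.

Lemma pmDl m (x y z : 'rV[Q]_n.+1) : pm m (x + y) z = pm m x z + pm m y z.
Proof. exact: (vlinD (vlin_pml m z (@vlin_id Q n))). Qed.
Lemma pmDr m (x y z : 'rV[Q]_n.+1) : pm m z (x + y) = pm m z x + pm m z y.
Proof. exact: (vlinD (vlin_pmr m z (@vlin_id Q n))). Qed.
Lemma pmZl m c (x z : 'rV[Q]_n.+1) : pm m (c *: x) z = c *: pm m x z.
Proof. exact: (vlinZ (vlin_pml m z (@vlin_id Q n))). Qed.
Lemma pmZr m c (x z : 'rV[Q]_n.+1) : pm m z (c *: x) = c *: pm m z x.
Proof. exact: (vlinZ (vlin_pmr m z (@vlin_id Q n))). Qed.
Lemma pmNl m (x z : 'rV[Q]_n.+1) : pm m (- x) z = - pm m x z.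
Proof. by rewrite -scaleN1r pmZl scaleN1r. Qed.
Lemma pmNr m (x z : 'rV[Q]_n.+1) : pm m z (- x) = - pm m z x.
Proof. by rewrite -scaleN1r pmZr scaleN1r. Qed.
Lemma prDl (x y z : 'rV[Q]_n.+1) : pr (x + y) z = pr x z + pr y z.
Proof. exact: (linD (lin_id_pr z)). Qed.

Lemma sw_normal_one nu B : normal nu -> sw nu o B = B o o.
Proof.
case=> _ _ h; rewrite /sw (bigD1 ord0) //= (bigD1 ord0) //=.
rewrite [X in _ + X + _]big1 => [|j j0]; last by rewrite pr_evl h (negPf j0) andbF mul0r.
rewrite big1 => [|i i0]; last first.
  by rewrite big1 // => j _; rewrite pr_evl h (negPf i0) mul0r.
by rewrite pr_evl h eqxx !addr0 mul1r.
Qed.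

Lemma cpt_one_l mu nu b f g : normal mu -> normal nu -> cpt mu nu o b f g = 0.
Proof.
move=> hm hn; rewrite /cpt sw_normal_one // (normal_1l _ hm) -sw_pr.
by under [X in _ - X]eq_sw => x y do rewrite !(normal_1l _ hm); rewrite subrr.
Qed.
Lemma cpt_one_r mu nu a f g : normal mu -> normal nu -> cpt mu nu a o f g = 0.
Proof.
move=> hm hn; rewrite /cpt (normal_1r _ hm) -sw_pr.
under [X in _ - X]eq_sw => x y do rewrite sw_normal_one // !(normal_1r _ hm).
by rewrite subrr.
Qed.

(** Expand the coproduct of a (b c) and of (a b) c factor by factor. The alternating sum telescopes
    up to associators of [mu], once on the product itself and once inside the coproducts ([HL]
    against [HR]). Hence products must be corrected before compatibility. *)
Lemma cpt_cocycle mu nu a b c f g : (forall a b c f, dvK (asc mu a b c f)) ->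
  dvK (sw nu a (fun x y => cpt mu nu b c (lact mu f x) (lact mu g y))
    - cpt mu nu (pm mu a b) c f g + cpt mu nu a (pm mu b c) f g
    - sw nu c (fun x y => cpt mu nu a b (ract mu x f) (ract mu y g))).
Proof.
move=> amu.
pose HL := sw nu a (fun x y => sw nu b (fun u v => sw nu c (fun z w =>
  pr (pm mu x (pm mu u z)) f * pr (pm mu y (pm mu v w)) g))).
pose HR := sw nu a (fun x y => sw nu b (fun u v => sw nu c (fun z w =>
  pr (pm mu (pm mu x u) z) f * pr (pm mu (pm mu y v) w) g))).
have hA : dvK (HL - HR).
  rewrite /HL /HR -sw_opp -sw_add; apply: dvK_sw => x y.
  rewrite -sw_opp -sw_add; apply: dvK_sw => u v.
  rewrite -sw_opp -sw_add; apply: dvK_sw => z w.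
  set A' := pr (pm mu x _) f; set B' := pr (pm mu y _) g.
  set A := pr (pm mu (pm mu x u) z) f; set B := pr (pm mu (pm mu y v) w) g.
  have -> : A' * B' - A * B = (- asc mu x u z f) * B' + A * (- asc mu y v w g).
    by rewrite /asc -/A -/B -/A' -/B'; ring.
  by apply: dvKD; [apply: dvKM | apply: dvKMl]; apply: dvKN.
have e1 : sw nu a (fun x y => cpt mu nu b c (lact mu f x) (lact mu g y)) =
    sw nu a (fun x y => pr (pm mu b c) (pm nu (lact mu f x) (lact mu g y))) - HL.
  rewrite /HL -sw_opp -sw_add; apply: eq_sw => x y; rewrite /cpt; congr (_ - _).
  by apply: eq_sw => u v; apply: eq_sw => z w; rewrite !pr_lact.
have e2 : cpt mu nu a (pm mu b c) f g = pr (pm mu a (pm mu b c)) (pm nu f g) -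
    sw nu a (fun x y => pr (pm mu b c) (pm nu (lact mu f x) (lact mu g y))).
  rewrite /cpt; congr (_ - _); apply: eq_sw => x y; rewrite -sw_pr.
  by apply: eq_sw => u v; rewrite !pr_lact.
have e3 : sw nu c (fun x y => cpt mu nu a b (ract mu x f) (ract mu y g)) =
    sw nu c (fun x y => pr (pm mu a b) (pm nu (ract mu x f) (ract mu y g))) - HR.
  transitivity (sw nu c (fun z w => pr (pm mu a b) (pm nu (ract mu z f) (ract mu w g)) -
     sw nu a (fun x y => sw nu b (fun u v =>
       pr (pm mu (pm mu x u) z) f * pr (pm mu (pm mu y v) w) g)))).
    apply: eq_sw => z w; rewrite /cpt; congr (_ - _).
    by apply: eq_sw => x y; apply: eq_sw => u v; rewrite !pr_ract.
  rewrite sw_add sw_opp; congr (_ - _); rewrite /HR sw_swap; apply: eq_sw => x y.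
  by rewrite sw_swap.
have e4 : cpt mu nu (pm mu a b) c f g = pr (pm mu (pm mu a b) c) (pm nu f g) -
    sw nu c (fun x y => pr (pm mu a b) (pm nu (ract mu x f) (ract mu y g))).
  rewrite /cpt; congr (_ - _); rewrite sw_swap; apply: eq_sw => x y; rewrite -sw_pr.
  by apply: eq_sw => u v; rewrite !pr_ract.
rewrite e1 e2 e3 e4.
set u1 := sw nu a _; set u2 := sw nu c _.
have -> : forall x y, u1 - HL - (x - u2) + (y - u1) - (u2 - HR) = (y - x) - (HL - HR).
  by move=> x y; ring.
apply: dvKD; last exact: dvKN.
by have := dvKN (amu a b c (pm nu f g)); rewrite /asc opprB.
Qed.

Variables (mu nu : tensor Q) (S : 'M[k]_n.+1) (t tau : 'rV[k]_n.+1) (lam li : k).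
Hypothesis hi : hopf_int (mapt proj mu) (mapt proj nu) S t tau lam li.
Hypotheses (nmu : normal mu) (nnu : normal nu).
Hypotheses (amu : forall a b c f, dvK (asc mu a b c f))
  (anu : forall a b c f, dvK (asc nu a b c f))
  (cq : forall a b f g, dvq (cpt mu nu a b f g)).

(** The product stays fixed. The reduced defect is a cocycle in both directions; [dYP] gives the
    correction of the coproduct that kills it, and [dWP] shows that this correction is a coboundary,
    so coassociativity survives. *)
Lemma correct_coproduct : exists B : tensor Q,
  [/\ (forall j, B ord0 j = 0), (forall j, B j ord0 = 0), (forall i j, B i j 0 ord0 = 0),
    (forall a b c f, dvK (asc (fun i j => nu i j + q *: B i j) a b c f))
    & (forall a b f g, dvK (cpt mu (fun i j => nu i j + q *: B i j) a b f g))].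
Proof.
have [U UE] : exists U, forall a b f g, cpt mu nu a b f g = q * ext4 U a b f g.
  by apply: divisible4; rewrite // /cpt; lin_tac.
pose X := ext4 (fun i j l r => proj (U i j l r)).
have XE a b c f : X a^^ b^^ c^^ f^^ = proj (ext4 U a b c f) by rewrite map_ext4.
have X1 b c f : lin (fun a => X a b c f) by apply: ext4_1.
have X2 a c f : lin (fun b => X a b c f) by apply: ext4_2.
have X3 a b f : lin (fun c => X a b c f) by apply: ext4_3.
have X4 a b c : lin (fun f => X a b c f) by apply: ext4_4.
clearbody X.
have csw f g a b : cpt nu mu f g a b = cpt mu nu a b f g by rewrite cpt_swap.
pose mb := mapt proj mu; pose nb := mapt proj nu.
have Xmu a b c f g : sw nb a (fun x y => X b c (lact mb f x) (lact mb g y))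
    - X (pm mb a b) c f g + X a (pm mb b c) f g
    - sw nb c (fun x y => X a b (ract mb x f) (ract mb y g)) = 0.
  have [{}a ->] := vsurj a; have [{}b ->] := vsurj b; have [{}c ->] := vsurj c.
  have [{}f ->] := vsurj f; have [{}g ->] := vsurj g.
  have := cpt_cocycle nu a b c f g amu.
  under eq_sw => x y do rewrite UE.
  under [X in _ - X]eq_sw => x y do rewrite UE.
  rewrite !sw_mull !UE -!(mulrBr, mulrDr) => /dvK_proj.
  rewrite !(rmorphD, rmorphN) /= -!map_pm -!XE.
  rewrite (@map_sw _ _ proj _ _ _ _ (fun x y => X b^^ c^^ (lact mb f^^ x) (lact mb g^^ y))); last first.
    by move=> x y; rewrite -XE !map_lact.
  rewrite (@map_sw _ _ proj _ _ _ _ (fun x y => X a^^ b^^ (ract mb x f^^) (ract mb y g^^))) //.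
  by move=> x y; rewrite -XE !map_ract.
have Xnu f g h a b : sw mb f (fun x y => X (lact nb a x) (lact nb b y) g h)
    - X a b (pm nb f g) h + X a b f (pm nb g h)
    - sw mb h (fun x y => X (ract nb x a) (ract nb y b) f g) = 0.
  have [{}a ->] := vsurj a; have [{}b ->] := vsurj b; have [{}h ->] := vsurj h.
  have [{}f ->] := vsurj f; have [{}g ->] := vsurj g.
  have := cpt_cocycle mu f g h a b anu.
  under eq_sw => x y do rewrite csw UE.
  under [X in _ - X]eq_sw => x y do rewrite csw UE.
  rewrite !csw !sw_mull !UE -!(mulrBr, mulrDr) => /dvK_proj.
  rewrite !(rmorphD, rmorphN) /= -!map_pm -!XE.
  rewrite (@map_sw _ _ proj _ _ _ _ (fun x y => X (lact nb a^^ x) (lact nb b^^ y) g^^ h^^)); last first.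
    by move=> x y; rewrite -XE !map_lact.
  rewrite (@map_sw _ _ proj _ _ _ _ (fun x y => X (ract nb x a^^) (ract nb y b^^) f^^ g^^)) //.
  by move=> x y; rewrite -XE !map_ract.
have Xo2 a f g : X a (ev k ord0) f g = 0.
  have [{}a ->] := vsurj a; have [{}f ->] := vsurj f; have [{}g ->] := vsurj g.
  by rewrite -(map_ev proj) XE; apply: q_tors; rewrite -UE cpt_one_r.
have Xo3 a b g : X a b (ev k ord0) g = 0.
  have [{}a ->] := vsurj a; have [{}b ->] := vsurj b; have [{}g ->] := vsurj g.
  by rewrite -(map_ev proj) XE; apply: q_tors; rewrite -UE cpt_swap cpt_one_l.
pose w := dW mb nb S t tau X; pose y := dY mb nb S t X.
have w1 v f : vlin v -> lin (fun a => w (v a) f) by apply: lin_dW1.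
have w2 v a : vlin v -> lin (fun f => w a (v f)) by apply: lin_dW2.
have wP a f g : sw nb a (fun x z => pr x f * w z g) - w a (pm nb f g)
    + sw nb a (fun x z => w x f * pr z g) = y a f g by apply: (dWP hi).
have yP a b f g : X a b f g = sw nb a (fun u v => y b (lact mb f u) (lact mb g v))
    - y (pm mb a b) f g + sw nb b (fun u v => y a (ract mb u f) (ract mb v g)).
  by apply: (dYP hi).
have wo1 f : w (ev k ord0) f = 0.
  rewrite /w /dW (sw_one (hopf_bialg (hint_hopf hi))).
  - by rewrite /dY; under eq_sw => u v do (under eq_sw => u' v' do rewrite Xo2; rewrite sw_0); rewrite sw_0.
  - by move=> z; apply: lin_dY1 => //; apply: vlin_id.
  by move=> z; apply: lin_dY3 => //; lin_tac.
have wo2 a : w a (ev k ord0) = 0.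
  rewrite /w /dW; under eq_sw => a1 a2.
    rewrite /dY; under eq_sw => u v.
      under eq_sw => u' v'.
        have -> : lact mb (ev k ord0) (v' *m S) = pr (v' *m S) (ev k ord0) *: ev k ord0.
          apply: pr_ext => g; rewrite prC pr_lact prZl (epsM (hopf_bialg (hint_hopf hi))).
          by rewrite (prC g).
        rewrite (linZ (X3 _ _ _)) Xo3 mulr0; over.
      rewrite sw_0; over.
    rewrite sw_0; over.
  exact: sw_0.
clearbody w y.
pose W : 'M[Q]_n.+1 := \matrix_(i, j) if (i == ord0) || (j == ord0) then 0
  else projT1 (cid (proj_surj (w (ev k j) (ev k i)))).
have WE a f : proj (pr a (f *m W)) = w a^^ f^^.
  rewrite map_pr map_mxM.
  apply: (lin_ext (f := fun a => pr a (f^^ *m W^^)) (g := fun a => w a f^^)) => [||j]; [lin_tac..|].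
  apply: (lin_ext (f := fun f => pr (ev k j) (f *m W^^)) (g := fun f => w (ev k j) f)) => [||i];
    [lin_tac..|].
  rewrite pr_evl -rowE !mxE; case: eqP => [->|_] /=; first by rewrite rmorph0 wo2.
  case: eqP => [->|_] /=; first by rewrite rmorph0 wo1.
  by case: cid.
have oW : o *m W = 0 by apply/rowP=> j; rewrite -rowE !mxE eqxx.
have Wo f : pr o (f *m W) = 0.
  by rewrite pr_evl !mxE big1 // => i _; rewrite mxE eqxx orbT mulr0.
clearbody W.
(* The first-order change of the product [nu] under conjugation by 1 + q W. *)
pose dd f g := pm nu (f *m W) g + pm nu f (g *m W) - (pm nu f g) *m W.
pose B i j := dd (ev Q i) (ev Q j).
have pBE f g : pm B f g = dd f g.
  apply: pr_ext => a.
  apply: (lin_ext (f := fun f => pr (pm B f g) a) (g := fun f => pr (dd f g) a)) => [||i].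
  - by lin_tac.
  - by rewrite /dd; lin_tac.
  apply: (lin_ext (f := fun g => pr (pm B (ev Q i) g) a) (g := fun g => pr (dd (ev Q i) g) a)) => [||j].
  - by lin_tac.
  - by rewrite /dd; lin_tac.
  by rewrite pm_ev.
have ddE a f g : proj (pr a (dd f g)) = y a^^ f^^ g^^.
  rewrite -wP prC /dd prDl prDl -scaleN1r prZl mulN1r !(prC _ a) -!sw_pr.
  rewrite !(rmorphD, rmorphN) WE map_pm -/nb.
  rewrite (@map_sw _ _ proj _ _ _ _ (fun x z => w x f^^ * pr z g^^)); last first.
    by move=> x z; rewrite rmorphM WE map_pr.
  rewrite (@map_sw _ _ proj _ _ _ _ (fun x z => pr x f^^ * w z g^^)); last first.
    by move=> x z; rewrite rmorphM WE map_pr.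
  by ring.
exists B; split.
- by move=> j; rewrite /B /dd oW (normal_1l _ nnu) (normal_1l _ nnu) (vlin0 (vlin_pml nu _ (@vlin_id Q n))) add0r subrr.
- by move=> j; rewrite /B /dd oW (normal_1r _ nnu) (normal_1r _ nnu) (vlin0 (vlin_pmr nu _ (@vlin_id Q n))) addr0 subrr.
- move=> i j; rewrite -pr_evl /B /dd prC prDl prDl -scaleN1r prZl mulN1r.
  by rewrite !(normal_eps _ _ nnu) !(prC _ o) !Wo; ring.
- move=> f g h a.
  have pmD u v : pm (fun i j => nu i j + q *: B i j) u v = pm nu u v + q *: dd u v.
    rewrite -pBE /pm scaler_sumr -big_split /=; apply: eq_bigr => i _.
    rewrite scaler_sumr -big_split /=; apply: eq_bigr => j _.
    by rewrite scalerDr !scalerA [q * _]mulrC.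
  pose Br := asc nu (f *m W) g h a + asc nu f (g *m W) h a + asc nu f g (h *m W) a
     - asc nu f g h (a *m W^T).
  (* The first-order variation of the associator of [nu] is a combination of its associators at
     arguments moved by W, all in q ker([proj]) by [anu]. The second-order term carries q^2. *)
  have BrE : pr (dd (pm nu f g) h + pm nu (dd f g) h - pm nu f (dd g h) - dd f (pm nu g h)) a = Br.
    rewrite /Br /asc -!pr_mx /dd !(pmDl, pmDr, pmNl, pmNr).
    have prN (x z : 'rV[Q]_n.+1) : pr (- x) z = - pr x z by rewrite -scaleN1r prZl mulN1r.
    by rewrite !(prDl, prN); ring.
  have -> : asc (fun i j => nu i j + q *: B i j) f g h a = asc nu f g h a + Br * q +
      q * (q * pr (dd (dd f g) h - dd f (dd g h)) a).
    have prN (x z : 'rV[Q]_n.+1) : pr (- x) z = - pr x z by rewrite -scaleN1r prZl mulN1r.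
    have ddD u v z : dd (u + q *: v) z = dd u z + q *: dd v z.
      by rewrite -!pBE pmDl pmZl.
    have ddD' u v z : dd z (u + q *: v) = dd z u + q *: dd z v.
      by rewrite -!pBE pmDr pmZr.
    rewrite -BrE /asc !pmD !(ddD, ddD', pmDl, pmDr, pmZl, pmZr) !(prDl, prN, prZl).
    by ring.
  apply: dvKD; last by apply: dvK_q; exists (pr (dd (dd f g) h - dd f (dd g h)) a).
  apply: dvKD; first exact: anu.
  by apply: dvKM; rewrite /Br; apply: dvKD; [apply: dvKD; [apply: dvKD; apply: anu | exact: anu] | apply: dvKN; apply: anu].
move=> a b f g.
have swD (c : 'rV[Q]_n.+1) G : sw (fun i j => nu i j + q *: B i j) c G = sw nu c G + q * sw B c G.
  rewrite /sw mulr_sumr -big_split /=; apply: eq_bigr => i _.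
  rewrite mulr_sumr -big_split /=; apply: eq_bigr => j _.
  by rewrite prC prDl prZl !(prC _ c) mulrDl mulrA.
have pmD u v : pm (fun i j => nu i j + q *: B i j) u v = pm nu u v + q *: dd u v.
  rewrite -pBE /pm scaler_sumr -big_split /=; apply: eq_bigr => i _.
  rewrite scaler_sumr -big_split /=; apply: eq_bigr => j _.
  by rewrite scalerDr !scalerA [q * _]mulrC.
pose G a1 a2 b1 b2 := pr (pm mu a1 b1) f * pr (pm mu a2 b2) g.
pose Y1 := sw nu a (fun a1 a2 => pr b (dd (lact mu f a1) (lact mu g a2))).
pose Y2 := sw nu b (fun b1 b2 => pr a (dd (ract mu b1 f) (ract mu b2 g))).
have Y1E : sw nu a (fun a1 a2 => sw B b (fun b1 b2 => G a1 a2 b1 b2)) = Y1.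
  apply: eq_sw => a1 a2; rewrite -pBE -sw_pr; apply: eq_sw => b1 b2.
  by rewrite !pr_lact.
have Y2E : sw B a (fun a1 a2 => sw nu b (fun b1 b2 => G a1 a2 b1 b2)) = Y2.
  rewrite sw_swap; apply: eq_sw => b1 b2; rewrite -pBE -sw_pr; apply: eq_sw => a1 a2.
  by rewrite !pr_ract.
pose R := sw B a (fun a1 a2 => sw B b (fun b1 b2 => G a1 a2 b1 b2)).
exists (ext4 U a b f g + pr (pm mu a b) (dd f g) - Y1 - Y2 - q * R).
  rewrite !(rmorphD, rmorphN) rmorphM proj_q mul0r subr0 -XE yP ddE map_pm /Y1 /Y2.
  rewrite (@map_sw _ _ proj _ _ _ _ (fun u v => y b^^ (lact mb f^^ u) (lact mb g^^ v))); last first.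
    by move=> u v; rewrite ddE !map_lact.
  rewrite (@map_sw _ _ proj _ _ _ _ (fun u v => y a^^ (ract mb u f^^) (ract mb v g^^))); last first.
    by move=> u v; rewrite ddE !map_ract.
  by ring.
rewrite !(mulrBr, mulrDr) -UE /cpt pmD swD.
under [X in _ - (X + _)]eq_sw => a1 a2 do rewrite swD -/(G a1 a2 _ _).
under [X in _ - (_ + q * X)]eq_sw => a1 a2 do rewrite swD.
rewrite !sw_add !sw_mull -/G Y1E Y2E -/R (prC _ (_ + _)) prDl prZl !(prC _ (pm mu a b)).
by ring.
Qed.
End Coproduct.
End Lifting.

(** * Base change and convolution *)

Section MapHopf.
Variables (F G : comNzRingType) (phi : {rmorphism F -> G}) (n : nat).
Variables (mu nu : 'I_n.+1 -> 'I_n.+1 -> 'rV[F]_n.+1) (S : 'M[F]_n.+1).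
Local Notation mp := (map_mx phi).
Local Notation mt := (mapt phi).
Local Notation oF := (ev F (ord0 : 'I_n.+1)).
Local Notation oG := (ev G (ord0 : 'I_n.+1)).

Lemma mu_map_assoc m : (forall a b c : 'rV[F]_n.+1, pm m (pm m a b) c = pm m a (pm m b c)) ->
  forall a b c, pm (mt m) (pm (mt m) a b) c = pm (mt m) a (pm (mt m) b c).
Proof.
move=> h a b c; apply: pr_ext => f.
apply: (eq_lin4 (A := fun a b c f => pr (pm (mt m) (pm (mt m) a b) c) f)
  (B := fun a b c f => pr (pm (mt m) a (pm (mt m) b c)) f)); [lin_tac..|] => i j l r.
by rewrite -!(map_ev phi) -!map_pm -!map_pr h.
Qed.
Lemma mu_map_1l m : (forall a, pm m oF a = a) -> forall a, pm (mt m) oG a = a.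
Proof.
move=> h a; apply: pr_ext => f.
apply: (lin_ext (f := fun a => pr (pm (mt m) oG a) f) (g := fun a => pr a f)) => [||i]; [lin_tac..|].
by rewrite -!(map_ev phi) -!map_pm h.
Qed.
Lemma mu_map_1r m : (forall a, pm m a oF = a) -> forall a, pm (mt m) a oG = a.
Proof.
move=> h a; apply: pr_ext => f.
apply: (lin_ext (f := fun a => pr (pm (mt m) a oG) f) (g := fun a => pr a f)) => [||i]; [lin_tac..|].
by rewrite -!(map_ev phi) -!map_pm h.
Qed.
Lemma mu_map_eps m : (forall a b, pr (pm m a b) oF = pr a oF * pr b oF) ->
  forall a b, pr (pm (mt m) a b) oG = pr a oG * pr b oG.
Proof.
move=> h a b.
apply: (lin_ext (f := fun a => pr (pm (mt m) a b) oG) (g := fun a => pr a oG * pr b oG)) => [||i];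
  [lin_tac..|].
apply: (lin_ext (f := fun b => pr (pm (mt m) (ev G i) b) oG)
  (g := fun b => pr (ev G i) oG * pr b oG)) => [||j]; [lin_tac..|].
by rewrite -!(map_ev phi) -!map_pm -!map_pr h rmorphM.
Qed.

Lemma bialg_map : bialg mu nu -> bialg (mt mu) (mt nu).
Proof.
move=> hb; case: (hb) => h1 h2 h3 h4 h5 h6 h7 h8 h9; split.
- exact: mu_map_assoc.
- exact: mu_map_assoc.
- exact: mu_map_1l.
- exact: mu_map_1r.
- exact: mu_map_1l.
- exact: mu_map_1r.
- exact: mu_map_eps.
- by move=> f g; rewrite prC mu_map_eps ?(prC oG) // => a b; rewrite prC h8 !(prC oF).
apply: eq_lin4; [lin_tac..|] => i j l r.
rewrite -!(map_ev phi) -!map_pm -map_pr h9.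
rewrite (@map_sw _ _ phi _ _ _ _ (fun a1 a2 => sw (mt nu) (mp (ev F j)) (fun b1 b2 =>
  pr (pm (mt mu) a1 b1) (mp (ev F l)) * pr (pm (mt mu) a2 b2) (mp (ev F r))))) //.
move=> x y; rewrite (@map_sw _ _ phi _ _ _ _ (fun b1 b2 =>
  pr (pm (mt mu) (mp x) b1) (mp (ev F l)) * pr (pm (mt mu) (mp y) b2) (mp (ev F r)))) //.
by move=> z w; rewrite rmorphM !map_pr !map_pm.
Qed.

Lemma hopf_map : hopf mu nu S -> hopf (mt mu) (mt nu) (mp S).
Proof.
case=> hb hl hr; split; first exact: bialg_map.
- move=> a f.
  apply: (lin_ext (f := fun a => sw (mt nu) a (fun x y => pr (pm (mt mu) (x *m mp S) y) f))
    (g := fun a => pr a oG * pr oG f)) => [||i]; [lin_tac..|].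
  apply: (lin_ext (f := fun f => sw (mt nu) (ev G i) (fun x y => pr (pm (mt mu) (x *m mp S) y) f))
    (g := fun f => pr (ev G i) oG * pr oG f)) => [||j]; [lin_tac..|].
  rewrite -!(map_ev phi) -!map_pr -rmorphM -hl.
  rewrite (@map_sw _ _ phi _ _ _ _ (fun x y => pr (pm (mt mu) (x *m mp S) y) (mp (ev F j)))) //.
  by move=> x y; rewrite map_pr map_pm map_mxM.
move=> a f.
apply: (lin_ext (f := fun a => sw (mt nu) a (fun x y => pr (pm (mt mu) x (y *m mp S)) f))
  (g := fun a => pr a oG * pr oG f)) => [||i]; [lin_tac..|].
apply: (lin_ext (f := fun f => sw (mt nu) (ev G i) (fun x y => pr (pm (mt mu) x (y *m mp S)) f))
  (g := fun f => pr (ev G i) oG * pr oG f)) => [||j]; [lin_tac..|].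
rewrite -!(map_ev phi) -!map_pr -rmorphM -hr.
rewrite (@map_sw _ _ phi _ _ _ _ (fun x y => pr (pm (mt mu) x (y *m mp S)) (mp (ev F j)))) //.
by move=> x y; rewrite map_pr map_pm map_mxM.
Qed.

Lemma int_map_l m (t : 'rV[F]_n.+1) : (forall a, pm m a t = pr a oF *: t) ->
  forall a, pm (mt m) a (mp t) = pr a oG *: mp t.
Proof.
move=> h a; apply: pr_ext => f; rewrite prZl.
apply: (lin_ext (f := fun a => pr (pm (mt m) a (mp t)) f)
  (g := fun a => pr a oG * pr (mp t) f)) => [||i]; [lin_tac..|].
by rewrite -!(map_ev phi) -!map_pm h -map_pr map_mxZ prZl.
Qed.
Lemma int_map_r m (t : 'rV[F]_n.+1) : (forall a, pm m t a = pr a oF *: t) ->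
  forall a, pm (mt m) (mp t) a = pr a oG *: mp t.
Proof.
move=> h a; apply: pr_ext => f; rewrite prZl.
apply: (lin_ext (f := fun a => pr (pm (mt m) (mp t) a) f)
  (g := fun a => pr a oG * pr (mp t) f)) => [||i]; [lin_tac..|].
by rewrite -!(map_ev phi) -!map_pm h -map_pr map_mxZ prZl.
Qed.

Lemma hopf_int_map t tau lam li : hopf_int mu nu S t tau lam li ->
  hopf_int (mt mu) (mt nu) (mp S) (mp t) (mp tau) (phi lam) (phi li).
Proof.
case=> hh h1 h2 h3 h4 h5 h6 h7 h8; split.
- exact: hopf_map.
- exact: int_map_l.
- exact: int_map_r.
- by rewrite -(map_ev phi) -map_pr h3 rmorph1.
- by move=> f; rewrite prC; apply: int_map_l => a; rewrite h4 prC.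
- by move=> f; rewrite prC; apply: int_map_r => a; rewrite h5 prC.
- by rewrite -(map_ev phi) -map_pr h6 rmorph1.
- by rewrite -map_pr h7.
by rewrite -rmorphM h8 rmorph1.
Qed.
End MapHopf.

Section Convolution.
Variables (F : comNzRingType) (n : nat).
Variables (mu nu : 'I_n.+1 -> 'I_n.+1 -> 'rV[F]_n.+1) (hb : bialg mu nu).
Local Notation o := (ev F (ord0 : 'I_n.+1)).
Implicit Types A B C : 'M[F]_n.+1.

Definition conv A B : 'M[F]_n.+1 :=
  \matrix_(i, j) sw nu (ev F i) (fun x y => pr (pm mu (x *m A) (y *m B)) (ev F j)).
Definition eta : 'M[F]_n.+1 := \matrix_(i, j) (pr (ev F i) o * pr o (ev F j)).

Lemma pr_mxE A a f : pr (a *m A) f = \sum_i \sum_j pr a (ev F i) * pr f (ev F j) * A i j.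
Proof.
rewrite (bilin_ev (B := fun a f => pr (a *m A) f)); [|lin_tac..].
by apply: eq_bigr => i _; apply: eq_bigr => j _; congr (_ * _); rewrite pr_evr -rowE mxE.
Qed.

Lemma mx_ext_pr A B : (forall a f, pr (a *m A) f = pr (a *m B) f) -> A = B.
Proof.
by move=> h; apply/matrixP => i j; have := h (ev F i) (ev F j); rewrite -!rowE !pr_evr !mxE.
Qed.

Lemma pr_conv A B a f :
  pr (a *m conv A B) f = sw nu a (fun x y => pr (pm mu (x *m A) (y *m B)) f).
Proof.
rewrite pr_mxE [RHS](bilin_ev (B := fun a f => sw nu a (fun x y => pr (pm mu (x *m A) (y *m B)) f)));
  [|lin_tac..].
by apply: eq_bigr => i _; apply: eq_bigr => j _; rewrite mxE.
Qed.
Lemma pr_eta a f : pr (a *m eta) f = pr a o * pr o f.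
Proof.
rewrite pr_mxE [RHS](bilin_ev (B := fun a f => pr a o * pr o f)); [|lin_tac..].
by apply: eq_bigr => i _; apply: eq_bigr => j _; rewrite mxE.
Qed.

Lemma convA A B C : conv (conv A B) C = conv A (conv B C).
Proof.
apply: mx_ext_pr => a f; rewrite !pr_conv.
under eq_sw => x y do rewrite -pr_ract pr_conv.
rewrite (sw_coassoc hb); apply: eq_sw => x r.
rewrite -pr_lact pr_conv; apply: eq_sw => y z.
by rewrite pr_lact pr_ract (muA hb).
Qed.
Lemma conv1l A : conv eta A = A.
Proof.
apply: mx_ext_pr => a f; rewrite pr_conv.
under eq_sw => x y do rewrite -pr_ract pr_eta pr_ract (mu1l hb).
by rewrite (sw_counitl hb _ (g := fun y => pr (y *m A) f)) //; lin_tac.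
Qed.
Lemma conv1r A : conv A eta = A.
Proof.
apply: mx_ext_pr => a f; rewrite pr_conv.
under eq_sw => x y do rewrite -pr_lact pr_eta pr_lact (mu1r hb) mulrC.
by rewrite (sw_counitr hb _ (g := fun y => pr (y *m A) f)) //; lin_tac.
Qed.
Lemma convDl A B C : conv (A + B) C = conv A C + conv B C.
Proof.
apply/matrixP=> i j; rewrite !mxE -sw_add; apply: eq_sw => x y.
rewrite mulmxDr; have l := lin_prl (ev F j) (vlin_pml mu (y *m C) (@vlin_id F n)).
by rewrite (linD l).
Qed.
Lemma convDr A B C : conv C (A + B) = conv C A + conv C B.
Proof.
apply/matrixP=> i j; rewrite !mxE -sw_add; apply: eq_sw => x y.
rewrite mulmxDr; have l := lin_prl (ev F j) (vlin_pmr mu (x *m C) (@vlin_id F n)).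
by rewrite (linD l).
Qed.
Lemma convZl c A B : conv (c *: A) B = c *: conv A B.
Proof.
apply/matrixP=> i j; rewrite !mxE -sw_mull; apply: eq_sw => x y.
rewrite -scalemxAr; have l := lin_prl (ev F j) (vlin_pml mu (y *m B) (@vlin_id F n)).
by rewrite (linZ l).
Qed.
Lemma convZr c A B : conv B (c *: A) = c *: conv B A.
Proof.
apply/matrixP=> i j; rewrite !mxE -sw_mull; apply: eq_sw => x y.
rewrite -scalemxAr; have l := lin_prl (ev F j) (vlin_pmr mu (x *m B) (@vlin_id F n)).
by rewrite (linZ l).
Qed.

Lemma hopf_convl S : hopf mu nu S -> conv S 1%:M = eta.
Proof.
move=> h; apply: mx_ext_pr => a f; rewrite pr_conv pr_eta -(antil h).
by apply: eq_sw => x y; rewrite mulmx1.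
Qed.
Lemma hopf_convr S : hopf mu nu S -> conv 1%:M S = eta.
Proof.
move=> h; apply: mx_ext_pr => a f; rewrite pr_conv pr_eta -(antir h).
by apply: eq_sw => x y; rewrite mulmx1.
Qed.
Lemma conv_hopf S S' : conv S 1%:M = eta -> conv 1%:M S' = eta -> hopf mu nu S.
Proof.
move=> h1 h2; have e : S = S' by rewrite -[S]conv1r -h2 -convA h1 conv1l.
split=> // a f.
  by rewrite -pr_eta -h1 pr_conv; apply: eq_sw => x y; rewrite mulmx1.
by rewrite -pr_eta -h2 pr_conv e; apply: eq_sw => x y; rewrite mulmx1.
Qed.
Lemma antipode_unique S S' : hopf mu nu S -> hopf mu nu S' -> S = S'.
Proof.
by move=> h h'; rewrite -[S]conv1r -(hopf_convr h') -convA (hopf_convl h) conv1l.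
Qed.
End Convolution.

(** * Lifting to a p-adic ring *)

Section Congruence.
Variables (Q : comNzRingType) (n : nat) (q : Q).
Local Notation V := 'rV[Q]_n.+1.
Local Notation tensor := ('I_n.+1 -> 'I_n.+1 -> V).

Implicit Types (m B mu nu : tensor).
Definition addq (m B : tensor) : tensor := fun i j => m i j + q *: B i j.
Definition eqq x y := dvq q (x - y).

Lemma eqq_refl x : eqq x x.
Proof. by rewrite /eqq subrr; apply: dvq0. Qed.
Lemma eqqD x y x' y' : eqq x x' -> eqq y y' -> eqq (x + y) (x' + y').
Proof. by move=> h h'; rewrite /eqq opprD addrACA; apply: dvqD. Qed.
Lemma eqqB x y x' y' : eqq x x' -> eqq y y' -> eqq (x - y) (x' - y').
Proof.
move=> h h'; apply: eqqD => //; rewrite /eqq -opprD; exact: dvqN.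
Qed.
Lemma eqqM x y x' y' : eqq x x' -> eqq y y' -> eqq (x * y) (x' * y').
Proof.
move=> h h'; rewrite /eqq.
have -> : x * y - x' * y' = (x - x') * y + x' * (y - y') by ring.
by apply: dvqD; [apply: dvqM | apply: dvqMl].
Qed.
Lemma eqq_dvq x y : eqq x y -> dvq q y -> dvq q x.
Proof. by move=> h hy; rewrite -[x](subrK y); apply: dvqD. Qed.

Lemma pm_addq m B (x y : V) : pm (addq m B) x y = pm m x y + q *: pm B x y.
Proof.
rewrite /pm scaler_sumr -big_split /=; apply: eq_bigr => i _.
rewrite scaler_sumr -big_split /=; apply: eq_bigr => j _.
by rewrite scalerDr !scalerA [q * _]mulrC.
Qed.
Lemma eqq_pr_pm m B (x y f : V) : eqq (pr (pm (addq m B) x y) f) (pr (pm m x y) f).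
Proof.
by exists (pr (pm B x y) f); rewrite pm_addq prDl prZl addrC addKr.
Qed.
Lemma eqq_sw m B (a : V) G G' : (forall x y, eqq (G x y) (G' x y)) ->
  eqq (sw (addq m B) a G) (sw m a G').
Proof.
move=> h; rewrite /sw.
elim/big_rec2: _ => [|i x y _ hx]; first exact: eqq_refl.
apply: eqqD => //; elim/big_rec2: _ => [|j x' y' _ hx']; first exact: eqq_refl.
apply: eqqD => //; apply: eqqM => //.
by exists (pr a (B i j)); rewrite prC prDl prZl !(prC _ a) addrC addKr.
Qed.
Lemma eqq_cpt mu nu B B' (a b f g : V) :
  eqq (cpt (addq mu B) (addq nu B') a b f g) (cpt mu nu a b f g).
Proof.
apply: eqqB.
  rewrite pm_addq prDl prZl; exists (pr (pm mu a b) (pm B' f g) + pr (pm B a b) (pm (addq nu B') f g)).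
  rewrite (prC (pm mu a b)) pm_addq prDl prZl !(prC _ (pm mu a b)); ring.
apply: eqq_sw => a1 a2; apply: eqq_sw => b1 b2.
by apply: eqqM; apply: eqq_pr_pm.
Qed.

Lemma normal_addq m B : normal m -> (forall j, B ord0 j = 0) -> (forall j, B j ord0 = 0) ->
  (forall i j, B i j 0 ord0 = 0) -> normal (addq m B).
Proof.
case=> h1 h2 h3 b1 b2 b3; split=> [j|j|i j].
- by rewrite /addq h1 b1 scaler0 addr0.
- by rewrite /addq h2 b2 scaler0 addr0.
by rewrite !mxE h3 b3 mulr0 addr0.
Qed.

Lemma dvq_lin4 (A : V -> V -> V -> V -> Q) :
  (forall b c f, lin (fun a => A a b c f)) -> (forall a c f, lin (fun b => A a b c f)) ->
  (forall a b f, lin (fun c => A a b c f)) -> (forall a b c, lin (fun f => A a b c f)) ->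
  (forall i j k l, dvq q (A (ev Q i) (ev Q j) (ev Q k) (ev Q l))) ->
  forall a b c f, dvq q (A a b c f).
Proof.
move=> a1 a2 a3 a4 h a b c f.
have -> : A a b c f = ext4 (fun i j k l => A (ev Q i) (ev Q j) (ev Q k) (ev Q l)) a b c f.
  by apply: eq_lin4 => //; [rewrite /ext4; lin_tac..|] => i j k l; rewrite ext4_ev.
have sum (G : 'I_n.+1 -> Q) : (forall i, dvq q (G i)) -> dvq q (\sum_i G i).
  by move=> hG; elim/big_rec: _ => [|i x _ hx]; [exact: dvq0 | exact: dvqD].
by rewrite /ext4; do 4 (apply sum; move=> ?); do 4 apply: dvqMl.
Qed.
End Congruence.

Section MapDefects.
Variables (F G : comNzRingType) (phi : {rmorphism F -> G}) (n : nat).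
Implicit Types m mu nu : 'I_n.+1 -> 'I_n.+1 -> 'rV[F]_n.+1.
Local Notation mp := (map_mx phi).

Lemma map_asc m a b c f : phi (asc m a b c f) = asc (mapt phi m) (mp a) (mp b) (mp c) (mp f).
Proof. by rewrite rmorphB !map_pr !map_pm. Qed.
Lemma map_cpt mu nu a b f g : phi (cpt mu nu a b f g) =
  cpt (mapt phi mu) (mapt phi nu) (mp a) (mp b) (mp f) (mp g).
Proof.
rewrite rmorphB map_pr !map_pm; congr (_ - _).
apply: (@map_sw _ _ phi) => x y; apply: (@map_sw _ _ phi) => z w.
by rewrite rmorphM !map_pr !map_pm.
Qed.
Lemma normal_map m : normal m -> normal (mapt phi m).
Proof.
case=> h1 h2 h3; split=> [j|j|i j]; rewrite /mapt ?h1 ?h2 ?map_ev //.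
by rewrite mxE h3 rmorph_nat.
Qed.
Lemma map_conv mu nu A B : mp (conv mu nu A B) = conv (mapt phi mu) (mapt phi nu) (mp A) (mp B).
Proof.
apply/matrixP=> i j; rewrite !mxE -!(map_ev phi); apply: (@map_sw _ _ phi) => x y.
by rewrite map_pr map_pm !map_mxM.
Qed.
Lemma map_eta : mp (eta F n) = eta G n.
Proof. by apply/matrixP=> i j; rewrite !mxE rmorphM !map_pr !map_ev. Qed.
End MapDefects.

Section Stages.
Variables (k : fieldType) (Q : comNzRingType) (proj : {rmorphism Q -> k}).
Variables (Phi : {rmorphism Q -> Q}) (fr : {rmorphism k -> k}) (p N n : nat).
Local Notation P := (p%:R : Q).
Hypotheses (proj_surj : forall c, exists x, proj x = c)
  (projPhi : forall z, proj (Phi z) = fr (proj z))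
  (kerPhi : forall z, proj z = 0 -> exists y, Phi z = P * y)
  (tors : forall j z, (j < N)%N -> P ^+ j * z = 0 -> proj z = 0)
  (nilP : P ^+ N = 0) (pk0 : p%:R = 0 :> k).
Local Notation tensor R := ('I_n.+1 -> 'I_n.+1 -> 'rV[R]_n.+1).

Definition stage j (mu nu : tensor Q) := [/\ normal mu, normal nu,
  (forall a b c f, dvq (P ^+ j) (asc mu a b c f)),
  (forall a b c f, dvq (P ^+ j) (asc nu a b c f))
  & (forall a b f g, dvq (P ^+ j) (cpt mu nu a b f g))].

(** A vector need not be an image under [Phi], but basis vectors are fixed by it; divisibility is
    checked on these and extended by multilinearity. *)
Lemma asc_Phi m q q' : (forall a b c f, dvK proj q (asc m a b c f)) ->
  (forall z, dvK proj q z -> dvq q' (Phi z)) ->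
  forall a b c f : 'rV[Q]_n.+1, dvq q' (asc (mapt Phi m) a b c f).
Proof.
move=> h hq; apply: dvq_lin4; [by rewrite /asc; lin_tac..|] => i j l r.
have <- : Phi (asc m (ev Q i) (ev Q j) (ev Q l) (ev Q r)) =
  asc (mapt Phi m) (ev Q i) (ev Q j) (ev Q l) (ev Q r) by rewrite map_asc !map_ev.
exact: hq.
Qed.
Lemma cpt_Phi mu nu q q' : (forall a b c f, dvK proj q (cpt mu nu a b c f)) ->
  (forall z, dvK proj q z -> dvq q' (Phi z)) ->
  forall a b c f : 'rV[Q]_n.+1, dvq q' (cpt (mapt Phi mu) (mapt Phi nu) a b c f).
Proof.
move=> h hq; apply: dvq_lin4; [by rewrite /cpt; lin_tac..|] => i j l r.
have <- : Phi (cpt mu nu (ev Q i) (ev Q j) (ev Q l) (ev Q r)) =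
  cpt (mapt Phi mu) (mapt Phi nu) (ev Q i) (ev Q j) (ev Q l) (ev Q r) by rewrite map_cpt !map_ev.
exact: hq.
Qed.

Lemma dvK_Phi j z : dvK proj (P ^+ j) z -> dvq (P ^+ j.+1) (Phi z).
Proof.
case=> y /kerPhi [y' hy] ->; exists y'.
by rewrite rmorphM rmorphXn rmorph_nat hy exprSr mulrA.
Qed.

Lemma mapt_proj_Phi (m : tensor Q) : mapt proj (mapt Phi m) = mapt fr (mapt proj m).
Proof.
apply/funext => i; apply/funext => j.
by apply/rowP=> l; rewrite !mxE projPhi.
Qed.
Lemma mapt_proj_addq q (m B : tensor Q) : proj q = 0 -> mapt proj (addq q m B) = mapt proj m.
Proof.
move=> hq; apply/funext => i; apply/funext => j.
by apply/rowP=> l; rewrite !mxE rmorphD rmorphM hq mul0r addr0.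
Qed.
Lemma mapt_comp (f g : {rmorphism k -> k}) (m : tensor k) :
  mapt f (mapt g m) = mapt (f \o g) m.
Proof.
apply/funext => i; apply/funext => j.
by apply/rowP=> l; rewrite !mxE.
Qed.

(** Correcting both products and then the coproduct puts all defects in p^j ker([proj]), without
    changing the reduction modulo ker([proj]). Applying [Phi] makes them divisible by p^(j+1), at
    the price of twisting the reduction by [fr]. *)
Lemma stageS j mu nu S t tau lam li : (0 < j < N)%N ->
  hopf_int (mapt proj mu) (mapt proj nu) S t tau lam li -> stage j mu nu ->
  exists mu' nu', [/\ stage j.+1 mu' nu', mapt proj mu' = mapt fr (mapt proj mu)
    & mapt proj nu' = mapt fr (mapt proj nu)].
Proof.
case/andP=> j0 jN hi [nm nn amu anu cq].
have pq : proj (P ^+ j) = 0 by rewrite rmorphXn rmorph_nat pk0 expr0n; case: (j) j0.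
have tq z : P ^+ j * z = 0 -> proj z = 0 by exact: tors.
have [B [b1 b2 b3 b4]] := correct_product proj_surj pq tq hi nm amu.
(* Coassociativity is corrected as associativity of the dual Hopf algebra. *)
have [B' [b1' b2' b3' b4']] := correct_product proj_surj pq tq (hopf_int_swap hi) nn anu.
pose mu1 := addq (P ^+ j) mu B; pose nu1 := addq (P ^+ j) nu B'.
have n1 : normal mu1 by apply: normal_addq.
have n1' : normal nu1 by apply: normal_addq.
have hi1 : hopf_int (mapt proj mu1) (mapt proj nu1) S t tau lam li.
  by rewrite /mu1 /nu1 !mapt_proj_addq.
have cq1 a b f g : dvq (P ^+ j) (cpt mu1 nu1 a b f g).
  by apply: (eqq_dvq (eqq_cpt _ _ _ _ _ _ _ _ _)).
have [C [c1 c2 c3 c4 c5]] := correct_coproduct proj_surj pq tq hi1 n1 n1' b4 b4' cq1.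
pose nu2 := addq (P ^+ j) nu1 C.
have n2 : normal nu2 by apply: normal_addq.
exists (mapt Phi mu1), (mapt Phi nu2); split; last first.
- by rewrite mapt_proj_Phi /nu2 /nu1 !mapt_proj_addq.
- by rewrite mapt_proj_Phi /mu1 !mapt_proj_addq.
have hK z : dvK proj (P ^+ j) z -> dvq (P ^+ j.+1) (Phi z) by exact: dvK_Phi.
split; try exact: normal_map.
- exact: asc_Phi b4 hK.
- exact: asc_Phi c4 hK.
exact: cpt_Phi c5 hK.
Qed.

(** Arbitrary normalized lifts of the structure constants have all their defects in ker([proj]),
    that is in [dvK proj 1]; [Phi] makes them divisible by p. *)
Lemma stage1 (m m' : tensor k) : bialg m m' ->
  exists mu nu, [/\ stage 1 mu nu, mapt proj mu = mapt fr m & mapt proj nu = mapt fr m'].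
Proof.
move=> hb.
have lift (x y : tensor k) : bialg x y -> exists X, normal X /\ mapt proj X = x.
  move=> hx; pose X (i j : 'I_n.+1) : 'rV[Q]_n.+1 := if i == ord0 then ev Q j else
    if j == ord0 then ev Q i else lift_tensor proj_surj x i j.
  exists X; split.
    split=> [j|j|i j]; rewrite /X ?eqxx //; first by case: eqP => [->|].
    case: (i =P ord0) => [_|i0] /=; first by rewrite evE eq_sym.
    case: (j =P ord0) => [_|j0] /=; last by rewrite mxE eqxx !orbT.
    by rewrite evE eq_sym; case: eqP.
  apply/funext => i; apply/funext => j.
  rewrite /mapt /X; case: eqP => [->|/eqP i0]; first by rewrite map_ev -pm_ev (mu1l hx).
  case: eqP => [->|/eqP j0]; first by rewrite map_ev -pm_ev (mu1r hx).
  apply/rowP=> l; rewrite !mxE (negPf i0) (negPf j0) /=; case: eqP => [->|_].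
    by rewrite rmorph0 -pr_evr -pm_ev (epsM hx) !pr_evl !evE (negPf i0) mul0r.
  by case: cid.
have [mu [n1 e1]] := lift _ _ hb; have [nu [n2 e2]] := lift _ _ (bialg_swap hb).
exists (mapt Phi mu), (mapt Phi nu); rewrite !mapt_proj_Phi e1 e2; split=> //.
have hK z : dvK proj 1 z -> dvq (P ^+ 1) (Phi z) by rewrite -(expr0 P); exact: dvK_Phi.
have K1 z : proj z = 0 -> dvK proj 1 z by exists z; rewrite ?mul1r.
split; try exact: normal_map.
- apply: asc_Phi hK => a b c f; apply: K1.
  by rewrite map_asc e1 /asc (muA hb) subrr.
- apply: asc_Phi hK => a b c f; apply: K1.
  by rewrite map_asc e2 /asc (nuA hb) subrr.
apply: cpt_Phi hK => a b c f; apply: K1.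
by rewrite map_cpt e1 e2 /cpt (mu_nu hb) subrr.
Qed.

(** [psi] is an iterate of [fr]. The twisted reduction is again a Hopf algebra with integrals by
    base change, which is what the next stage asks for. *)
Lemma stages (m m' : tensor k) S t tau lam li : hopf_int m m' S t tau lam li ->
  forall j, (0 < j <= N)%N -> exists mu nu (psi : {rmorphism k -> k}),
    [/\ stage j mu nu, mapt proj mu = mapt psi m & mapt proj nu = mapt psi m'].
Proof.
move=> hi; case=> // j; elim: j => [|j IH] jN.
  have [mu [nu [h1 h2 h3]]] := stage1 (hopf_bialg (hint_hopf hi)).
  by exists mu, nu, fr.
have [|mu [nu [psi [h1 h2 h3]]]] := IH; first by rewrite /= ltnW.
have hi' : hopf_int (mapt proj mu) (mapt proj nu) (map_mx psi S) (map_mx psi t)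
    (map_mx psi tau) (psi lam) (psi li) by rewrite h2 h3; apply: hopf_int_map.
have [|mu' [nu' [h1' h2' h3']]] := stageS _ hi' h1; first by [].
by exists mu', nu', (fr \o psi); split=> //; rewrite ?h2' ?h3' ?h2 ?h3 mapt_comp.
Qed.

(** If y0 lifts the inverse of [proj z], then 1 - z y0 lies in ker([proj]), so [Phi (z * y0)] has
    the form 1 - p w. Since p^N = 0, a geometric series inverts it. *)
Lemma unit_Phi z : proj z != 0 -> exists y, Phi z * y = 1.
Proof.
move=> z0; have [y0 hy] := proj_surj (proj z)^-1.
have [|w hw] := kerPhi (z := 1 - z * y0).
  by rewrite rmorphB rmorph1 rmorphM hy mulfV // subrr.
exists (Phi y0 * \sum_(i < N) (P * w) ^+ i); rewrite mulrA -rmorphM.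
have -> : Phi (z * y0) = 1 - P * w by rewrite -hw rmorphB rmorph1 opprB addrC subrK.
rewrite -[1 - _]opprB mulNr -subrX1 exprMn nilP mul0r sub0r opprK //.
Qed.

(** Any matrix lift of S inverts the identity under convolution up to ker([proj]), hence up to p
    after [Phi]. Multiplying by et - p^(j+1) E improves the error et + p^(j+1) E by a power of p,
    until p^(N+1) = 0. Left and right inverses are built separately, and [conv_hopf] identifies
    them. *)
Lemma antipode_lift (mu nu : tensor Q) S : bialg mu nu ->
  hopf (mapt proj mu) (mapt proj nu) S -> exists T, hopf (mapt Phi mu) (mapt Phi nu) T.
Proof.
move=> hb hS; have hb' := bialg_map Phi hb.
pose cv := conv (mapt Phi mu) (mapt Phi nu); pose et := eta Q n.
pose S0 : 'M[Q]_n.+1 := \matrix_(i, j)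
  projT1 (cid (proj_surj (S i j))).
have S0E : map_mx proj S0 = S.
  by apply/matrixP=> i j; rewrite !mxE; case: cid.
have kermx (E : 'M[Q]_n.+1) : map_mx proj E = 0 -> exists E', map_mx Phi E = P *: E'.
  move=> hE; have h i j : exists y, Phi (E i j) = P * y.
    by apply: kerPhi; have /matrixP/(_ i j) := hE; rewrite !mxE.
  exists (\matrix_(i, j) projT1 (cid (h i j))).
  by apply/matrixP=> i j; rewrite !mxE; case: cid.
have init (X Y : 'M[Q]_n.+1) : conv (mapt proj mu) (mapt proj nu) (map_mx proj X) (map_mx proj Y)
      = eta k n -> exists E, cv (map_mx Phi X) (map_mx Phi Y) = et + P *: E.
  move=> e; have [|E hE] := kermx (conv mu nu X Y - eta Q n).
    by rewrite map_mxB map_conv map_eta e subrr.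
  by exists E; rewrite -hE map_mxB map_conv map_eta addrC subrK.
have one1 : map_mx proj 1%:M = 1%:M :> 'M_n.+1 by rewrite map_mx1.
have one2 : map_mx Phi 1%:M = 1%:M :> 'M_n.+1 by rewrite map_mx1.
have cD1 := convDl (mapt Phi mu) (mapt Phi nu); have cD2 := convDr (mapt Phi mu) (mapt Phi nu).
have cZ1 := convZl (mapt Phi mu) (mapt Phi nu); have cZ2 := convZr (mapt Phi mu) (mapt Phi nu).
have gen c E : cv (et + c *: E) (et - c *: E) = et - (c * c) *: cv E E.
  rewrite -scaleNr /cv cD1 !cD2 !cZ1 !cZ2 !(conv1l hb') (conv1r hb') scalerA mulrN.
  by rewrite -addrA scaleNr (addrA (- _)) addNr add0r scaleNr.
have sq j : P ^+ j.+1 * P ^+ j.+1 = P ^+ j.+2 * P ^+ j by rewrite -!exprD !addSn !addnS.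
have newton' j E : cv (et + P ^+ j.+1 *: E) (et - P ^+ j.+1 *: E) =
    et + P ^+ j.+2 *: (- P ^+ j *: cv E E).
  by rewrite gen sq scaleNr scalerN scalerA.
have newton j E : cv (et - P ^+ j.+1 *: E) (et + P ^+ j.+1 *: E) =
    et + P ^+ j.+2 *: (- P ^+ j *: cv E E).
  have := gen (- P ^+ j.+1) E; rewrite scaleNr opprK mulrNN => ->.
  by rewrite sq scaleNr scalerN scalerA.
have left j : exists A E, cv A 1%:M = et + P ^+ j.+1 *: E.
  elim: j => [|j [A [E hE]]].
    have [|E hE] := init S0 1%:M; last by exists (map_mx Phi S0), E; rewrite -one2 hE expr1.
    by rewrite S0E one1 (hopf_convl hS).
  exists (cv (et - P ^+ j.+1 *: E) A), (- P ^+ j *: cv E E).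
  by rewrite -newton -hE; apply: convA.
have right j : exists A E, cv 1%:M A = et + P ^+ j.+1 *: E.
  elim: j => [|j [A [E hE]]].
    have [|E hE] := init 1%:M S0; last by exists (map_mx Phi S0), E; rewrite -one2 hE expr1.
    by rewrite S0E one1 (hopf_convr hS).
  exists (cv A (et - P ^+ j.+1 *: E)), (- P ^+ j *: cv E E).
  by rewrite -newton' -hE /cv -convA.
have [A [E hA]] := left N; have [B [E' hB]] := right N.
exists A; apply: (conv_hopf hb' (S' := B)).
  by rewrite -/cv hA exprS nilP mulr0 scale0r addr0.
by rewrite -/cv hB exprS nilP mulr0 scale0r addr0.
Qed.

(** Two units are carried along: tr(T^2) allows integrals to be rebuilt over a field, and the entry
    of T^2 - 1 contradicts the conclusion there. A last application of [Phi] turns elements with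
    nonzero reduction into units. *)
Theorem lift_hopf (m m' : tensor k) S t tau lam li i j : (0 < N)%N ->
  hopf_int m m' S t tau lam li -> \tr (S *m S) != 0 -> (S *m S - 1%:M) i j != 0 ->
  exists (mu nu : tensor Q) T, [/\ hopf mu nu T, exists y, \tr (T *m T) * y = 1
    & exists y, (T *m T - 1%:M) i j * y = 1].
Proof.
move=> N0 hi hD hij.
have [|mu [nu [psi [[n1 n2 a1 a2 c] e1 e2]]]] := stages hi (j := N); first by rewrite N0 /=.
have d0 z : dvq (P ^+ N) z -> z = 0 by case=> y ->; rewrite nilP mul0r.
have hb : bialg mu nu.
  split.
  - by move=> x y z; apply: pr_ext => f; apply/eqP; rewrite -subr_eq0; apply/eqP/d0/a1.
  - by move=> x y z; apply: pr_ext => f; apply/eqP; rewrite -subr_eq0; apply/eqP/d0/a2.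
  - by move=> x; apply: normal_1l.
  - by move=> x; apply: normal_1r.
  - by move=> x; apply: normal_1l.
  - by move=> x; apply: normal_1r.
  - by move=> x y; apply: normal_eps.
  - by move=> x y; rewrite prC normal_eps // !(prC (ev Q ord0)).
  by move=> x y f g; apply/eqP; rewrite -subr_eq0; apply/eqP/d0/c.
have hS : hopf (mapt proj mu) (mapt proj nu) (map_mx psi S).
  by rewrite e1 e2; apply: hopf_map; exact: hint_hopf hi.
have [T hT] := antipode_lift hb hS.
(* The reduction of T and the twist of S are antipodes of the same bialgebra. *)
have eT : map_mx proj T = map_mx fr (map_mx psi S).
  apply: (antipode_unique (bialg_map proj (bialg_map Phi hb))).
    exact: hopf_map hT.
  by rewrite !mapt_proj_Phi; apply: hopf_map.
exists (mapt Phi (mapt Phi mu)), (mapt Phi (mapt Phi nu)), (map_mx Phi T); split.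
- exact: hopf_map.
- rewrite -map_mxM trace_map_mx; apply: unit_Phi.
  by rewrite -trace_map_mx map_mxM eT -!map_mxM !trace_map_mx !fmorph_eq0.
have [|y hy] := unit_Phi (z := (T *m T - 1%:M) i j); last first.
  exists y; rewrite -[RHS]hy; congr (_ * _).
  transitivity ((map_mx Phi (T *m T - 1%:M)) i j); last by rewrite mxE.
  by rewrite map_mxB map_mxM map_mx1.
have -> : proj ((T *m T - 1%:M) i j) = fr (psi ((S *m S - 1%:M) i j)).
  transitivity ((map_mx proj (T *m T - 1%:M)) i j); first by rewrite !mxE.
  transitivity ((map_mx fr (map_mx psi (S *m S - 1%:M))) i j); last by rewrite !mxE.
  by rewrite !map_mxB !map_mxM !map_mx1 eT.
by rewrite !fmorph_eq0.
Qed.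
End Stages.

(** * Fields of characteristic zero *)

Definition ideal_pred (R : comNzRingType) (J : R -> Prop) : Prop :=
  [/\ J 0, forall a b, J a -> J b -> J (a + b) & forall r a, J a -> J (r * a)].

Lemma idealB (R : comNzRingType) (J : R -> Prop) a b :
  ideal_pred J -> J a -> J b -> J (a - b).
Proof. by case=> _ hD hM ha hb; rewrite -mulN1r; apply: hD => //; apply: hM. Qed.

Section QuotientRing.
Variables (R : comNzRingType) (J : R -> Prop).
Hypotheses (hJ : ideal_pred J) (J1 : ~ J 1).

Let Jb : R -> bool := fun x => `[< J x >].

Let Jb_ideal : idealr_closed Jb.
Proof.
case: hJ => h0 hD hM; split; rewrite /Jb ?unfold_in.
- by rewrite asboolE.
- by apply/asboolP.
by move=> a u v; rewrite !unfold_in !asboolE => hu hv; apply: hD => //; apply: hM.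
Qed.

HB.instance Definition _ := isIdealr.Build R Jb Jb_ideal.

Lemma quotient_ring : exists (Q : comNzRingType) (q : {rmorphism R -> Q}),
  (forall z, exists x, z = q x) /\ (forall x, q x = 0 <-> J x).
Proof.
pose Q : comNzRingType := {ideal_quot (Jb : idealr R)}.
exists Q, (\pi_({ideal_quot (Jb : idealr R)})%qT : {rmorphism R -> Q}); split=> [z|x].
  exists (@generic_quotient.repr _ {ideal_quot (Jb : idealr R)} z).
  by apply: esym; apply: (@generic_quotient.reprK _ {ideal_quot (Jb : idealr R)}).
rewrite -(rmorph0 (\pi_({ideal_quot (Jb : idealr R)})%qT : {rmorphism R -> Q})).
split=> [/eqP|h]; last apply/eqP; rewrite -Quotient.idealrBE subr0 unfold_in /Jb asboolE //.
Qed.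

End QuotientRing.

Section Induced.
Variables (R Q S : comNzRingType) (q : {rmorphism R -> Q}) (g : {rmorphism R -> S}).
Hypotheses (qsurj : forall z, exists x, z = q x) (qker : forall x, q x = 0 -> g x = 0).

Let s z := projT1 (cid (qsurj z)).
Let h z := g (s z).

Let h_q x : h (q x) = g x.
Proof.
rewrite /h /s; case: cid => y /= hy; apply/eqP; rewrite -subr_eq0 -rmorphB; apply/eqP/qker.
by rewrite rmorphB hy subrr.
Qed.

Let h_zmod : zmod_morphism h.
Proof.
by move=> a b; case: (qsurj a) (qsurj b) => x -> [y ->]; rewrite -rmorphB !h_q rmorphB.
Qed.

Let h_mon : monoid_morphism h.
Proof.
split=> [|a b]; first by rewrite -(rmorph1 q) h_q rmorph1.
by case: (qsurj a) (qsurj b) => x -> [y ->]; rewrite -rmorphM !h_q rmorphM.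
Qed.

HB.instance Definition _ := GRing.isZmodMorphism.Build Q S h h_zmod.
HB.instance Definition _ := GRing.isMonoidMorphism.Build Q S h h_mon.

Lemma induced_morphism : exists f : {rmorphism Q -> S}, forall x, f (q x) = g x.
Proof. by exists (h : {rmorphism Q -> S}). Qed.

End Induced.

Section FractionField.
Variables (R : comNzRingType) (dom : forall x y : R, x * y = 0 -> (x == 0) || (y == 0)).

(** An alias of [R] that remembers the integrality proof, so that the unit ring and domain
    structures can be attached to a type. *)
Definition domain_of of (forall x y : R, x * y = 0 -> (x == 0) || (y == 0)) : Type := R.
Local Notation D := (domain_of dom).
HB.instance Definition _ := GRing.ComNzRing.on D.

Let unit_pred : pred D := fun x => `[< exists y : D, y * x = 1 >].
Let inv_fun (x : D) : D :=
  if pselect (exists y : D, y * x = 1) is left h then projT1 (cid h) else x.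

Let inv_l : {in unit_pred, left_inverse 1 inv_fun *%R}.
Proof.
move=> x; rewrite unfold_in asboolE /inv_fun => h; case: pselect => // h'.
by case: cid.
Qed.

Let inv_unit (x y : D) : y * x = 1 -> unit_pred x.
Proof. by move=> h; rewrite /unit_pred asboolE; exists y. Qed.

Let inv_out : {in [predC unit_pred], inv_fun =1 id}.
Proof.
move=> x /negP hx; rewrite /inv_fun; case: pselect => // h.
by case: hx; apply/asboolP.
Qed.

HB.instance Definition _ := GRing.ComNzRing_hasMulInverse.Build D inv_l inv_unit inv_out.
HB.instance Definition _ := GRing.ComUnitRing_isIntegral.Build D dom.

Lemma fraction_field : exists (L : fieldType) (f : {rmorphism R -> L}),
  forall x, f x = 0 -> x = 0.
Proof.
pose f : {rmorphism D -> {fraction D}} := @tofrac D.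
exists {fraction D}, (f : GRing.RMorphism.type R {fraction D}) => x /eqP.
by rewrite tofrac_eq0 => /eqP.
Qed.
End FractionField.

Section PrimeIdeal.
Variables (P : comNzRingType) (P0 : forall m : nat, m%:R = 0 :> P -> m = 0%N).

Let good (J : P -> Prop) := ideal_pred J /\ forall m : nat, J m%:R -> m = 0%N.
Let T := {J : P -> Prop | good J}.
Let le : rel T := fun I J => `[< forall x, sval I x -> sval J x >].

(** The positive integers form a multiplicative set that avoids 0 in P, and an ideal maximal among
    those avoiding it is prime. The quotient is then a domain of characteristic 0. *)
Lemma prime_ideal : exists J : P -> Prop,
  [/\ ideal_pred J, forall m : nat, J m%:R -> m = 0%N
    & forall x y, J (x * y) -> J x \/ J y].
Proof.
have [||||[J [[J0 JD JM] Jm]] /= max] := @Zorn T le.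
- by move=> t; apply/asboolP.
- move=> r s t /asboolP h1 /asboolP h2; apply/asboolP => x /h1; exact: h2.
- move=> [I hI] [J hJ] /asboolP /= h1 /asboolP /= h2.
  apply: eq_exist; apply/funext => x; apply/propext; split; [exact: h1|exact: h2].
- move=> A tot.
  (* The disjunct x = 0 provides an upper bound for the empty chain. *)
  pose U x := x = 0 \/ exists2 I : T, A I & sval I x.
  have hU : good U.
    split=> [|m [/P0 //|[[I [hI Im]] _ /=]]]; last exact: Im.
    split; first by left.
      move=> a b [->|[I AI Ia]]; first by rewrite add0r.
      case=> [->|[K AK Kb]]; first by rewrite addr0; right; exists I.
      right; case: (tot I K AI AK) => /asboolP h.
        by exists K => //; case: (svalP K) => -[_ hD _] _; apply: hD => //; apply: h.
      by exists I => //; case: (svalP I) => -[_ hD _] _; apply: hD => //; apply: h.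
    move=> r a [->|[I AI Ia]]; first by left; rewrite mulr0.
    by right; exists I => //; case: (svalP I) => -[_ _ hM] _; apply: hM.
  exists (exist _ U hU) => I AI; apply/asboolP => x /= Ix; by right; exists I.
exists J; split=> // x y Jxy; apply: contrapT => /not_orP[nx ny].
have add z : ~ J z -> exists m r, [/\ m != 0%N & J (m%:R - r * z)].
  move=> nz; apply: contrapT => no.
  pose U w := exists r, J (w - r * z).
  have hU : good U.
    split=> [|m [r hr]].
      split; first by exists 0; rewrite mul0r subr0.
        move=> a b [r hr] [s hs]; exists (r + s).
        by rewrite mulrDl opprD addrACA; exact: (JD).
      by move=> s a [r hr]; exists (s * r); rewrite -mulrA -mulrBr; apply: (JM).
    by apply: contrapT => /eqP m0; apply: no; exists m, r.
  have sub : le (exist _ J (conj (And3 J0 JD JM) Jm)) (exist _ U hU).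
    by apply/asboolP => w /= Jw; exists 0; rewrite mul0r subr0.
  have /(congr1 sval) /= e := max _ sub.
  by apply: nz; rewrite -e; exists 1; rewrite mul1r subrr.
have [m [r [m0 hm]]] := add x nx; have [m' [r' [m0' hm']]] := add y ny.
have /Jm/eqP : J (m * m')%:R.
  have -> : (m * m')%:R = m'%:R * (m%:R - r * x) + r * x * (m'%:R - r' * y)
     + r * r' * (x * y).
    by rewrite natrM !mulrBr [m'%:R * m%:R]mulrC [m'%:R * (r * x)]mulrC addrA subrK
      [r * r' * _]mulrACA subrK.
  by do 2?[refine (JD _ _ _ _)]; apply: (JM).
by rewrite muln_eq0 (negPf m0) (negPf m0').
Qed.
End PrimeIdeal.

Lemma char0_field (P : comNzRingType) : (forall m : nat, m%:R = 0 :> P -> m = 0%N) ->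
  exists (L : fieldType) (f : {rmorphism P -> L}), [pchar L] =i pred0.
Proof.
move=> /prime_ideal[J [hJ Jm Jp]].
have [|Q [q [qs qk]]] := quotient_ring hJ; first by move=> /(Jm 1%N).
have [|L [f fi]] := @fraction_field Q.
  move=> a b; case: (qs a) (qs b) => x -> [y ->]; rewrite -rmorphM => /qk /Jp[]/qk ->.
    by rewrite eqxx.
  by rewrite eqxx orbT.
exists L, (f \o q : {rmorphism P -> L}); apply/pcharf0P => m.
apply/eqP/eqP => [h|->//]; apply: Jm; apply/qk/fi; by rewrite !rmorph_nat.
Qed.

Section ProductRing.
Variable Q : nat -> comNzRingType.

Definition product_ring := forall N, Q N.
Local Notation P := product_ring.
HB.instance Definition _ := gen_eqMixin P.
HB.instance Definition _ := gen_choiceMixin P.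

Let addP (f g : P) : P := fun N => f N + g N.
Let mulP (f g : P) : P := fun N => f N * g N.
Let oppP (f : P) : P := fun N => - f N.

Let addPA : associative addP.
Proof. by move=> *; apply: functional_extensionality_dep => N; apply: addrA. Qed.
Let addPC : commutative addP.
Proof. by move=> *; apply: functional_extensionality_dep => N; apply: addrC. Qed.
Let add0P : left_id ((fun N => 0) : P) addP.
Proof. by move=> *; apply: functional_extensionality_dep => N; apply: add0r. Qed.
Let addNP : left_inverse ((fun N => 0) : P) oppP addP.
Proof. by move=> *; apply: functional_extensionality_dep => N; apply: addNr. Qed.
HB.instance Definition _ := GRing.isZmodule.Build P addPA addPC add0P addNP.

Let mulPA : associative mulP.
Proof. by move=> *; apply: functional_extensionality_dep => N; apply: mulrA. Qed.
Let mulPC : commutative mulP.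
Proof. by move=> *; apply: functional_extensionality_dep => N; apply: mulrC. Qed.
Let mul1P : left_id ((fun N => 1) : P) mulP.
Proof. by move=> *; apply: functional_extensionality_dep => N; apply: mul1r. Qed.
Let mulPDl : left_distributive mulP +%R.
Proof. by move=> *; apply: functional_extensionality_dep => N; apply: mulrDl. Qed.
Let oneP : ((fun N => 1) : P) != 0.
Proof. by apply/eqP => /(congr1 (fun f : P => f 0%N))/eqP; rewrite oner_eq0. Qed.
HB.instance Definition _ :=
  GRing.Zmodule_isComNzRing.Build P mulPA mulPC mul1P mulPDl oneP.

Definition component N (f : P) := f N.
Let component_zmod N : zmod_morphism (component N). Proof. by []. Qed.
Let component_mon N : monoid_morphism (component N). Proof. by []. Qed.
HB.instance Definition _ N :=
  GRing.isZmodMorphism.Build P (Q N) (component N) (component_zmod N).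
HB.instance Definition _ N :=
  GRing.isMonoidMorphism.Build P (Q N) (component N) (component_mon N).

Lemma productP (f g : P) : (forall N, component N f = component N g) -> f = g.
Proof. by move=> h; apply: functional_extensionality_dep. Qed.

Variable n : nat.
Local Notation tensor R := ('I_n.+1 -> 'I_n.+1 -> 'rV[R]_n.+1).

Lemma product_vecP (u v : 'rV[P]_n.+1) :
  (forall N, map_mx (component N) u = map_mx (component N) v) -> u = v.
Proof. by move=> h; apply/rowP => i; apply: productP => N; have /rowP/(_ i) := h N; rewrite !mxE. Qed.

Lemma product_hopf (mu nu : tensor P) (S : 'M[P]_n.+1) :
  (forall N, hopf (mapt (component N) mu) (mapt (component N) nu) (map_mx (component N) S)) ->
  hopf mu nu S.
Proof.
move=> h; pose hb N := hopf_bialg (h N); split; first split.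
- by move=> a b c; apply: product_vecP => N; rewrite !map_pm (muA (hb N)).
- by move=> a b c; apply: product_vecP => N; rewrite !map_pm (nuA (hb N)).
- by move=> a; apply: product_vecP => N; rewrite !map_pm map_ev (mu1l (hb N)).
- by move=> a; apply: product_vecP => N; rewrite !map_pm map_ev (mu1r (hb N)).
- by move=> a; apply: product_vecP => N; rewrite !map_pm map_ev (nu1l (hb N)).
- by move=> a; apply: product_vecP => N; rewrite !map_pm map_ev (nu1r (hb N)).
- by move=> a b; apply: productP => N; rewrite rmorphM !map_pr map_pm map_ev (epsM (hb N)).
- by move=> a b; apply: productP => N; rewrite rmorphM !map_pr map_pm map_ev (oneM (hb N)).
- move=> a b f g; apply: productP => N; rewrite map_pr !map_pm (mu_nu (hb N)); apply: esym.
  apply: map_sw => x y; apply: map_sw => z w; by rewrite rmorphM !map_pr !map_pm.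
- move=> a f; apply: productP => N; rewrite rmorphM !map_pr map_ev -(antil (h N)).
  by apply: map_sw => x y; rewrite map_pr map_pm map_mxM.
- move=> a f; apply: productP => N; rewrite rmorphM !map_pr map_ev -(antir (h N)).
  by apply: map_sw => x y; rewrite map_pr map_pm map_mxM.
Qed.
End ProductRing.

(** * A ring with a Frobenius lift *)

Section FrobeniusLift.
Import Num.Theory monalg.

(* Adjoining a new unit to the multiplicative monoid of [k]: the result has no
   nontrivial units, as [monomType] requires. *)
Definition cone (k : Type) := option k.

Section Cone.
Variable k : comNzRingType.
Local Notation K := (cone k).
HB.instance Definition _ := Choice.on K.

Let mulK (a b : K) : K :=
  match a, b with Some x, Some y => Some (x * y) | Some x, None => Some x | None, _ => b end.

Let mulKA : associative mulK.
Proof. by move=> [a|] [b|] [c|] //=; rewrite mulrA. Qed.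
Let mul1K : left_id None mulK. Proof. by []. Qed.
Let mulK1 : right_id None mulK. Proof. by case. Qed.
Let unitK (x y : K) : mulK x y = None -> x = None /\ y = None.
Proof. by case: x y => [a|] [b|]. Qed.
Let mulKC : commutative mulK.
Proof. by move=> [a|] [b|] //=; rewrite mulrC. Qed.

HB.instance Definition _ := Choice_isMonomialDef.Build K mulKA mul1K mulK1 unitK.
HB.instance Definition _ := MonomialDef_isConomialDef.Build K mulKC.

Definition cone_val (a : K) : k := if a is Some x then x else 1.
Lemma cone_val_morph : mmorphism cone_val.
Proof. by split=> // -[a|] [b|]; rewrite /= ?mulr1 ?mul1r. Qed.
HB.instance Definition _ := isMultiplicative.Build K k cone_val cone_val_morph.

Local Notation R := {malg int[K]}.

Definition cone_pow (p : nat) (a : K) : R := << omap (fun x => x ^+ p) a : K >>.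
Lemma cone_pow_morph p : mmorphism (cone_pow p).
Proof.
split=> // a b; rewrite /cone_pow malgM_def fgmulUU mulr1; congr (<< _ >>).
by case: a b => [a|] [b|] //=; rewrite exprMn.
Qed.
HB.instance Definition _ p := isMultiplicative.Build K R (cone_pow p) (cone_pow_morph p).

(** The integral monoid ring is torsion free, and a |-> a^p on monomials extends to an endomorphism
    congruent to the p-th power modulo p, whether or not k is perfect. *)
Definition cone_proj : {rmorphism R -> k} := mmap (intr : {rmorphism int -> k}) cone_val.
Definition cone_frob p : {rmorphism R -> R} := mmap (intr : {rmorphism int -> R}) (cone_pow p).

Lemma cone_proj_surj c : cone_proj << Some c : K >> = c.
Proof. by rewrite /cone_proj /= mmapU mul1r. Qed.

Lemma cone_gen (S : nzRingType) (f g : {additive R -> S}) :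
  (forall (c : int) (a : K), f << c *g a >> = g << c *g a >>) -> f =1 g.
Proof. by move=> h x; rewrite (monalgE x) !raddf_sum; apply: eq_bigr => a _; apply: h. Qed.

Variable p : nat.
Hypothesis pp : prime p.

Lemma cone_frobU (c : int) (a : K) :
  cone_frob p << c *g a >> = << c *g (omap (fun x => x ^+ p) a : K) >>.
Proof.
have e : (intr c : R) = << c *g (mone : K) >> by rewrite -{2}[c]intz -(rmorph_int (@malgC K int)).
by rewrite /cone_frob /= mmapU /cone_pow /= e malgM_def fgmulUU mulr1 mul1m.
Qed.

Lemma cone_tors (x : R) : p%:R * x = 0 -> x = 0.
Proof.
move=> h; apply/malgP => a; rewrite mcoeff0.
have := congr1 (mcoeff a) h; rewrite mulr_natl mcoeffMn mcoeff0 => /eqP.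
by rewrite mulrn_eq0 -leqn0 leqNgt prime_gt0 // => /eqP.
Qed.

Lemma cone_projF : p%:R = 0 :> k -> forall x : R, cone_proj (cone_frob p x) = cone_proj x ^+ p.
Proof.
move=> pk0; have ch : p \in [pchar k] by rewrite inE pp pk0 /=.
move=> x; rewrite -(pFrobenius_autE ch).
refine (@cone_gen _ (cone_proj \o cone_frob p) (pFrobenius_aut ch \o cone_proj) _ x) => c a /=.
rewrite cone_frobU /cone_proj /= !mmapU pFrobenius_autE exprMn -(pFrobenius_autE ch) rmorph_int.
by congr (_ * _); case: a => [a|] //=; rewrite expr1n.
Qed.

(** p divides the middle binomial coefficients, and each middle term contains x. The explicit factor
    x keeps the remainder in any ideal that contains x, as [ipow_frob] requires. *)
Lemma expr_prime_sum (S : comNzRingType) (x y : S) :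
  exists z, (x + y) ^+ p = x ^+ p + y ^+ p + p%:R * (x * z).
Proof.
exists (\sum_(1 <= i < p) x ^+ (p - i).-1 * y ^+ i * ('C(p, i) %/ p)%:R).
rewrite exprDn -(big_mkord xpredT (fun i => x ^+ (p - i) * y ^+ i *+ 'C(p, i))).
rewrite big_ltn // big_nat_recr ?prime_gt0 //= bin0 binn subn0 subnn !expr0 mulr1 mul1r !mulr1n.
rewrite -addrA; congr (_ + _); rewrite addrC; congr (_ + _); rewrite !mulr_sumr.
apply: eq_big_nat => i /andP[i0 ip]; have /divnK {1}<- := prime_dvd_bin pp (introT andP (conj i0 ip)).
have {1}-> : (p - i = (p - i).-1.+1)%N by rewrite prednK // subn_gt0.
rewrite -mulr_natr natrM exprS; ring.
Qed.

Lemma cone_frob_lift (x : R) : exists d, cone_frob p x = x ^+ p + p%:R * d.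
Proof.
pose G (x : R) := exists d, cone_frob p x = x ^+ p + p%:R * d.
have G0 : G 0 by exists 0; rewrite rmorph0 mulr0 addr0 expr0n -leqn0 leqNgt prime_gt0.
have GD u v : G u -> G v -> G (u + v).
  move=> [d hd] [e he]; have [z hz] := expr_prime_sum u v.
  by exists (d + e - u * z); rewrite rmorphD hd he hz; ring.
(* The power of -u is compared with that of u through (u - u)^p = 0, which treats p = 2 and odd p
   alike. *)
have GN u : G u -> G (- u).
  move=> [d hd]; have [z] := expr_prime_sum u (- u).
  rewrite subrr expr0n -leqn0 leqNgt prime_gt0 //= mulr0n => hz.
  exists (u * z - d); rewrite rmorphN hd.
  move: hz; move: (u ^+ p) ((- u) ^+ p) (u * z) => a b c hz.
  have -> : a = - b - p%:R * c by rewrite -[LHS]subr0 {1}hz; ring.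
  ring.
have GU (c : int) (a : K) : G << c *g a >>.
  have G1 : G << 1 *g a >>.
    exists 0; rewrite cone_frobU mulr0 addr0 -(prednK (prime_gt0 pp)).
    elim: p.-1 => [|q IH]; first by case: (a) => [b|].
    rewrite exprS -IH malgM_def fgmulUU mulr1; congr (<< _ *g _ >>).
    by case: (a) => [b|] //=; rewrite exprS.
  have GM m : G << 1 *g a >> -> G << (Posz m) *g a >>.
    move=> h; rewrite -natz monalgUMn; elim: m => [|m IH]; first by rewrite mulr0n.
    by rewrite mulrS; exact: (GD _ _ h IH).
  case: c => m; first exact: (GM m G1).
  by rewrite NegzE monalgUN; exact: (GN _ (GM m.+1 G1)).
rewrite -/(G x) (monalgE x); elim: (finmap.enum_fset (msupp x)) => [|a s hs]; first by rewrite big_nil.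
by rewrite big_cons; exact: (GD _ _ (GU _ _) hs).
Qed.
End Cone.

Section PowerQuotient.
Variables (R : comNzRingType) (k : fieldType) (pi : {rmorphism R -> k}) (Fr : {rmorphism R -> R}).
Variables (p : nat).
Hypotheses (pp : prime p) (pk0 : p%:R = 0 :> k) (pi_surj : forall c, exists x, pi x = c)
  (piFr : forall x, pi (Fr x) = pi x ^+ p)
  (frob : forall x, exists d, Fr x = x ^+ p + p%:R * d)
  (tors : forall x : R, p%:R * x = 0 -> x = 0).
Local Notation I x := (pi x = 0).

(** Powers of the ideal I = ker([pi]), level 0 being the whole ring. The inductive form supplies the
    induction on generators used in [ipow_frob]. *)
Inductive ipow : nat -> R -> Prop :=
| Ipow0 x : ipow 0 x
| IpowM n a b : I a -> ipow n b -> ipow n.+1 (a * b)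
| IpowD n a b : ipow n.+1 a -> ipow n.+1 b -> ipow n.+1 (a + b).

Lemma ipow_mull n x r : ipow n x -> ipow n (r * x).
Proof.
elim=> {n x} [x|n a b Ia Ib _|n a b _ Ia _ Ib]; first exact: Ipow0.
- by rewrite mulrA; apply: IpowM => //; rewrite rmorphM Ia mulr0.
- by rewrite mulrDr; apply: IpowD.
Qed.

Lemma ipow_0 n : ipow n 0.
Proof. by elim: n => [|n h]; [exact: Ipow0|rewrite -(mulr0 0); apply: IpowM; rewrite ?rmorph0]. Qed.

Lemma ipowD n x y : ipow n x -> ipow n y -> ipow n (x + y).
Proof. by case: n => [|n] h1 h2; [exact: Ipow0|exact: IpowD]. Qed.

Lemma ipow_ideal n : ideal_pred (ipow n).
Proof. by split; [exact: ipow_0|exact: ipowD|move=> *; exact: ipow_mull]. Qed.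

Lemma ipow_S n x : ipow n.+1 x -> ipow n x.
Proof.
elim: n x => [|n IH] x; first by move=> _; exact: Ipow0.
move e: n.+2 => m h; elim: h e => {m x} // m a b.
  by move=> Ia Ib _ [e]; subst m; apply: IpowM => //; apply: IH.
by move=> _ h1 _ h2 [e]; subst m; apply: IpowD; auto.
Qed.

Lemma ipow_le m n x : (m <= n)%N -> ipow n x -> ipow m x.
Proof. by move/subnK <-; elim: (n - m)%N => // d IH /ipow_S. Qed.

Lemma ipow_I n x : ipow n.+1 x -> I x.
Proof.
move=> /(ipow_le (isT : (1 <= n.+1)%N)); move e: 1%N => m h.
elim: h e => {m x} // m a b; first by move=> Ia _ _ _; rewrite rmorphM Ia mul0r.
by move=> _ h1 _ h2 e; rewrite rmorphD h1 // h2 // addr0.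
Qed.

Lemma I_ipowX x n : I x -> ipow n (x ^+ n).
Proof.
move=> Ix; elim: n => [|n IH]; first exact: Ipow0.
by rewrite exprS; apply: IpowM.
Qed.

Lemma p_gt0 : (0 < p)%N. Proof. exact: prime_gt0. Qed.

(* The operator [x |-> (Fr x - x ^+ p) / p] lowers the [I]-adic filtration by one. *)
Lemma ipow_frob n x : ipow n.+1 x -> exists2 d, ipow n d & Fr x = x ^+ p + p%:R * d.
Proof.
move e: n.+1 => m h; elim: h n e => {m x} // m a b.
  move=> Ia Ib IHb n [e]; subst m; have [da ha] := frob a.
  have [db hb1 hb2] : exists2 db, ipow n.-1 db & Fr b = b ^+ p + p%:R * db.
    case: n Ib IHb => [|n] Ib IHb; last exact: IHb.
    by have [db hb] := frob b; exists db => //; exact: Ipow0.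
  exists (da * b ^+ p + Fr a * db).
    apply: ipowD; first by apply: ipow_mull; rewrite -(prednK p_gt0) exprSr; apply: ipow_mull.
    case: n hb1 {Ib IHb} => [|n] h; first exact: Ipow0.
    by apply: IpowM => //; rewrite piFr Ia expr0n -leqn0 leqNgt p_gt0.
  by rewrite rmorphM hb2 exprMn mulrDr {1}ha; ring.
move=> Ia IHa Ib IHb n e; have [da ha ea] := IHa n e; have [db hb eb] := IHb n e.
have [z hz] := expr_prime_sum pp a b.
exists (da + db - a * z).
  apply: idealB; [exact: ipow_ideal|exact: ipowD|].
  by rewrite mulrC; apply: ipow_mull; apply: ipow_S; rewrite e.
by rewrite rmorphD ea eb hz; ring.
Qed.

(** Let p y be in I^(n+2), where y = p^n x. Dividing Fr(p y) = (p y)^p + p d by p, with d in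
    I^(n+1), puts Fr(y) = p^n Fr(x) in I^(n+1). By induction Fr(x) is in I, so the p-th power of
    pi(x) vanishes in the field k. *)
Lemma tors_I n x : ipow n.+1 (p%:R ^+ n * x) -> I x.
Proof.
elim: n x => [|n IH] x; first by rewrite expr0 mul1r => /ipow_I.
rewrite exprS -mulrA => h; have [d hd] := ipow_frob h.
set y := p%:R ^+ n * x in h hd; rewrite rmorphM rmorph_nat => e.
have eF : Fr y = (p%:R * y) ^+ p.-1 * y + d.
  apply/eqP; rewrite -subr_eq0; apply/eqP/tors; rewrite mulrBr e.
    by rewrite -[X in _ ^+ X](prednK p_gt0) exprSr -/y; move: (_ ^+ p.-1) => c; move: (y) => z; ring.
have : I (Fr x).
  apply: IH; rewrite -[p%:R](rmorph_nat Fr) -rmorphXn -rmorphM -/y eF; apply: ipowD => //.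
  rewrite mulrC; apply: ipow_mull; case: p pp (ipow_S h) => [|[|q]] // _ hy.
  by rewrite exprS mulrC; apply: ipow_mull.
by rewrite piFr => /eqP; rewrite expf_eq0 => /andP[_ /eqP].
Qed.

Lemma frob_iter m x : exists d, iter m Fr x = x ^+ (p ^ m) + p%:R * d.
Proof.
elim: m => [|m [d hd]]; first by exists 0; rewrite mulr0 addr0.
rewrite /= hd; have [e he] := frob (x ^+ (p ^ m) + p%:R * d).
have [z hz] := expr_prime_sum pp (p%:R * d) (x ^+ (p ^ m)).
exists (p%:R ^+ p.-1 * d ^+ p + p%:R * d * z + e).
rewrite he [p%:R * d + _]addrC in hz *; rewrite hz exprMn -exprM -expnSr.
have -> : (p%:R : R) ^+ p = p%:R * p%:R ^+ p.-1 by rewrite -exprS prednK ?p_gt0.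
by move: (x ^+ _) (d ^+ p) (_ ^+ p.-1) => a b c; ring.
Qed.

(** Q is R/I^N and [Phi] is the N-fold iterate of [Fr]: for x in I it equals x^(p^N) modulo p, and
    x^(p^N) lies in I^N because N <= p^N. Accordingly [fr] is the N-fold Frobenius of k. The torsion
    condition is [tors_I]. *)
Lemma tower_quotient N : (0 < N)%N -> exists (Q : comNzRingType) (proj : {rmorphism Q -> k})
    (Phi : {rmorphism Q -> Q}) (fr : {rmorphism k -> k}),
  [/\ forall c, exists x, proj x = c, forall z, proj (Phi z) = fr (proj z),
      forall z, proj z = 0 -> exists y, Phi z = p%:R * y,
      forall j z, (j < N)%N -> p%:R ^+ j * z = 0 -> proj z = 0
    & p%:R ^+ N = 0 :> Q].
Proof.
move=> N0; have ch : p \in [pchar k] by rewrite inE pp pk0 /=.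
have [|Q [q [qs qk]]] := quotient_ring (ipow_ideal N).
  by rewrite -(prednK N0) => /ipow_I/eqP; rewrite rmorph1 oner_eq0.
have [|proj hproj] := induced_morphism (g := pi) qs.
  by move=> x /qk; rewrite -(prednK N0) => /ipow_I.
have FI n x : ipow n x -> ipow n (Fr x).
  elim=> {n x} [x|n a b Ia _ hb|n a b _ ha _ hb]; first exact: Ipow0.
    by rewrite rmorphM; apply: IpowM => //; rewrite piFr Ia expr0n -leqn0 leqNgt p_gt0.
  by rewrite rmorphD; apply: IpowD.
pose it (S : comNzRingType) (f : {rmorphism S -> S}) :=
  fix it n : {rmorphism S -> S} := if n is n'.+1 then f \o it n' else idfun.
have itE (S : comNzRingType) (f : {rmorphism S -> S}) n x : it S f n x = iter n f x.
  by elim: n => //= n ->.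
have [|Phi hPhi] := induced_morphism (g := q \o it R Fr N) qs.
  move=> x /qk hx /=; apply/qk; rewrite itE; elim: {2}N => //= n; exact: FI.
exists Q, proj, Phi, (it k (pFrobenius_aut ch) N); split.
- by move=> c; have [x <-] := pi_surj c; exists (q x).
- move=> z; have [x ->] := qs z; rewrite hPhi hproj /= !itE hproj.
  by elim: (N) => //= n <-; rewrite piFr pFrobenius_autE.
- move=> z; have [x ->] := qs z; rewrite hproj => Ix; rewrite hPhi /= itE.
  have [d ->] := frob_iter N x; exists (q d).
  have /qk e : ipow N (x ^+ (p ^ N)).
    by apply: ipow_le (I_ipowX _ Ix); apply: ltnW; apply: ltn_expl; apply: prime_gt1.
  by rewrite rmorphD e add0r rmorphM rmorph_nat.
- move=> j z jN; have [x ->] := qs z; rewrite hproj -(rmorph_nat q) -rmorphXn -rmorphM.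
  by move=> /qk /(ipow_le jN); apply: tors_I.
by rewrite -(rmorph_nat q) -rmorphXn; apply/qk/I_ipowX; rewrite rmorph_nat.
Qed.
End PowerQuotient.

Theorem lifting_tower (k : fieldType) p N : prime p -> p%:R = 0 :> k -> (0 < N)%N ->
  exists (Q : comNzRingType) (proj : {rmorphism Q -> k})
    (Phi : {rmorphism Q -> Q}) (fr : {rmorphism k -> k}),
  [/\ forall c, exists x, proj x = c, forall z, proj (Phi z) = fr (proj z),
      forall z, proj z = 0 -> exists y, Phi z = p%:R * y,
      forall j z, (j < N)%N -> p%:R ^+ j * z = 0 -> proj z = 0
    & p%:R ^+ N = 0 :> Q].
Proof.
move=> pp pk0 N0.
refine (@tower_quotient _ k (cone_proj k) (cone_frob k p) p pp pk0 _ _ _ _ N N0).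
- by move=> c; exists << Some c : cone k >>; apply: cone_proj_surj.
- exact: cone_projF.
- exact: cone_frob_lift.
- exact: cone_tors.
Qed.
End FrobeniusLift.

(** * The Etingof-Gelaki theorem *)

(** Write m = p^v u with u prime to p. If v < N, the torsion condition puts u in ker([proj]), so p
    divides u. A positive integer thus cannot vanish in every ring of the tower. *)
Lemma unit_nat_tower (Q : comNzRingType) (k : fieldType) (proj : {rmorphism Q -> k}) p N m :
  prime p -> (forall j z, (j < N)%N -> p%:R ^+ j * z = 0 -> proj z = 0) ->
  p%:R = 0 :> k -> m%:R = 0 :> Q -> (p ^ N %| m)%N.
Proof.
move=> pp tors pk0 hm.
have [->|m0] := posnP m; first by rewrite dvdn0.
rewrite pfactor_dvdn // leqNgt; apply/negP => lt.
have [u cu hu] := pfactor_coprime pp m0.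
have /tors := lt; move=> /(_ u%:R); rewrite -natrX -natrM mulnC -hu hm => /(_ erefl).
rewrite rmorph_nat => u0.
have ch : p \in [pchar k] by rewrite inE pp pk0 /=.
by move: cu; rewrite prime_coprime // => /negP; case; rewrite (dvdn_pcharf ch) u0.
Qed.

(* In characteristic [p] an entry of [S^2 - 1] lifts to a unit in each ring of the
   tower, hence survives in a field of characteristic 0 under the product of the tower. *)
Theorem etingof_gelaki (k : fieldType) n (mu nu : 'I_n.+1 -> 'I_n.+1 -> 'rV[k]_n.+1)
  (S : 'M[k]_n.+1) t tau lam li :
  hopf_int mu nu S t tau lam li -> S *m S = 1%:M.
Proof.
move=> hi; have [ch0|] := pselect ([pchar k] =i pred0); first exact: larson_radford hi.
move=> nch; have [p pp pk0] : exists2 p, prime p & p%:R = 0 :> k.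
  apply: contrapT => no; apply: nch => q; apply/negP => /andP[pq /eqP q0].
  by apply: no; exists q.
apply/eqP/negP => /negP; rewrite -subr_eq0 => /eqP nz.
have [i [j hij]] : exists i j, (S *m S - 1%:M) i j != 0.
  apply: contrapT => no; apply: nz; apply/matrixP => i j; rewrite [RHS]mxE.
  by apply/eqP/negP => /negP h; apply: no; exists i, j.
have hD : \tr (S *m S) != 0.
  have <- : trV (fun a => (a *m S) *m S) = \tr (S *m S).
    by rewrite -trV_mx; apply: eq_trV => z; rewrite mulmxA.
  rewrite (trV_anti2 hi); apply/eqP => li0; have /eqP := lamV hi.
  by rewrite li0 mulr0 eq_sym oner_eq0.
have tower N : {Q : comNzRingType & {mu' : 'I_n.+1 -> 'I_n.+1 -> 'rV[Q]_n.+1 &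
   {nu' : 'I_n.+1 -> 'I_n.+1 -> 'rV[Q]_n.+1 & {T : 'M[Q]_n.+1 & {a : Q & {b : Q |
   [/\ hopf mu' nu' T, \tr (T *m T) * a = 1, (T *m T - 1%:M) i j * b = 1 &
     forall m : nat, m%:R = 0 :> Q -> (p ^ N.+1 %| m)%N]}}}}}}.
  have [Q hQ] := cid (lifting_tower pp pk0 (ltn0Sn N)).
  have {}hQ : exists mu' nu' T (a b : Q),
     [/\ hopf mu' nu' T, \tr (T *m T) * a = 1, (T *m T - 1%:M) i j * b = 1 &
     forall m : nat, m%:R = 0 :> Q -> (p ^ N.+1 %| m)%N].
    case: hQ => proj [Phi [fr [h1 h2 h3 h4 h5]]].
    have [mu' [nu' [T [h [a ha] [b hb]]]]] := lift_hopf h1 h2 h3 h4 h5 pk0 (ltn0Sn N) hi hD hij.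
    by exists mu', nu', T, a, b; split=> // m; apply: unit_nat_tower pp h4 pk0.
  case/cid: hQ => mu' /cid[nu' /cid[T /cid[a /cid[b h]]]].
  by exists Q, mu', nu', T, a, b.
pose Q N := projT1 (tower N).
pose P := product_ring Q.
pose mu' N := projT1 (projT2 (tower N)).
pose nu' N := projT1 (projT2 (projT2 (tower N))).
pose T N := projT1 (projT2 (projT2 (projT2 (tower N)))).
pose a N := projT1 (projT2 (projT2 (projT2 (projT2 (tower N))))).
pose b N := sval (projT2 (projT2 (projT2 (projT2 (projT2 (tower N)))))).
have H N : [/\ hopf (mu' N) (nu' N) (T N), \tr (T N *m T N) * a N = 1, 
   (T N *m T N - 1%:M) i j * b N = 1 &
   forall m : nat, m%:R = 0 :> Q N -> (p ^ N.+1 %| m)%N].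
  exact: (svalP (projT2 (projT2 (projT2 (projT2 (projT2 (tower N))))))).
pose MU i j : 'rV[P]_n.+1 := \row_l ((fun N => mu' N i j 0 l) : P).
pose NU i j : 'rV[P]_n.+1 := \row_l ((fun N => nu' N i j 0 l) : P).
pose TT : 'M[P]_n.+1 := \matrix_(i, j) ((fun N => T N i j) : P).
have eT N : map_mx (component N) TT = T N by apply/matrixP => u v; rewrite !mxE.
have eM N : mapt (component N) MU = mu' N.
  by apply/funext => u; apply/funext => v; apply/rowP => w; rewrite !mxE.
have eN N : mapt (component N) NU = nu' N.
  by apply/funext => u; apply/funext => v; apply/rowP => w; rewrite !mxE.
have hP : hopf MU NU TT.
  by apply: product_hopf => N; rewrite eM eN eT; case: (H N).
have P0 m : m%:R = 0 :> P -> m = 0%N.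
  move=> h; apply/eqP; apply/negPn/negP; rewrite -lt0n => m0.
  (* The component of index m suffices: there p^(m+1) would divide m. *)
  have : (m < p ^ m.+1)%N by apply: ltn_trans (ltn_expl _ _); rewrite ?prime_gt1.
  rewrite ltnNge dvdn_leq //; case: (H m) => _ _ _; apply.
  by rewrite -(rmorph_nat (@component Q m)) h rmorph0.
have [L [f fch]] := char0_field P0.
pose A : P := a; pose B : P := b.
have hA : \tr (TT *m TT) * A = 1.
  apply: productP => N; rewrite rmorphM rmorph1 -trace_map_mx map_mxM eT; by case: (H N).
have hB : (TT *m TT - 1%:M) i j * B = 1.
  apply: productP => N; rewrite [RHS]rmorph1; case: (H N) => _ _ <- _; rewrite rmorphM.
  by congr (_ * _); rewrite -eT -map_mxM -(map_mx1 (@component Q N)) -map_mxB [RHS]mxE.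
have hL := hopf_map f hP.
have unitL (x y : P) : x * y = 1 -> f x != 0.
  move=> h; apply/eqP => fx; have := congr1 f h.
  by rewrite rmorphM fx mul0r rmorph1 => /esym/eqP; rewrite oner_eq0.
(* The image of tr(T^2) in L is nonzero, so the trace formula produces the integrals that
   [larson_radford] expects. *)
have [|t' [tau' [lam' [li' hiL]]]] := hopf_has_int hL.
  by rewrite -map_mxM trace_map_mx; apply: unitL hA.
have := larson_radford fch hiL.
have := unitL _ _ hB.
have -> : f ((TT *m TT - 1%:M) i j) = (map_mx f TT *m map_mx f TT - 1%:M) i j.
  by rewrite -map_mxM -(map_mx1 f) -map_mxB [RHS]mxE.
by move=> /[swap] ->; rewrite subrr mxE eqxx.
Qed.

(** * Vector-valued Sweedler sums, one-sided antipodes and cointegrals *)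

Definition vsw (F : comNzRingType) n (nu : 'I_n.+1 -> 'I_n.+1 -> 'rV[F]_n.+1) a
    (B : 'rV[F]_n.+1 -> 'rV[F]_n.+1 -> 'rV[F]_n.+1) : 'rV[F]_n.+1 :=
  \sum_i \sum_j pr a (nu i j) *: B (ev F i) (ev F j).

Lemma pr_vsw (F : comNzRingType) n (nu : 'I_n.+1 -> 'I_n.+1 -> 'rV[F]_n.+1) a B f :
  pr (vsw nu a B) f = sw nu a (fun u v => pr (B u v) f).
Proof.
have l : lin (fun u : 'rV[F]_n.+1 => pr u f) by lin_tac.
rewrite /vsw (lin_sum l); apply: eq_bigr => i _; rewrite (lin_sum l).
by apply: eq_bigr => j _; rewrite (linZ l).
Qed.

Section LeftAntipode.
Variables (F : fieldType) (n : nat).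
Variables (mu nu : 'I_n.+1 -> 'I_n.+1 -> 'rV[F]_n.+1) (hb : bialg mu nu).
Local Notation o := (ev F (ord0 : 'I_n.+1)).

Let f (X : 'M[F]_n.+1) := conv mu nu 1%:M X.
Let f_lin : linear f.
Proof. by move=> c X Y; rewrite /f convDr convZr. Qed.
HB.instance Definition _ :=
  GRing.isLinear.Build F 'M[F]_n.+1 'M[F]_n.+1 _ f f_lin.

(* In the finite dimensional convolution algebra a left inverse is two-sided. *)
Lemma left_antipode_hopf S :
  (forall a f, sw nu a (fun x y => pr (pm mu (x *m S) y) f) = pr a o * pr o f) ->
  hopf mu nu S.
Proof.
move=> hS.
have hl : conv mu nu S 1%:M = eta F n.
  apply: mx_ext_pr => a g; rewrite pr_conv pr_eta -hS.
  by apply: eq_sw => x y; rewrite mulmx1.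
have free : row_free (lin_mx f).
  apply: inj_row_free => v hv; rewrite -[v]vec_mxK.
  have : f (vec_mx v) = 0.
    by apply: (can_inj mxvecK); rewrite -mul_vec_lin vec_mxK hv linear0.
  rewrite /f => fv0; rewrite -[vec_mx v](conv1l hb) -hl (convA hb) fv0.
  by rewrite -[0](scale0r (0 : 'M_n.+1)) convZr !scale0r linear0.
pose S' := vec_mx (mxvec (eta F n) *m invmx (lin_mx f)).
apply: (conv_hopf hb hl (S' := S')).
have := mul_vec_lin f S'; rewrite vec_mxK mulmxKV -?row_free_unit //.
by move/(can_inj mxvecK).
Qed.
End LeftAntipode.

Section TwoSided.
Variables (F : fieldType) (n : nat) (mu nu : 'I_n.+1 -> 'I_n.+1 -> 'rV[F]_n.+1).
Local Notation o := (ev F (ord0 : 'I_n.+1)).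

(** The transposed antipode reverses products, so it sends a left cointegral to a right one;
    invertibility lets every f be an image. The two are normalized, and as for integrals they
    coincide. *)
Lemma left_cointegral_two_sided S tau : hopf mu nu S -> S \in unitmx ->
  (forall f, pm nu f tau = pr o f *: tau) -> pr o tau = 1 ->
  forall f, pm nu tau f = pr o f *: tau.
Proof.
move=> hh Su hl h1; have hs := hopf_swap hh.
have e a : pr o (a *m S^T) = pr o a by rewrite -pr_mx (anti_one hh).
have r f : pm nu (tau *m S^T) f = pr o f *: (tau *m S^T).
  have -> : f = f *m invmx S^T *m S^T by rewrite mulmxKV // unitmx_tr.
  by rewrite -(anti_mul hs) hl e -scalemxAl.
have -> : tau = tau *m S^T; last exact: r.
by have := r tau; rewrite hl e h1 !scale1r.
Qed.
End TwoSided.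

(** * Expectations and the basic construction *)

Lemma big_add1 (k : fieldType) (M : algType k) (I : Type) (s : seq I) (F : I -> M -> M) a :
  (\big[@add1 k M/@zero1 k M]_(i <- s) F i) a = \sum_(i <- s) F i a.
Proof. by elim/big_rec2: _ => //= i f b _ <-. Qed.

Record expectation (k : fieldType) (M : algType k) (N : M -> Prop) (E : M -> M)
    (m : nat) (x y : 'I_m -> M) : Prop := Expectation {
  exp_unital : is_unital_subalg N;
  exp_central : centralizer_trivial N;
  exp_in : forall a, N (E a);
  exp_add : forall a b, E (a + b) = E a + E b;
  exp_bimod : forall n n' a, N n -> N n' -> E (n * a * n') = n * E a * n';
  exp_dual1 : forall a, \sum_i E (a * x i) * y i = a;
  exp_dual2 : forall a, \sum_i x i * E (y i * a) = a;
  exp1 : E 1 = 1;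
  exp_index : \sum_i x i * y i != 0 }.

Section Normalize.
Variables (k : fieldType) (M : algType k) (N : M -> Prop) (E : M -> M) (m : nat) (x y : 'I_m -> M).

(** E(1) commutes with N by the bimodule property, hence is a nonzero scalar c. E is divided by c
    and the y_i are multiplied by it. *)
Lemma normalize_expectation : is_unital_subalg N -> strongly_sep_irred N E x y ->
  exists E' y', expectation N E' x y'.
Proof.
move=> hN [hC [EN ED] EB Ed [E1 Exy]]; case: (hN) => N1 NDM _ NZ.
have [c hc] : exists c : k, E 1 = c%:A.
  apply: hC => n Nn; have := EB _ _ 1 Nn N1; have := EB _ _ 1 N1 Nn.
  by rewrite !mulr1 !mul1r => <- <-.
have c0 : c != 0 by apply: contra E1; rewrite hc => /eqP ->; rewrite scale0r.
exists (fun a => c^-1 *: E a), (fun i => c *: y i); split=> //.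
- by move=> a; apply: NZ.
- by move=> a b; rewrite ED scalerDr.
- by move=> n n' a Nn Nn'; rewrite EB // scalerAl scalerAr.
- move=> a; rewrite -[RHS](proj1 (Ed a)); apply: eq_bigr => i _.
  by rewrite -scalerAl -scalerAr scalerA mulVf // scale1r.
- move=> a; rewrite -[RHS](proj2 (Ed a)); apply: eq_bigr => i _.
  have -> : E (c *: y i * a) = c *: E (y i * a).
    have := EB c%:A 1 (y i * a) (NZ c _ N1) N1.
    by rewrite !mulr1 -!scalerAl !mul1r.
  by rewrite scalerA mulVf // scale1r.
- by rewrite hc scalerA mulVf // scale1r.
under eq_bigr => i _ do rewrite -scalerAr.
by rewrite -scaler_sumr scaler_eq0 negb_or c0.
Qed.
End Normalize.

Section Expectation.
Variables (k : fieldType) (M : algType k) (N : M -> Prop) (E : M -> M) (m : nat) (x y : 'I_m -> M).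
Hypothesis hE : expectation N E x y.

Let N1 : N 1. Proof. by case: (exp_unital hE). Qed.

Lemma expL n a : N n -> E (n * a) = n * E a.
Proof. by move=> Nn; have := exp_bimod hE a Nn N1; rewrite !mulr1. Qed.

Lemma expR n a : N n -> E (a * n) = E a * n.
Proof. by move=> Nn; have := exp_bimod hE a N1 Nn; rewrite !mul1r. Qed.

Lemma exp_sum (I : Type) (r : seq I) (F : I -> M) : E (\sum_(i <- r) F i) = \sum_(i <- r) E (F i).
Proof.
have E0 : E 0 = 0 by apply: (addrI (E 0)); rewrite -(exp_add hE) !addr0.
elim/big_rec2: _ => [//|i a b _ <-]; exact: exp_add hE _ _.
Qed.

Lemma exp_nondegl u v : (forall a, E (a * u) = E (a * v)) -> u = v.
Proof.
move=> h; rewrite -[u](exp_dual2 hE) -[v](exp_dual2 hE).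
by apply: eq_bigr => i _; rewrite h.
Qed.

Lemma exp_nondegr u v : (forall a, E (u * a) = E (v * a)) -> u = v.
Proof.
move=> h; rewrite -[u](exp_dual1 hE) -[v](exp_dual1 hE).
by apply: eq_bigr => i _; rewrite h.
Qed.

(** An N-balanced [B] plays the role of the tensor product over N. Expanding a x_i by the x_j and
    y_j a by the y_i turns both sides into sums over i and j with E(y_j a x_i), an element of N, in
    the middle. *)
Lemma exp_casimir (B : M -> M -> M) a :
  (forall u u' v, B (u + u') v = B u v + B u' v) -> (forall u v v', B u (v + v') = B u v + B u v') ->
  (forall u n v, N n -> B (u * n) v = B u (n * v)) ->
  \sum_i B (a * x i) (y i) = \sum_i B (x i) (y i * a).
Proof.
move=> Bl Br Bn.
have Bsl v (F : 'I_m -> M) : B (\sum_i F i) v = \sum_i B (F i) v.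
  elim/big_rec2: _ => [|i u w _ <-]; last exact: Bl.
  by apply: (addrI (B 0 v)); rewrite -Bl !addr0.
have Bsr u (F : 'I_m -> M) : B u (\sum_i F i) = \sum_i B u (F i).
  elim/big_rec2: _ => [|i v w _ <-]; last exact: Br.
  by apply: (addrI (B u 0)); rewrite -Br !addr0.
under eq_bigr => i _ do rewrite -[a * x i](exp_dual2 hE) Bsl.
rewrite exchange_big; apply: eq_bigr => j _ /=.
rewrite -[y j * a](exp_dual1 hE) Bsr; apply: eq_bigr => i _.
by rewrite Bn ?mulrA //; apply: exp_in hE _.
Qed.

Lemma exp_index_scalar : exists2 c : k, c != 0 & \sum_i x i * y i = c%:A.
Proof.
have [c hc] : exists c : k, \sum_i x i * y i = c%:A.
  apply: (exp_central hE) => n _; rewrite mulr_suml mulr_sumr.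
  have := @exp_casimir (fun u v => u * v) n.
  rewrite (eq_bigr (fun i => n * (x i * y i))) => [->|i _]; last by rewrite mulrA.
  - by apply: eq_bigr => i _; rewrite mulrA.
  - by move=> *; rewrite mulrDl.
  - by move=> *; rewrite mulrDr.
  - by move=> *; rewrite mulrA.
exists c => //; apply: contraNneq (exp_index hE) => c0; by rewrite hc c0 scale0r.
Qed.

Definition lam : k := (projT1 (cid2 exp_index_scalar))^-1.

Lemma lam_neq0 : lam != 0.
Proof. by rewrite /lam; case: cid2 => c c0 _ /=; rewrite invr_eq0. Qed.

Lemma lam_index : lam *: \sum_i x i * y i = 1.
Proof. by rewrite /lam; case: cid2 => c c0 /= ->; rewrite scalerA mulVf // scale1r. Qed.

(* Junk-free only on [M1set N]: there it is the conditional expectation [E_M]. *)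
Definition EM (f : M -> M) : M := lam *: \sum_i f (x i) * y i.

Lemma EM_L a f : EM (fun b => a * f b) = a * EM f.
Proof.
by rewrite /EM -scalerAr mulr_sumr; congr (_ *: _); apply: eq_bigr => i _; rewrite mulrA.
Qed.

Lemma EM_R a f : M1set N f -> EM (fun b => f (a * b)) = EM f * a.
Proof.
move=> [fD fN]; rewrite /EM -scalerAl mulr_suml; congr (_ *: _).
rewrite (@exp_casimir (fun u v => f u * v)).
- by apply: eq_bigr => i _; rewrite mulrA.
- by move=> *; rewrite fD mulrDl.
- by move=> *; rewrite mulrDr.
- by move=> u n v Nn; rewrite fN // mulrA.
Qed.

Lemma EM_LE g a : M1set N g -> EM (fun b => g (a * E b)) = lam *: g a.
Proof.
move=> [gD gN]; rewrite /EM; congr (_ *: _).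
rewrite -[RHS]mulr1 -[in RHS](exp_dual1 hE 1) mulr_sumr; apply: eq_bigr => i _.
by rewrite mul1r gN ?mulrA //; apply: exp_in hE _.
Qed.

Lemma EM_sum (I : Type) (r : seq I) (F : I -> M -> M) :
  EM (fun b => \sum_(i <- r) F i b) = \sum_(i <- r) EM (F i).
Proof.
rewrite /EM -scaler_sumr exchange_big; congr (_ *: _); apply: eq_bigr => i _.
by rewrite mulr_suml.
Qed.


Lemma M1_sum (I : Type) (r : seq I) (F : I -> M) f : M1set N f ->
  f (\sum_(i <- r) F i) = \sum_(i <- r) f (F i).
Proof.
move=> [fD _]; elim/big_rec2: _ => [|i a b _ <-]; last exact: fD.
by apply: (addrI (f 0)); rewrite -fD !addr0.
Qed.

Lemma M1_scale c a f : M1set N f -> f (c *: a) = c *: f a.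
Proof.
move=> [_ fN]; rewrite -[c *: a]mulr1 -scalerAl scalerAr.
by rewrite fN; [rewrite -scalerAr mulr1|case: (exp_unital hE) => _ _ _; apply].
Qed.

Lemma M1_dual f a : M1set N f -> f a = \sum_i f (x i) * E (y i * a).
Proof.
move=> hf; rewrite -{1}[a](exp_dual2 hE) M1_sum //.
by case: hf => _ fN; apply: eq_bigr => i _; rewrite fN //; apply: exp_in hE _.
Qed.

Lemma M1_id : M1set N (fun a : M => a). Proof. by []. Qed.

Lemma M1_comp f g : M1set N f -> M1set N g -> M1set N (f \o g).
Proof. by move=> [fD fN] [gD gN]; split=> [a b|a n Nn] /=; rewrite ?gD ?fD // gN // fN. Qed.

Lemma M1_Lmul a : M1set N (Lmul a).
Proof. by split=> [b c|b n _]; rewrite /Lmul ?mulrDr ?mulrA. Qed.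

Lemma A_M1 a : Aset N a -> M1set N a. Proof. by case. Qed.

Lemma A_L a n b : Aset N a -> N n -> a (n * b) = n * a b.
Proof. by move=> [_ h] /h/(congr1 (fun f => f b)). Qed.

Lemma A_intro a : M1set N a -> (forall n b, N n -> a (n * b) = n * a b) -> Aset N a.
Proof. by move=> h1 h2; split=> // n Nn; apply/funext => b; apply: h2. Qed.

Lemma A_comp a b : Aset N a -> Aset N b -> Aset N (a \o b).
Proof.
move=> ha hb; apply: A_intro => [|n c Nn]; first by apply: M1_comp; apply: A_M1.
by rewrite /= (A_L _ hb) // (A_L _ ha).
Qed.

Lemma A_id : Aset N (fun a : M => a). Proof. by apply: A_intro. Qed.

Lemma A_E : Aset N E.
Proof.
apply: A_intro => [|n b Nn]; last exact: expL.
split=> [a b|a n Nn]; [exact: exp_add hE _ _|exact: expR].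
Qed.

Lemma A_one a : Aset N a -> exists c : k, a 1 = c%:A.
Proof.
move=> ha; apply: (exp_central hE) => n Nn.
by rewrite -(A_L _ ha) // mulr1; case: ha => -[_ aN] _; rewrite -aN // mul1r.
Qed.

Lemma A_EM a : Aset N a -> exists c : k, EM a = c%:A.
Proof.
move=> ha; apply: (exp_central hE) => n Nn.
rewrite -EM_R -?EM_L //; last exact: A_M1.
by congr EM; apply/funext => b; rewrite (A_L _ ha).
Qed.

Lemma M1_lincomb (I : finType) (c : I -> k) (w : I -> M -> M) :
  (forall i, M1set N (w i)) -> M1set N (fun a => \sum_i c i *: w i a).
Proof.
move=> hw; split=> [a b|a n Nn].
  by rewrite -big_split; apply: eq_bigr => i _; case: (hw i) => -> _; rewrite scalerDr.
by rewrite mulr_suml; apply: eq_bigr => i _; case: (hw i) => _ -> //; rewrite scalerAl.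
Qed.

Lemma A_lincomb (I : finType) (c : I -> k) (w : I -> M -> M) :
  (forall i, Aset N (w i)) -> Aset N (fun a => \sum_i c i *: w i a).
Proof.
move=> hw; apply: A_intro => [|n b Nn]; first by apply: M1_lincomb => i; apply: A_M1.
by rewrite mulr_sumr; apply: eq_bigr => i _; rewrite (A_L _ (hw i)) // scalerAr.
Qed.

(** * From a right basis of M_1 in A to a left one *)

Section Depth2.
Variables (d : nat) (u : 'I_d -> M -> M).
Hypotheses (uA : forall j, Aset N (u j))
  (uspan : forall f, M1set N f -> exists c : 'I_d -> M,
            f = \big[@add1 k M/@zero1 k M]_(j < d) (u j \o Lmul (c j)))
  (ufree : forall c : 'I_d -> M,
            \big[@add1 k M/@zero1 k M]_(j < d) (u j \o Lmul (c j)) = @zero1 k M ->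
            forall j, c j = 0).

Let uspan' f : M1set N f -> exists c : 'I_d -> M, forall b, f b = \sum_j u j (c j * b).
Proof. by move=> /uspan[c ->]; exists c => b; rewrite big_add1. Qed.

Definition rco (f : M -> M) j : M :=
  if pselect (M1set N f) is left h then projT1 (cid (uspan' h)) j else 0.

Lemma rcoE f b : M1set N f -> f b = \sum_j u j (rco f j * b).
Proof. by move=> hf; rewrite /rco; case: pselect => // h; case: cid. Qed.

Lemma rco_uniq f c : M1set N f -> (forall b, f b = \sum_j u j (c j * b)) -> rco f =1 c.
Proof.
move=> hf hc j; apply/eqP; rewrite -subr_eq0; apply/eqP; move: j.
apply: (ufree (c := fun j => rco f j - c j)); apply/funext => b; rewrite big_add1 /zero1.
under eq_bigr => j _ do rewrite /= /Lmul mulrBl.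
have uB j v w : u j (v - w) = u j v - u j w.
  by have := (A_M1 (uA j)).1 (v - w) w; rewrite subrK => ->; rewrite addrK.
under eq_bigr => j _ do rewrite uB.
by rewrite sumrB -rcoE // -hc subrr.
Qed.

(** The map b |-> a E(b) is a e_1, and [zed j a] is its j-th right coordinate, scaled. The scaling
    makes [zed] dual to [u] for the form E_M(f g), by [EM_zed]. *)
Definition zed j : M -> M := fun a => lam^-1 *: rco (fun b => a * E b) j.

Lemma M1_LE a : M1set N (fun b => a * E b).
Proof. exact: (M1_comp (M1_Lmul a) (A_M1 A_E)). Qed.

Lemma zed_A j : Aset N (zed j).
Proof.
rewrite /zed; pose g a := rco (fun b => a * E b).
apply: A_intro; first split=> [a b|a n Nn].
- rewrite -scalerDr; congr (_ *: _).
  refine (rco_uniq (c := fun j => g a j + g b j) (M1_LE _) _ j) => c.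
  rewrite mulrDl (rcoE c (M1_LE a)) (rcoE c (M1_LE b)) -big_split; apply: eq_bigr => i _ /=.
  by case: (A_M1 (uA i)) => <- _; rewrite -mulrDl.
- rewrite -scalerAl; congr (_ *: _).
  refine (rco_uniq (c := fun j => g a j * n) (M1_LE _) _ j) => c.
  by rewrite -mulrA -expL // (rcoE _ (M1_LE a)); apply: eq_bigr => i _; rewrite mulrA.
- move=> n b Nn; rewrite -scalerAr; congr (_ *: _).
  refine (rco_uniq (c := fun j => n * g b j) (M1_LE _) _ j) => c.
  rewrite -mulrA (rcoE _ (M1_LE b)) mulr_sumr; apply: eq_bigr => i _.
  by rewrite -(A_L _ (uA i)) // mulrA.
Qed.

Lemma EM_zed j f : M1set N f -> EM (zed j \o f) = rco f j.
Proof.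
move=> hf; rewrite /EM /zed /=.
under eq_bigr => i _ do rewrite -scalerAl.
rewrite -scaler_sumr scalerA mulfV ?lam_neq0 // scale1r.
apply/esym; refine (rco_uniq (c := fun j => \sum_i rco (fun b => f (x i) * E b) j * y i) hf _ j) => {j} b.
under eq_bigr => j _ do rewrite mulr_suml (M1_sum _ _ (A_M1 (uA j))).
rewrite exchange_big (M1_dual _ hf); apply: eq_bigr => i _ /=.
by rewrite (rcoE _ (M1_LE _)); apply: eq_bigr => j _; rewrite mulrA.
Qed.

Lemma zed_span f b : M1set N f -> f b = \sum_j EM (f \o u j) * zed j b.
Proof.
move=> hf; rewrite /zed.
have e j : EM (f \o u j) * (lam^-1 *: rco (fun c => b * E c) j) =
    lam^-1 *: EM (fun c => f (u j (rco (fun c => b * E c) j * c))).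
  by rewrite -scalerAr -(EM_R _ (M1_comp hf (A_M1 (uA j)))).
under eq_bigr => j _ do rewrite e.
rewrite -scaler_sumr -EM_sum.
have -> : (fun c => \sum_j f (u j (rco (fun c => b * E c) j * c))) = fun c => f (b * E c).
  by apply/funext => c; rewrite -M1_sum // -(rcoE _ (M1_LE b)).
by rewrite EM_LE // scalerA mulVf ?scale1r // lam_neq0.
Qed.

Lemma zed_free (c : 'I_d -> M) : (forall b, \sum_j c j * zed j b = 0) -> forall j, c j = 0.
Proof.
move=> h i.
have e j : EM (zed j \o u i) = (i == j)%:R.
  rewrite EM_zed; last exact: A_M1.
  rewrite (rco_uniq (c := fun j => (i == j)%:R) (A_M1 (uA i))) // => b.
  rewrite (bigD1 i) //= eqxx mul1r big1 ?addr0 // => l /negPf hl.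
  rewrite eq_sym hl mul0r; apply: (addrI (u l 0)).
  by case: (A_M1 (uA l)) => <- _; rewrite !addr0.
have : EM (fun b => \sum_j c j * zed j (u i b)) = 0.
  have -> : (fun b => \sum_j c j * zed j (u i b)) = fun=> 0 by apply/funext => b; apply: h.
  by rewrite /EM big1 ?scaler0 // => j _; rewrite mul0r.
rewrite EM_sum (bigD1 i) //= EM_L (e i) eqxx mulr1 big1 ?addr0 // => j /negPf hj.
by rewrite EM_L (e j) eq_sym hj mulr0.
Qed.

End Depth2.
End Expectation.

(** A left M-basis of M_1 in A that matches the convention of [bialg]: its first member is the unit,
    and evaluation at 1, the future counit, kills the others. *)
Record adapted_basis (k : fieldType) (M : algType k) (N : M -> Prop) n
    (w : 'I_n.+1 -> M -> M) : Prop := AdaptedBasis {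
  ab_A : forall j, Aset N (w j);
  ab_id : forall a, w ord0 a = a;
  ab_one : forall j, w j 1 = (j == ord0)%:R;
  ab_span : forall f, M1set N f -> exists c : 'I_n.+1 -> M, forall b, f b = \sum_j c j * w j b;
  ab_free : forall c : 'I_n.+1 -> M, (forall b, \sum_j c j * w j b = 0) -> forall j, c j = 0 }.

Section Adapt.
Variables (k : fieldType) (M : algType k) (N : M -> Prop) (E : M -> M) (m : nat) (x y : 'I_m -> M).
Hypothesis hE : expectation N E x y.

(** The identity has a nonzero coordinate at z_0, so it can replace z_0. Subtracting from each other
    z_j its scalar value at 1 makes it vanish at 1. *)
Lemma adapt_nz n (z : 'I_n.+1 -> M -> M) (c : 'I_n.+1 -> k) :
  (forall j, Aset N (z j)) ->
  (forall f, M1set N f -> exists c : 'I_n.+1 -> M, forall b, f b = \sum_j c j * z j b) ->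
  (forall c : 'I_n.+1 -> M, (forall b, \sum_j c j * z j b = 0) -> forall j, c j = 0) ->
  (forall b, b = \sum_j c j *: z j b) -> c ord0 != 0 ->
  exists w : 'I_n.+1 -> M -> M, adapted_basis N w.
Proof.
move=> zA zs zf hc c0.
have [e he] : exists e : 'I_n.+1 -> k, forall j, z j 1 = (e j)%:A.
  exists (fun j => projT1 (cid (A_one hE (zA j)))) => j; by case: cid.
pose w (j : 'I_n.+1) a := if j == ord0 then a else z j a - e j *: a.
have w0 a : w ord0 a = a by rewrite /w eqxx.
have wl l a : w (lift ord0 l) a = z (lift ord0 l) a - e (lift ord0 l) *: a by [].
have sum (C : 'I_n.+1 -> M) b : \sum_j C j * w j b = (C ord0 - \sum_(l < n) e (lift ord0 l) *: C (lift ord0 l)) * b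
    + \sum_(l < n) C (lift ord0 l) * z (lift ord0 l) b.
  rewrite big_ord_recl w0 mulrBl -addrA; congr (_ + _); rewrite addrC mulr_suml -sumrB.
  by apply: eq_bigr => l _; rewrite wl mulrBr -scalerAl -scalerAr.
have w1 j : w j 1 = (j == ord0)%:R.
  by rewrite /w he; case: eqP => // _; rewrite subrr.
exists w; split=> //.
- move=> j; apply: A_intro => [|n0 b Nn].
    split=> [a b|a n0 Nn]; rewrite /w; case: eqP => // _; case: (zA j) => -[zD zN] _.
      by rewrite zD scalerDr opprD addrACA.
    by rewrite zN // mulrBl scalerAl.
  by rewrite /w; case: eqP => // _; rewrite (A_L _ (zA j)) // mulrBr scalerAr.
- move=> f /zs[C hC].
  pose K := (c ord0)^-1 *: C ord0.
  pose C' j := C j - c j *: K.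
  exists (fun j => if j == ord0 then K + \sum_(l < n) e (lift ord0 l) *: C' (lift ord0 l) else C' j).
  move=> b; rewrite sum /= addrK {}hC.
  rewrite {2}[b]hc mulr_sumr [X in X + _]big_ord_recl /= [LHS]big_ord_recl -addrA.
  congr (_ + _).
    by rewrite -scalerAr -scalerAl scalerA mulfV // scale1r.
  rewrite -big_split; apply: eq_bigr => l _ /=.
  by rewrite -/K mulrBl -[_ *: K * _]scalerAl -scalerAr addrC subrK.
move=> C hC.
have C0 : C ord0 = 0.
  have := hC 1; rewrite (bigD1 ord0) //= w1 mulr1 big1 ?addr0 // => j /negPf h.
  by rewrite w1 h mulr0.
pose s := \sum_(l < n) e (lift ord0 l) *: C (lift ord0 l).
have key : forall j, (if j == ord0 then 0 else C j) - c j *: s = 0.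
  apply: zf => b; under eq_bigr => j _ do rewrite mulrBl.
  rewrite sumrB big_ord_recl /= mul0r add0r.
  have -> : \sum_i c i *: s * z i b = s * b.
    by rewrite [in RHS](hc b) mulr_sumr; apply: eq_bigr => i _; rewrite -scalerAr scalerAl.
  by have := hC b; rewrite sum C0 -/s sub0r mulNr addrC.
have s0 : s = 0.
  have := key ord0; rewrite eqxx sub0r => /eqP; rewrite oppr_eq0 scaler_eq0 (negPf c0) /=.
  by move/eqP.
move=> j; have := key j; rewrite s0 scaler0 subr0.
by case: (unliftP ord0 j) => [l ->|->] //=; rewrite C0.
Qed.

Lemma adapt d (z : 'I_d -> M -> M) :
  (forall j, Aset N (z j)) ->
  (forall f, M1set N f -> exists c : 'I_d -> M, forall b, f b = \sum_j c j * z j b) ->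
  (forall c : 'I_d -> M, (forall b, \sum_j c j * z j b = 0) -> forall j, c j = 0) ->
  (forall a, Aset N a -> exists c : 'I_d -> k, forall b, a b = \sum_j c j *: z j b) ->
  exists n (w : 'I_n.+1 -> M -> M), adapted_basis N w.
Proof.
case: d z => [|n] z zA zs zf zk.
  have [c /(_ 1)] := zk _ (A_id N).
  by rewrite big_ord0 => /eqP; rewrite oner_eq0.
have [c hc] := zk _ (A_id N).
have [j cj] : exists j, c j != 0.
  apply: contrapT => no; have /eqP := hc 1; rewrite big1 ?oner_eq0 // => j _.
  have [->|cj] := eqVneq (c j) 0; first by rewrite scale0r.
  by case: no; exists j.
pose s := tperm ord0 j.
have sK : involutive s by exact: tpermK.
have re (V : zmodType) (G : 'I_n.+1 -> V) : \sum_i G (s i) = \sum_i G i.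
  by rewrite [RHS](reindex_inj (perm_inj (s := s))).
exists n; apply: (@adapt_nz n (fun i => z (s i)) (fun i => c (s i))).
- by move=> i; apply: zA.
- move=> f /zs[C hC]; exists (fun i => C (s i)) => b.
  by rewrite (re _ (fun i => C i * z i b)).
- move=> C hC i; rewrite -[i]sK; apply: (zf (fun i => C (s i))) => b.
  rewrite -[RHS](hC b) -(re _ (fun i => C (s i) * z i b)).
  by apply: eq_bigr => l _; rewrite sK.
- by move=> b; rewrite (re _ (fun i => c i *: z i b)).
by rewrite /s tpermL.
Qed.
End Adapt.

(* [right_span] is all that the argument uses of the right bases. *)
Definition right_span (k : fieldType) (M : algType k) (N : M -> Prop) : Prop :=
  forall f, M1set N f -> exists (d : nat) (u : 'I_d -> M -> M) (c : 'I_d -> M),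
    (forall j, Aset N (u j)) /\ forall b, f b = \sum_j u j (c j * b).

Lemma depth2_basis (k : fieldType) (M : algType k) (N : M -> Prop) (E : M -> M) (m : nat)
    (x y : 'I_m -> M) : expectation N E x y -> depth2 N ->
  right_span N /\ exists n (w : 'I_n.+1 -> M -> M), adapted_basis N w.
Proof.
move=> hE [[d [u [uA us uf]]] _]; split.
  move=> f /us[c ->]; exists d, u, c; split=> // b; by rewrite big_add1.
apply: (adapt hE (z := zed hE us)).
- by move=> j; apply: zed_A uf _.
- by move=> f hf; exists (fun j => EM hE (f \o u j)) => b; apply: zed_span.
- exact: zed_free.
move=> a ha.
have A_c j : exists c : k, EM hE (a \o u j) = c%:A by apply: A_EM; apply: A_comp.
exists (fun j => projT1 (cid (A_c j))) => b.
rewrite {1}(zed_span hE uA us b (A_M1 ha)); apply: eq_bigr => j _; case: cid => c /= ->.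
by rewrite -scalerAl mul1r.
Qed.

(** * The Hopf algebra A *)

Section Contraction.
Variables (k : comNzRingType) (I : finType) (A : I -> I -> k) (B : I -> I -> I -> k) (f g h : I -> k).

Lemma contract_l : \sum_s \sum_l A s l * ((\sum_i \sum_j f i * g j * B i j s) * h l) =
  \sum_l \sum_i \sum_j (\sum_s A s l * B i j s) * (f i * g j * h l).
Proof.
rewrite exchange_big; apply: eq_bigr => l _ /=.
under [LHS]eq_bigr => s _ do rewrite mulr_suml mulr_sumr.
rewrite exchange_big; apply: eq_bigr => i _ /=.
under [LHS]eq_bigr => s _ do rewrite mulr_suml mulr_sumr.
rewrite exchange_big; apply: eq_bigr => j _ /=.
by rewrite mulr_suml; apply: eq_bigr => s _; ring.
Qed.

Lemma contract_r : \sum_i \sum_s A i s * (f i * (\sum_j \sum_l g j * h l * B j l s)) =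
  \sum_l \sum_i \sum_j (\sum_s A i s * B j l s) * (f i * g j * h l).
Proof.
rewrite [RHS]exchange_big; apply: eq_bigr => i _ /=.
rewrite [RHS]exchange_big /=.
under [LHS]eq_bigr => s _ do rewrite 2!mulr_sumr.
rewrite exchange_big; apply: eq_bigr => j _ /=.
under [LHS]eq_bigr => s _ do rewrite 2!mulr_sumr.
rewrite exchange_big; apply: eq_bigr => l _ /=.
by rewrite mulr_suml; apply: eq_bigr => s _; ring.
Qed.
End Contraction.

Lemma sum4 (Z : nmodType) (I : finType) (G : I -> I -> I -> I -> Z) :
  \sum_i \sum_j \sum_u \sum_v G i j u v =
  \sum_(z : (I * I) * (I * I)) G z.1.1 z.1.2 z.2.1 z.2.2.
Proof.
rewrite -(pair_bigA _ (fun z1 z2 => G z1.1 z1.2 z2.1 z2.2)) /=.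
rewrite -(pair_bigA _ (fun i j => \sum_z2 G i j z2.1 z2.2)) /=.
apply: eq_bigr => i _; apply: eq_bigr => j _.
by rewrite -(pair_bigA _ (fun u v => G i j u v)).
Qed.

Section Coordinates.
Variables (k : fieldType) (M : algType k) (N : M -> Prop) (E : M -> M) (m : nat) (x y : 'I_m -> M).
Hypothesis hE : expectation N E x y.
Variables (n : nat) (w : 'I_n.+1 -> M -> M).
Hypothesis hw : adapted_basis N w.
Local Notation V := 'rV[k]_n.+1.
Local Notation o := (ev k (ord0 : 'I_n.+1)).

Definition opA (a : V) : M -> M := fun b => \sum_i a 0 i *: w i b.

Lemma opA_A a : Aset N (opA a).
Proof. by apply: A_lincomb; exact: ab_A hw. Qed.

Lemma opA_M1 a : M1set N (opA a). Proof. exact: A_M1 (opA_A a). Qed.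

Lemma opA_D a b c : opA (a + b) c = opA a c + opA b c.
Proof. by rewrite -big_split; apply: eq_bigr => i _; rewrite mxE scalerDl. Qed.
Lemma opA_Z t a c : opA (t *: a) c = t *: opA a c.
Proof. by rewrite scaler_sumr; apply: eq_bigr => i _; rewrite mxE scalerA. Qed.
Lemma opA_0 c : opA 0 c = 0.
Proof. by rewrite /opA big1 // => i _; rewrite mxE scale0r. Qed.
Lemma opA_sum (I : Type) (r : seq I) (F : I -> V) c :
  opA (\sum_(i <- r) F i) c = \sum_(i <- r) opA (F i) c.
Proof. by elim/big_rec2: _ => [|i a b _ <-]; rewrite ?opA_0 ?opA_D. Qed.
Lemma opA_ev i c : opA (ev k i) c = w i c.
Proof.
rewrite /opA (bigD1 i) //= evE eqxx scale1r big1 ?addr0 // => j /negPf ji.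
by rewrite evE ji scale0r.
Qed.
Lemma opA_o c : opA o c = c. Proof. by rewrite opA_ev (ab_id hw). Qed.
Lemma opA_1 a : opA a 1 = (pr a o)%:A.
Proof.
rewrite pr_evr /opA (bigD1 ord0) //= (ab_one hw) eqxx big1 ?addr0 // => j /negPf j0.
by rewrite (ab_one hw) j0 scaler0.
Qed.

Lemma free1 (c : 'I_n.+1 -> k) : (forall b, \sum_i c i *: w i b = 0) -> forall i, c i = 0.
Proof.
move=> h i; have := ab_free hw (c := fun j => (c j)%:A) _ i => e.
have /eqP : (c i)%:A = 0 :> M.
  by apply: e => b; rewrite -[RHS](h b); apply: eq_bigr => j _; rewrite -scalerAl mul1r.
by rewrite scaler_eq0 oner_eq0 orbF => /eqP.
Qed.

Lemma opA_inj a b : (forall c, opA a c = opA b c) -> a = b.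
Proof.
move=> h; apply/rowP => i; apply/eqP; rewrite -subr_eq0; apply/eqP.
apply: (free1 (c := fun i => a 0 i - b 0 i)) => c.
under eq_bigr => j _ do rewrite scalerBl.
by rewrite sumrB; apply/eqP; rewrite subr_eq0; apply/eqP; apply: h.
Qed.

Definition lco (f : M -> M) j : M :=
  if pselect (M1set N f) is left h then projT1 (cid (ab_span hw h)) j else 0.

Lemma lcoE f b : M1set N f -> f b = \sum_j lco f j * w j b.
Proof. by move=> hf; rewrite /lco; case: pselect => // h; case: cid. Qed.

Lemma lco_uniq f c : M1set N f -> (forall b, f b = \sum_j c j * w j b) -> forall j, lco f j = c j.
Proof.
move=> hf hc j; apply/eqP; rewrite -subr_eq0; apply/eqP; move: j.
apply: (ab_free hw (c := fun j => lco f j - c j)) => b.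
under eq_bigr => j _ do rewrite mulrBl.
by rewrite sumrB -lcoE // -hc subrr.
Qed.

(** Both f and the w_j commute with left multiplication by N, so by uniqueness the left coordinates
    of f commute with N; irreducibility makes them scalars. Hence w is a k-basis of A. *)
Lemma opA_surj f : Aset N f -> exists a, forall b, f b = opA a b.
Proof.
move=> hf; have hc j : exists c : k, lco f j = c%:A.
  apply: (exp_central hE) => u Nu; move: j.
  have h c : f (u * c) = u * f c by exact: (A_L c hf Nu).
  have hM : M1set N (fun c => f (u * c)) by exact: M1_comp (A_M1 hf) (M1_Lmul N u).
  move=> j; rewrite -(lco_uniq (c := fun j => lco f j * u) hM).
    rewrite -(lco_uniq (c := fun j => u * lco f j) hM) // => b.
    by rewrite h (lcoE _ (A_M1 hf)) mulr_sumr; apply: eq_bigr => i _; rewrite mulrA.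
  move=> b; rewrite (lcoE _ (A_M1 hf)); apply: eq_bigr => i _.
  by rewrite (A_L _ (ab_A hw i)) // mulrA.
exists (\row_j projT1 (cid (hc j))) => b; rewrite (lcoE _ (A_M1 hf)).
by apply: eq_bigr => j _; rewrite mxE; case: cid => c /= ->; rewrite -scalerAl mul1r.
Qed.

Definition coA (f : M -> M) : V :=
  if pselect (Aset N f) is left h then projT1 (cid (opA_surj h)) else 0.

Lemma coAK f b : Aset N f -> opA (coA f) b = f b.
Proof. by move=> hf; rewrite /coA; case: pselect => // h; case: cid. Qed.

Lemma opA_mulZ a t c : opA a (t *: c) = t *: opA a c.
Proof. exact: (M1_scale hE t c (opA_M1 a)). Qed.

Definition mul_tensor i j : V := coA (w i \o w j).

Lemma muA_opA a b c : opA (pm mul_tensor a b) c = opA a (opA b c).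
Proof.
rewrite {3}/opA (M1_sum _ _ (opA_M1 a)) /pm exchange_big opA_sum; apply: eq_bigr => j _.
rewrite opA_sum opA_mulZ /opA scaler_sumr; apply: eq_bigr => i _.
rewrite -/(opA _ c) opA_Z coAK //; last by apply: A_comp; exact: ab_A hw _.
by rewrite scalerA mulrC.
Qed.

(** The j-th left coordinate of c |-> a(b c), as a function of b, is again in A. Expanding it in w
    gives a(b c) as a sum of a_(1)(b) a_(2)(c), which defines [cop_tensor]. *)
Lemma cop_A a j : Aset N (fun b => lco (fun c => opA a (b * c)) j).
Proof.
have h b : M1set N (fun c => opA a (b * c)) by exact: M1_comp (opA_M1 a) (M1_Lmul N b).
apply: A_intro; first split=> [b b'|b u Nu].
- apply: (lco_uniq (c := fun j => lco (fun c => opA a (b * c)) j + lco (fun c => opA a (b' * c)) j)) => // c.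
  rewrite mulrDl (opA_M1 a).1 (lcoE _ (h b)) (lcoE _ (h b')) -big_split.
  by apply: eq_bigr => i _; rewrite mulrDl.
- apply: (lco_uniq (c := fun j => lco (fun c => opA a (b * c)) j * u)) => // c.
  rewrite -mulrA (lcoE _ (h b)); apply: eq_bigr => i _.
  by rewrite (A_L _ (ab_A hw i)) // mulrA.
move=> u b Nu; apply: (lco_uniq (c := fun j => u * lco (fun c => opA a (b * c)) j)) => // c.
rewrite -mulrA (A_L _ (opA_A a)) // (lcoE _ (h b)) mulr_sumr.
by apply: eq_bigr => i _; rewrite mulrA.
Qed.

Definition cop_tensor i j : V := \row_l coA (fun b => lco (fun c => opA (ev k l) (b * c)) j) 0 i.

Lemma pr_nuA a i j : pr a (cop_tensor i j) = coA (fun b => lco (fun c => opA a (b * c)) j) 0 i.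
Proof.
have -> : coA (fun b => lco (fun c => opA a (b * c)) j) =
    \sum_l a 0 l *: coA (fun b => lco (fun c => opA (ev k l) (b * c)) j).
  apply: opA_inj => b; rewrite coAK; last exact: cop_A.
  rewrite opA_sum; refine (lco_uniq (c := fun j => \sum_l opA (a 0 l *:
    coA (fun b => lco (fun c => opA (ev k l) (b * c)) j)) b) _ _ j) => [|c].
    exact: M1_comp (opA_M1 a) (M1_Lmul N b).
  under [RHS]eq_bigr => i' _ do rewrite mulr_suml.
  rewrite exchange_big {1}/opA; apply: eq_bigr => l _ /=.
  have h : M1set N (fun c => opA (ev k l) (b * c)) by exact: M1_comp (opA_M1 _) (M1_Lmul N b).
  rewrite (eq_bigr (fun i => a 0 l *: (lco (fun c => opA (ev k l) (b * c)) i * w i c))).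
    by rewrite -scaler_sumr -(lcoE _ h) opA_ev.
  by move=> i' _; rewrite opA_Z coAK ?scalerAl //; apply: cop_A.
by rewrite summxE; apply: eq_bigr => l _; rewrite !mxE.
Qed.

Lemma cop a b c : opA a (b * c) = \sum_i \sum_j pr a (cop_tensor i j) *: (w i b * w j c).
Proof.
have h : M1set N (fun c => opA a (b * c)) by exact: M1_comp (opA_M1 a) (M1_Lmul N b).
rewrite (lcoE c h) exchange_big; apply: eq_bigr => j _ /=.
rewrite -(coAK b (cop_A a j)) mulr_suml; apply: eq_bigr => i _.
by rewrite pr_nuA scalerAl.
Qed.

Lemma free2 (T : 'I_n.+1 -> 'I_n.+1 -> k) :
  (forall b c, \sum_i \sum_j T i j *: (w i b * w j c) = 0) -> forall i j, T i j = 0.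
Proof.
move=> h i j; move: i; apply: free1 => b.
apply: (ab_free hw (c := fun j => \sum_i T i j *: w i b)) => c.
rewrite -[RHS](h b c) exchange_big; apply: eq_bigr => l _.
by rewrite mulr_suml; apply: eq_bigr => i _; rewrite scalerAl.
Qed.

(* Any expression of [a (b c)] as a sum of products computes the coproduct. *)
Lemma sw_cop (I : finType) (r : I -> k) (p q : I -> V) a (B : V -> V -> k) :
  (forall v, lin (fun u => B u v)) -> (forall u, lin (B u)) ->
  (forall b c, opA a (b * c) = \sum_i r i *: (opA (p i) b * opA (q i) c)) ->
  sw cop_tensor a B = \sum_i r i * B (p i) (q i).
Proof.
move=> h1 h2 ha.
have e i j : pr a (cop_tensor i j) = \sum_l r l * (p l 0 i * q l 0 j).
  apply/eqP; rewrite -subr_eq0; apply/eqP; move: i j; apply: free2 => b c.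
  under eq_bigr => i _ do under eq_bigr => j _ do rewrite scalerBl.
  under eq_bigr => i _ do rewrite sumrB.
  rewrite sumrB -cop ha; apply/eqP; rewrite subr_eq0; apply/eqP.
  under [RHS]eq_bigr => i _ do under eq_bigr => j _ do rewrite scaler_suml.
  under [RHS]eq_bigr => i _ do rewrite exchange_big.
  rewrite exchange_big; apply: eq_bigr => l _ /=.
  rewrite /opA mulr_suml scaler_sumr; apply: eq_bigr => i _.
  rewrite mulr_sumr scaler_sumr; apply: eq_bigr => j _.
  by rewrite -scalerAl -scalerAr !scalerA mulrA.
under [RHS]eq_bigr => l _ do rewrite (bilin_ev (p l) (q l) h1 h2) mulr_sumr.
rewrite exchange_big; apply: eq_bigr => i _.
under [RHS]eq_bigr => l _ do rewrite mulr_sumr.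
rewrite exchange_big; apply: eq_bigr => j _.
by rewrite e mulr_suml; apply: eq_bigr => l _; rewrite !pr_evr !mulrA.
Qed.

(** Associativity of M: a(b c d) is expanded with either bracketing, and the coefficients are
    compared by freeness of w. *)
Lemma nuA_assoc f g h : pm cop_tensor (pm cop_tensor f g) h = pm cop_tensor f (pm cop_tensor g h).
Proof.
apply: pr_ext => a; rewrite prC [RHS]prC -!sw_pr.
pose T1 i j l := \sum_s pr a (cop_tensor s l) * cop_tensor i j 0 s.
pose T2 i j l := \sum_s pr a (cop_tensor i s) * cop_tensor j l 0 s.
have eT i j l : T1 i j l = T2 i j l.
  apply/eqP; rewrite -subr_eq0; apply/eqP.
  pose D i j l := T1 i j l - T2 i j l; rewrite -/(D i j l).
  suff hD b c d : \sum_l (\sum_i \sum_j D i j l *: (w i b * w j c)) * w l d = 0.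
    move: i j; apply: free2 => b c.
    exact: (ab_free hw (c := fun l => \sum_i \sum_j D i j l *: (w i b * w j c))).
  have e1 : \sum_l (\sum_i \sum_j T1 i j l *: (w i b * w j c)) * w l d = opA a (b * c * d).
    rewrite cop exchange_big; apply: eq_bigr => {}l _ /=.
    under [RHS]eq_bigr => s _ do rewrite scalerAl -opA_ev cop scaler_sumr.
    rewrite -mulr_suml; congr (_ * _).
    under [RHS]eq_bigr => s _ do under eq_bigr => i' _ do rewrite scaler_sumr.
    rewrite [RHS]exchange_big; apply: eq_bigr => i' _ /=.
    rewrite [RHS]exchange_big; apply: eq_bigr => j' _ /=.
    by rewrite scaler_suml; apply: eq_bigr => s _; rewrite pr_evl scalerA.
  have e2 : \sum_l (\sum_i \sum_j T2 i j l *: (w i b * w j c)) * w l d = opA a (b * c * d).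
    rewrite -mulrA cop.
    under [LHS]eq_bigr => l' _ do rewrite mulr_suml.
    rewrite [LHS]exchange_big; apply: eq_bigr => i' _ /=.
    under [RHS]eq_bigr => s _ do rewrite -[w s _]opA_ev cop mulr_sumr scaler_sumr.
    rewrite [RHS]exchange_big /=.
    under [LHS]eq_bigr => l' _ do rewrite mulr_suml.
    rewrite [LHS]exchange_big; apply: eq_bigr => j' _ /=.
    under [RHS]eq_bigr => s _ do rewrite mulr_sumr scaler_sumr.
    rewrite [RHS]exchange_big; apply: eq_bigr => l' _ /=.
    rewrite scaler_suml mulr_suml; apply: eq_bigr => s _.
    by rewrite pr_evl -scalerAr scalerA -scalerAl mulrA.
  apply/eqP; rewrite -[X in _ == X](subrr (opA a (b * c * d))) -{1}e1 -e2 -sumrB; apply/eqP.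
  apply: eq_bigr => l' _; rewrite -mulrBl -sumrB; congr (_ * _); apply: eq_bigr => i' _.
  by rewrite -sumrB; apply: eq_bigr => j' _; rewrite -scalerBl.
have e1 s : pr (ev k s) (pm cop_tensor f g) = \sum_i \sum_j f 0 i * g 0 j * cop_tensor i j 0 s.
  by rewrite pr_evl summxE; apply: eq_bigr => i _; rewrite summxE; apply: eq_bigr => j _; rewrite mxE.
have e2 s : pr (ev k s) (pm cop_tensor g h) = \sum_j \sum_l g 0 j * h 0 l * cop_tensor j l 0 s.
  by rewrite pr_evl summxE; apply: eq_bigr => i _; rewrite summxE; apply: eq_bigr => j _; rewrite mxE.
rewrite /sw; under eq_bigr => s _ do under eq_bigr => l _ do rewrite e1 pr_evl.
under [RHS]eq_bigr => s _ do under eq_bigr => l _ do rewrite e2 pr_evl.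
rewrite (contract_l (fun s l => pr a (cop_tensor s l)) (fun i j s => cop_tensor i j 0 s) (fun i => f 0 i)
  (fun i => g 0 i) (fun i => h 0 i)).
rewrite (contract_r (fun s l => pr a (cop_tensor s l)) (fun i j s => cop_tensor i j 0 s) (fun i => f 0 i)
  (fun i => g 0 i) (fun i => h 0 i)).
apply: eq_bigr => l _; apply: eq_bigr => i _; apply: eq_bigr => j _.
by congr (_ * _); exact: eT.
Qed.

Lemma scalar_inj (s t : k) : s%:A = t%:A :> M -> s = t.
Proof.
move=> /eqP; rewrite -subr_eq0 -scalerBl scaler_eq0 oner_eq0 orbF subr_eq0.
by move/eqP.
Qed.

Lemma opA_vsw a (B : V -> V -> V) c :
  opA (vsw cop_tensor a B) c = \sum_i \sum_j pr a (cop_tensor i j) *: opA (B (ev k i) (ev k j)) c.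
Proof.
rewrite /vsw opA_sum; apply: eq_bigr => i _; rewrite opA_sum.
by apply: eq_bigr => j _; rewrite opA_Z.
Qed.

(** All axioms are identities of operators on M: b = 1 or c = 1 in a(b c) gives the counit laws,
    evaluation at 1 the multiplicativity of the counit, and two expansions of a(b(c d)), compared by
    [sw_cop], the compatibility. *)
Lemma bialg_A : bialg mul_tensor cop_tensor.
Proof.
have epsE i : w i 1 = (pr (ev k i) o)%:A by rewrite -opA_1 opA_ev.
split.
- by move=> a b c; apply: opA_inj => r; rewrite !muA_opA.
- exact: nuA_assoc.
- by move=> a; apply: opA_inj => r; rewrite muA_opA opA_o.
- by move=> a; apply: opA_inj => r; rewrite muA_opA opA_o.
- move=> f; apply: pr_ext => a; rewrite prC [RHS]prC -sw_pr.
  have {2}-> : a = vsw cop_tensor a (fun u v => pr u o *: v).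
    apply: opA_inj => c; rewrite opA_vsw -{1}[c]mul1r cop.
    apply: eq_bigr => i _; apply: eq_bigr => j _.
    by rewrite opA_Z opA_ev epsE -scalerAl mul1r.
  by rewrite pr_vsw; apply: eq_sw => u v; rewrite prZl.
- move=> f; apply: pr_ext => a; rewrite prC [RHS]prC -sw_pr.
  have {2}-> : a = vsw cop_tensor a (fun u v => pr v o *: u).
    apply: opA_inj => c; rewrite opA_vsw -{1}[c]mulr1 cop.
    apply: eq_bigr => i _; apply: eq_bigr => j _.
    by rewrite opA_Z opA_ev epsE -scalerAr mulr1.
  by rewrite pr_vsw; apply: eq_sw => u v; rewrite prZl mulrC.
- move=> a b; apply: scalar_inj; rewrite -opA_1 muA_opA opA_1 opA_mulZ opA_1.
  by rewrite scalerA mulrC.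
- move=> f g; rewrite -sw_pr.
  rewrite (sw_cop (I := unit) (r := fun=> 1) (p := fun=> o) (q := fun=> o)); [|lin_tac..|].
    by rewrite big_const cardT enumT unlock /= mul1r addr0.
  by move=> b c; rewrite big_const cardT enumT unlock /= scale1r addr0 !opA_o.
move=> a b f g; rewrite -sw_pr sw_compat_ev.
pose I := (('I_n.+1 * 'I_n.+1) * ('I_n.+1 * 'I_n.+1))%type.
rewrite (sw_cop (I := I)
  (r := fun z => pr a (cop_tensor z.1.1 z.1.2) * pr b (cop_tensor z.2.1 z.2.2))
  (p := fun z => mul_tensor z.1.1 z.2.1) (q := fun z => mul_tensor z.1.2 z.2.2)); [|lin_tac..|].
  rewrite (sum4 (fun i j u v => pr a (cop_tensor i j) * pr b (cop_tensor u v) * (pr f (mul_tensor i u) * pr g (mul_tensor j v)))).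
  by apply: eq_bigr => z _; rewrite (prC f) (prC g).
move=> c d; rewrite muA_opA cop (M1_sum _ _ (opA_M1 a)).
under eq_bigr => u _ do rewrite (M1_sum _ _ (opA_M1 a)).
have e u v : opA a (pr b (cop_tensor u v) *: (w u c * w v d)) =
   \sum_i \sum_j pr a (cop_tensor i j) * pr b (cop_tensor u v) *: (opA (mul_tensor i u) c * opA (mul_tensor j v) d).
  rewrite opA_mulZ cop scaler_sumr; apply: eq_bigr => i _; rewrite scaler_sumr.
  apply: eq_bigr => j _; rewrite scalerA mulrC; congr (_ *: (_ * _)).
    by rewrite -pm_ev muA_opA !opA_ev.
  by rewrite -pm_ev muA_opA !opA_ev.
under eq_bigr => u _ do under eq_bigr => v _ do rewrite e.
rewrite -(sum4 (fun i j u v => pr a (cop_tensor i j) * pr b (cop_tensor u v) *: (opA (mul_tensor i u) c * opA (mul_tensor j v) d))).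
under eq_bigr => u _ do rewrite exchange_big /=.
rewrite exchange_big /=; apply: eq_bigr => i _.
under eq_bigr => u _ do rewrite exchange_big /=.
by rewrite exchange_big.
Qed.

Definition Sop (f : M -> M) : M -> M := fun b => \sum_i x i * E (f (y i) * b).

Lemma exp_Sop f b c : Aset N f -> E (f b * c) = E (b * Sop f c).
Proof.
move=> hf; rewrite /Sop mulr_sumr (exp_sum hE).
have e i : E (b * (x i * E (f (y i) * c))) = E (f (E (b * x i) * y i) * c).
  have hN u : N (E u) by exact: exp_in hE u.
  by rewrite mulrA (expR hE _ (hN _)) (A_L (y i) hf (hN _)) -mulrA [RHS](expL hE).
under eq_bigr => i _ do rewrite e.
rewrite -(exp_sum hE) -mulr_suml; congr (E (_ * c)).
by rewrite -(M1_sum _ _ (A_M1 hf)) (exp_dual1 hE).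
Qed.

Lemma Sop_A f : Aset N f -> Aset N (Sop f).
Proof.
move=> hf; apply: A_intro; first split=> [b c|b u Nu].
- rewrite -big_split; apply: eq_bigr => i _.
  by rewrite mulrDr (exp_add hE) mulrDr.
- by rewrite mulr_suml; apply: eq_bigr => i _; rewrite mulrA (expR hE) // mulrA.
move=> u b Nu; apply: (exp_nondegl hE) => a.
by rewrite mulrA -!exp_Sop // mulrA; case: hf => -[_ ->].
Qed.

Definition antiA : 'M[k]_n.+1 := \matrix_(i, j) coA (Sop (w i)) 0 j.

Lemma opA_anti a b : opA (a *m antiA) b = Sop (opA a) b.
Proof.
have -> : a *m antiA = \sum_i a 0 i *: coA (Sop (w i)).
  by apply/rowP => j; rewrite mxE summxE; apply: eq_bigr => i _; rewrite !mxE.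
rewrite opA_sum /Sop; under [RHS]eq_bigr => j _ do rewrite /opA mulr_suml (exp_sum hE) mulr_sumr.
rewrite [RHS]exchange_big; apply: eq_bigr => i _ /=.
rewrite opA_Z coAK; last by apply: Sop_A; exact: ab_A hw _.
rewrite /Sop scaler_sumr; apply: eq_bigr => j _.
by rewrite -scalerAl (M1_scale hE _ _ (A_M1 (A_E hE))) scalerAr.
Qed.

Lemma exp_anti a b c : E (opA a b * c) = E (b * opA (a *m antiA) c).
Proof. by rewrite opA_anti; apply: exp_Sop; apply: opA_A. Qed.

Lemma exp_scale t b : E (t *: b) = t *: E b.
Proof. exact: (M1_scale hE _ _ (A_M1 (A_E hE))). Qed.

Lemma eps_antiA a : pr (a *m antiA) o = pr a o.
Proof.
apply: scalar_inj; have := exp_anti a 1 1.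
by rewrite mulr1 mul1r !opA_1 !exp_scale (exp1 hE).
Qed.

(** Adjointness tested against 1: S(a)(1) is eps(a) times 1. This makes E a right integral of A. *)
Lemma exp_opA a b : E (opA a b) = pr a o *: E b.
Proof.
by rewrite -[opA a b]mulr1 exp_anti opA_1 eps_antiA -scalerAr mulr1 exp_scale.
Qed.

(** E(c S(a_(1))(a_(2)(b))) = E(a_(1)(c) a_(2)(b)) = E(a(c b)) = eps(a) E(c b), and the form is
    nondegenerate. This is one half of the antipode axiom; [left_antipode_hopf] gives the other. *)
Lemma hopf_A : hopf mul_tensor cop_tensor antiA.
Proof.
apply: left_antipode_hopf bialg_A _ _ => a f.
rewrite -pr_vsw -prZl; congr pr; apply: opA_inj => b.
apply: (exp_nondegl hE) => c.
rewrite opA_Z opA_o -scalerAr exp_scale -exp_opA cop opA_vsw mulr_sumr !(exp_sum hE).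
apply: eq_bigr => i _; rewrite mulr_sumr !(exp_sum hE); apply: eq_bigr => j _.
by rewrite -scalerAr !exp_scale muA_opA -!opA_ev exp_anti.
Qed.

Lemma antiA_unit : antiA \in unitmx.
Proof.
rewrite -row_free_unit; apply: inj_row_free => v hv.
apply: opA_inj => b; rewrite opA_0; apply: (exp_nondegr hE) => c.
by rewrite mul0r exp_anti hv opA_0 mulr0.
Qed.

Lemma EM_opA a : exists c : k, EM hE (opA a) = c%:A.
Proof. exact: A_EM hE _ (opA_A a). Qed.

Definition tauA : V := \row_i projT1 (cid (EM_opA (ev k i))).

Lemma EM_scale t f : EM hE (fun b => t *: f b) = t *: EM hE f.
Proof.
rewrite /EM [RHS]scalerA [t * _]mulrC -[RHS]scalerA; congr (_ *: _).
by rewrite [RHS]scaler_sumr; apply: eq_bigr => i _; rewrite scalerAl.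
Qed.

Lemma EM_tau a : EM hE (opA a) = (pr a tauA)%:A.
Proof.
rewrite /opA EM_sum scaler_suml; apply: eq_bigr => i _.
rewrite EM_scale mxE -scalerA; case: cid => c /= <-; congr (_ *: EM hE _).
by apply/funext => b; rewrite opA_ev.
Qed.

(** Right M-linearity of E_M: E_M(a o L_b) = E_M(a) b, with a o L_b expanded by the coproduct, says
    that the sum of a_(1) tau(a_(2)) is tau(a) 1. *)
Lemma cointA f : pm cop_tensor f tauA = pr o f *: tauA.
Proof.
apply: pr_ext => a; rewrite prC prZl [pr tauA _]prC -sw_pr mulrC -prZl.
under eq_sw => u v do rewrite mulrC -prZl.
rewrite -pr_vsw; congr pr; apply: opA_inj => b.
rewrite opA_Z opA_o -[b in RHS]mul1r scalerAl -EM_tau -(EM_R hE _ (opA_M1 a)) opA_vsw.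
have -> : (fun c => opA a (b * c)) =
    fun c => \sum_i \sum_j pr a (cop_tensor i j) *: (w i b * opA (ev k j) c).
  apply/funext => c; rewrite cop; apply: eq_bigr => i _; apply: eq_bigr => j _.
  by rewrite opA_ev.
rewrite EM_sum; apply: eq_bigr => i _; rewrite EM_sum; apply: eq_bigr => j _.
rewrite EM_scale; congr (_ *: _).
by rewrite EM_L EM_tau opA_Z opA_ev -scalerAr mulr1.
Qed.

Definition intA : V := coA E.

Lemma opA_int b : opA intA b = E b. Proof. exact: coAK (A_E hE). Qed.

(** Right N-linearity gives a(E(b)) = a(1) E(b), so E is a left integral, and [exp_opA] gives the
    right side. The pairing of the two integrals is E_M(e_1), which is the index constant [lam]. *)
Lemma hopf_int_A : hopf_int mul_tensor cop_tensor antiA intA tauA (lam hE) (lam hE)^-1.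
Proof.
have tau1 : pr o tauA = 1.
  apply: scalar_inj; rewrite -EM_tau scale1r -(lam_index hE) /EM.
  by congr (_ *: _); apply: eq_bigr => i _; rewrite opA_o.
split=> //.
- exact: hopf_A.
- move=> a; apply: opA_inj => b; rewrite muA_opA opA_Z !opA_int.
  have := (opA_M1 a).2 1 (E b) (exp_in hE b).
  by rewrite !mul1r opA_1 -scalerAl mul1r.
- by move=> a; apply: opA_inj => b; rewrite muA_opA opA_Z !opA_int exp_opA.
- by apply: scalar_inj; rewrite -opA_1 opA_int (exp1 hE) scale1r.
- exact: cointA.
- exact: (left_cointegral_two_sided hopf_A antiA_unit cointA tau1).
- apply: scalar_inj; rewrite -EM_tau.
  have -> : opA intA = fun b => 1 * E b by apply/funext => b; rewrite opA_int mul1r.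
  exact: (EM_LE hE 1 (M1_id N)).
by rewrite mulfV // lam_neq0.
Qed.
End Coordinates.

(** * Transport from coordinates *)

(** [el] identifies row vectors with the members of X as an algebra. The coproduct is not part of
    the data: it is imported into X along [el], so the same record serves A with [mu] and B with
    [nu]. *)
Record coord_model (k : fieldType) (X : salg k) n (mu : 'I_n.+1 -> 'I_n.+1 -> 'rV[k]_n.+1)
    (el : 'rV[k]_n.+1 -> car X) : Prop := CoordModel {
  cm_mem : forall a, smem X (el a);
  cm_surj : forall x, smem X x -> exists a, el a = x;
  cm_inj : injective el;
  cm_D : forall a b, el (a + b) = sadd X (el a) (el b);
  cm_Z : forall c a, el (c *: a) = sscale X c (el a);
  cm_0 : el 0 = szero X;
  cm_M : forall a b, el (pm mu a b) = smul X (el a) (el b);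
  cm_1 : el (ev k ord0) = sone X }.

Lemma Forall_map_all (A B : Type) (P : B -> Prop) (f : A -> B) (s : seq A) :
  (forall z, P (f z)) -> List.Forall P (map f s).
Proof. by move=> h; elim: s => [|z s IH] /=; constructor. Qed.

Section Model.
Variables (k : fieldType) (X : salg k) (n : nat).
Variables (mu nu : 'I_n.+1 -> 'I_n.+1 -> 'rV[k]_n.+1) (el : 'rV[k]_n.+1 -> car X).
Hypothesis cm : coord_model mu el.
Local Notation V := 'rV[k]_n.+1.
Local Notation o := (ev k (ord0 : 'I_n.+1)).

Definition co (x : car X) : V :=
  if pselect (smem X x) is left h then projT1 (cid (cm_surj cm h)) else 0.

Lemma coK x : smem X x -> el (co x) = x.
Proof. by move=> hx; rewrite /co; case: pselect => // h; case: cid. Qed.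

Lemma elK : cancel el co.
Proof. by move=> a; apply: (cm_inj cm); apply: coK; exact: cm_mem cm a. Qed.

Lemma el_ssum (I : Type) (s : seq I) (F : I -> V) :
  ssum X [seq el (F i) | i <- s] = el (\sum_(i <- s) F i).
Proof.
by elim: s => [|i s IH]; rewrite ?big_nil ?(cm_0 cm) // big_cons (cm_D cm) -IH.
Qed.

Definition copX (x : car X) : seq (car X * car X) :=
  [seq (el (pr (co x) (nu z.1 z.2) *: ev k z.1), el (ev k z.2)) | z <- enum {: 'I_n.+1 * 'I_n.+1}].
Definition epsX (x : car X) : k := pr (co x) o.
Definition antX (S : 'M[k]_n.+1) (x : car X) : car X := el (co x *m S).

Lemma epsX_el a : epsX (el a) = pr a o. Proof. by rewrite /epsX elK. Qed.

Lemma big_copX (Z : nmodType) (G : car X -> car X -> Z) a :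
  \sum_(p <- copX (el a)) G p.1 p.2 =
  \sum_i \sum_j G (el (pr a (nu i j) *: ev k i)) (el (ev k j)).
Proof.
rewrite big_map big_enum elK.
by rewrite -(pair_bigA _ (fun i j => G (el (pr a (nu i j) *: ev k i)) (el (ev k j)))).
Qed.

Lemma sum_copX (G : car X -> car X -> k) (B : V -> V -> k) a :
  (forall u v, G (el u) (el v) = B u v) -> (forall v, lin (fun u => B u v)) ->
  \sum_(p <- copX (el a)) G p.1 p.2 = sw nu a B.
Proof.
move=> h l; rewrite big_copX; apply: eq_bigr => i _; apply: eq_bigr => j _.
by rewrite h (linZ (l _)).
Qed.

Lemma ssum_copX (G : car X -> car X -> car X) (b : V -> V -> V) a :
  (forall u v, G (el u) (el v) = el (b u v)) -> (forall v, vlin (fun u => b u v)) ->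
  ssum X [seq G p.1 p.2 | p <- copX (el a)] = el (vsw nu a b).
Proof.
move=> h l; rewrite -map_comp.
rewrite (eq_map (g := fun z => el (pr a (nu z.1 z.2) *: b (ev k z.1) (ev k z.2)))); last first.
  by move=> z; rewrite /= elK h (vlinZ (l _)).
rewrite el_ssum big_enum /vsw.
by rewrite -(pair_bigA _ (fun i j => pr a (nu i j) *: b (ev k i) (ev k j))).
Qed.

Lemma lin_fun_el phi : lin_fun X phi -> exists f, forall a, phi (el a) = pr a f.
Proof.
move=> h; have l : lin (fun a => phi (el a)).
  move=> c a b; rewrite (cm_D cm) (cm_Z cm).
  have e u : smem X (el u) := cm_mem cm u.
  have es : smem X (sscale X c (el a)) by rewrite -(cm_Z cm).
  by rewrite (h _ _ 0 es (e b)).1 (h _ (el b) c (e a) (e b)).2.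
by exists (\row_i phi (el (ev k i))) => a; rewrite (pr_row l).
Qed.

Lemma pr_co_lin f : lin_fun X (fun x => pr (co x) f).
Proof.
move=> x y c hx hy; rewrite -(coK hx) -(coK hy) -(cm_D cm) -(cm_Z cm) !elK prZl.
by rewrite (linD (lin_id_pr f)).
Qed.

Lemma fin_dim_model : fin_dim X.
Proof.
exists n.+1, (fun i => el (ev k i)); split=> [i|x hx]; first exact: cm_mem cm _.
exists (fun i => co x 0 i); rewrite -{1}(coK hx) {1}(ev_sum (co x)).
have -> : [seq sscale X (co x 0 i) (el (ev k i)) | i <- enum 'I_n.+1] =
    [seq el (co x 0 i *: ev k i) | i <- enum 'I_n.+1].
  by apply: eq_map => i; rewrite (cm_Z cm).
by rewrite el_ssum big_enum.
Qed.

Lemma is_hopf_model S : hopf mu nu S -> is_hopf X copX epsX (antX S).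
Proof.
move=> hh; have hb := hopf_bialg hh.
have e u : smem X (el u) := cm_mem cm u.
have P x : smem X x -> exists a, x = el a by move=> hx; exists (co x); rewrite coK.
split.
- move=> a _; split; last exact: e.
  by apply: Forall_map_all => z /=; split; apply: e.
- move=> _ _ c /P[u ->] /P[v ->]; rewrite -(cm_D cm) -(cm_Z cm); split.
    move=> phi psi /lin_fun_el[f hf] /lin_fun_el[g hg].
    rewrite big_cat !(sum_copX (G := fun x y => phi x * psi y) (B := fun u v => pr u f * pr v g));
      try (by move=> *; rewrite hf hg); try (by move=> v'; lin_tac).
    have l : lin (fun u => sw nu u (fun u v => pr u f * pr v g)) by lin_tac.
    by rewrite (linD l).
  move=> phi psi /lin_fun_el[f hf] /lin_fun_el[g hg].
  rewrite [RHS]big_map /=; have /= -> := @sum_copX (fun x y => phi (sscale X c x) * psi y)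
     (fun u v => c * pr u f * pr v g) u;
    [|by move=> *; rewrite -(cm_Z cm) hf hg prZl|by move=> v'; lin_tac].
  rewrite (sum_copX (G := fun x y => phi x * psi y) (B := fun u v => pr u f * pr v g));
    [|by move=> *; rewrite hf hg|by move=> v'; lin_tac].
  have l : lin (fun u => sw nu u (fun u v => pr u f * pr v g)) by lin_tac.
  by rewrite (linZ l) -sw_mull; apply: eq_sw => *; rewrite mulrA.
- split; first exact: pr_co_lin.
  move=> _ _ c /P[u ->] /P[v ->]; rewrite /antX -!(cm_D cm) -!(cm_Z cm) !elK.
  by rewrite mulmxDl scalemxAl.
split.
- move=> _ phi psi chi /P[a ->] /lin_fun_el[f hf] /lin_fun_el[g hg] /lin_fun_el[h hh'].
  have D u (f' g' : V) phi' psi' : (forall a, phi' (el a) = pr a f') ->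
      (forall a, psi' (el a) = pr a g') ->
      \sum_(q <- copX (el u)) phi' q.1 * psi' q.2 = sw nu u (fun x y => pr x f' * pr y g').
    move=> h1 h2; apply: (sum_copX (G := fun x y => phi' x * psi' y)) => [u' v|v].
      by rewrite h1 h2.
    lin_tac.
  have /= -> := @sum_copX (fun x y => (\sum_(q <- copX x) phi q.1 * psi q.2) * chi y)
    (fun u v => sw nu u (fun x y => pr x f * pr y g * pr v h)) a.
  + have /= -> := @sum_copX (fun x y => phi x * (\sum_(q <- copX y) psi q.1 * chi q.2))
    (fun u v => sw nu v (fun x y => pr u f * pr x g * pr y h)) a.
    - exact: (sw_coassoc hb a (fun x y z => pr x f * pr y g * pr z h)).
    - move=> u v; rewrite (D v g h) // hf -sw_mull.
      by apply: eq_sw => *; rewrite mulrA.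
    by move=> v; lin_tac.
  + by move=> u v; rewrite (D u f g) // hh' -sw_mulr.
  by move=> v; lin_tac.
- move=> _ /P[a ->]; split.
    have /= -> := @ssum_copX (fun x y => sscale X (epsX x) y) (fun u v => pr u o *: v) a.
    + congr el; apply: pr_ext => f; rewrite pr_vsw -[RHS](sw_counitl hb a (g := fun u => pr u f)).
        by apply: eq_sw => *; rewrite prZl.
      by lin_tac.
    + by move=> u v; rewrite epsX_el (cm_Z cm).
    by move=> v c u u'; rewrite (linD (lin_id_pr o)) prZl scalerDl scalerA.
  have /= -> := @ssum_copX (fun x y => sscale X (epsX y) x) (fun u v => pr v o *: u) a.
  + congr el; apply: pr_ext => f; rewrite pr_vsw -[RHS](sw_counitr hb a (g := fun u => pr u f)).
      by apply: eq_sw => *; rewrite prZl mulrC.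
    by lin_tac.
  + by move=> u v; rewrite epsX_el (cm_Z cm).
  by move=> v; apply: vlin_scale.
- move=> _ _ /P[a ->] /P[b ->]; rewrite -(cm_M cm); split; last by rewrite !epsX_el (epsM hb).
  move=> phi psi /lin_fun_el[f hf] /lin_fun_el[g hg].
  rewrite (sum_copX (G := fun x y => phi x * psi y) (B := fun u v => pr u f * pr v g));
    [|by move=> *; rewrite hf hg|by move=> v'; lin_tac].
  rewrite (sw_mul hb); [|lin_tac..].
  rewrite big_allpairs_dep /=.
  have /= -> // := @sum_copX (fun x y => \sum_(q <- copX (el b)) phi (smul X x q.1) * psi (smul X y q.2))
    (fun u v => sw nu b (fun b1 b2 => pr (pm mu u b1) f * pr (pm mu v b2) g)) a.
    move=> u v; apply: (sum_copX (G := fun x y => phi (smul X (el u) x) * psi (smul X (el v) y))).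
      by move=> u' v'; rewrite -!(cm_M cm) hf hg.
    by move=> v'; lin_tac.
  by move=> v; lin_tac.
- rewrite -(cm_1 cm) epsX_el; split; last by rewrite pr_evl evE.
  move=> phi psi /lin_fun_el[f hf] /lin_fun_el[g hg].
  rewrite (sum_copX (G := fun x y => phi x * psi y) (B := fun u v => pr u f * pr v g));
    [|by move=> *; rewrite hf hg|by move=> v'; lin_tac].
  by rewrite (sw_one hb) ?big_seq1 /= ?hf ?hg //; lin_tac.
move=> _ /P[a ->]; rewrite -(cm_1 cm) epsX_el -(cm_Z cm); split.
  have /= -> := @ssum_copX (fun x y => smul X (antX S x) y) (fun u v => pm mu (u *m S) v) a.
  + by congr el; apply: pr_ext => f; rewrite pr_vsw (antil hh) prZl.
  + by move=> u v; rewrite /antX elK (cm_M cm).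
  by move=> v; apply: vlin_pml; apply: vlin_mx.
have /= -> := @ssum_copX (fun x y => smul X x (antX S y)) (fun u v => pm mu u (v *m S)) a.
+ by congr el; apply: pr_ext => f; rewrite pr_vsw (antir hh) prZl.
+ by move=> u v; rewrite /antX elK (cm_M cm).
by move=> v; apply: vlin_pml.
Qed.

Lemma involutive_model S : S *m S = 1%:M -> involutive_antipode X (antX S).
Proof. by move=> hS x hx; rewrite /antX elK -mulmxA hS mulmx1 coK. Qed.
End Model.

(** * Maschke's theorem and semisimplicity *)

Lemma subspace_projection (k : fieldType) n (I : 'rV[k]_n -> Prop) :
  I 0 -> (forall u v, I u -> I v -> I (u + v)) -> (forall c u, I u -> I (c *: u)) ->
  exists P : 'M[k]_n, (forall v, I (v *m P)) /\ (forall v, I v -> v *m P = v).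
Proof.
move=> I0 ID IZ.
(* [I] is only a predicate; a matrix of maximal rank among those with row space inside [I] has row
   space equal to [I]. *)
pose good (U : 'M[k]_n) := forall v : 'rV_n, (v <= U)%MS -> I v.
pose Q r := `[< exists2 U : 'M[k]_n, good U & \rank U = r >].
have Q0 : exists r, Q r.
  exists 0%N; apply/asboolP; exists 0; last by rewrite mxrank0.
  by move=> v; rewrite submx0 => /eqP ->.
have Qle r : Q r -> (r <= n)%N by move=> /asboolP[U _ <-]; apply: rank_leq_row.
case: (ex_maxnP Q0 Qle) => r /asboolP[U gU rU] max.
have IU v : I v -> (v <= U)%MS.
  move=> Iv; have gW : good (U + v)%MS.
    move=> z /sub_addsmxP[[a b] /= ->]; apply: ID; first by apply: gU; apply: submxMl.
    by rewrite [b]mx11_scalar mul_scalar_mx; apply: IZ.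
  have : Q (\rank (U + v)%MS) by apply/asboolP; exists (U + v)%MS.
  move=> /max; rewrite -rU => le; apply: submx_trans (addsmxSr U v) _.
  by rewrite -(geq_leqif (mxrank_leqif_sup (addsmxSl U v))).
exists (proj_mx U (U^C)%MS); split=> v; first by apply: gU; apply: proj_mx_sub.
by move=> /IU; apply: proj_mx_id; apply: capmx_compl.
Qed.

Section Maschke.
Variables (k : fieldType) (n : nat) (mu nu : 'I_n.+1 -> 'I_n.+1 -> 'rV[k]_n.+1) (S : 'M[k]_n.+1).
Variables (t tau : 'rV[k]_n.+1) (lam li : k).
Hypothesis hi : hopf_int mu nu S t tau lam li.
Local Notation V := 'rV[k]_n.+1.

(** A linear projection P onto I is averaged to v |-> sum of t_(1) P(S(t_(2)) v), which is A-linear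
    by [sw_casimir'] and fixes I since eps(t) = 1. *)
Lemma maschke (I : V -> Prop) :
  I 0 -> (forall u v, I u -> I v -> I (u + v)) -> (forall c u, I u -> I (c *: u)) ->
  (forall a u, I u -> I (pm mu a u)) ->
  exists pi : V -> V, [/\ vlin pi, forall v, I (pi v), forall v, I v -> pi v = v
    & forall a v, pi (pm mu a v) = pm mu a (pi v)].
Proof.
move=> I0 ID IZ IM; have [P [hP1 hP2]] := subspace_projection I0 ID IZ.
have hh := hint_hopf hi; have hb := hopf_bialg hh.
exists (fun v => vsw nu t (fun x y => pm mu x (pm mu (y *m S) v *m P))); split.
- move=> c u v; apply: pr_ext => f; rewrite pr_vsw.
  have l : lin (fun v => sw nu t (fun x y => pr (pm mu x (pm mu (y *m S) v *m P)) f)) by lin_tac.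
  by rewrite (linD (lin_id_pr f)) prZl !pr_vsw l.
- move=> v; rewrite /vsw; elim/big_ind: _ => // i _; elim/big_ind: _ => // j _.
  by apply: IZ; apply: IM; apply: hP1.
- move=> v Iv; apply: pr_ext => f; rewrite pr_vsw.
  under eq_sw => x y do rewrite (hP2 _ (IM _ _ Iv)) -(muA hb) -pr_ract.
  by rewrite (antir hh) (int1 hi) mul1r pr_ract (mu1l hb).
move=> a v; apply: pr_ext => f; rewrite pr_vsw -pr_lact pr_vsw.
under eq_sw => x y do rewrite -(muA hb).
pose B x z := pr (pm mu x (pm mu z v *m P)) f.
rewrite -(@sw_casimir' _ _ _ _ _ _ _ _ _ hi B); [|by move=> ?; rewrite /B; lin_tac..].
by apply: eq_sw => x y; rewrite /B pr_lact (muA hb).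
Qed.
End Maschke.

Section SemisimpleModel.
Variables (k : fieldType) (X : salg k) (n : nat) (mu nu : 'I_n.+1 -> 'I_n.+1 -> 'rV[k]_n.+1)
  (el : 'rV[k]_n.+1 -> car X).
Hypothesis cm : coord_model mu el.

Lemma semisimple_model S t tau lam li : hopf_int mu nu S t tau lam li -> semisimple_alg X.
Proof.
move=> hi I [Imem I0 ID IZ IM].
have e u : smem X (el u) := cm_mem cm u.
have [||||pi [pl pI pid pM]] := maschke hi (I := fun a => I (el a)).
- by rewrite (cm_0 cm).
- by move=> u v; rewrite (cm_D cm); apply: ID.
- by move=> c u; rewrite (cm_Z cm); apply: IZ.
- by move=> a u; rewrite (cm_M cm); apply: IM.
have P x : smem X x -> exists a, x = el a by move=> hx; exists (co cm x); rewrite coK.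
exists (fun x => smem X x /\ pi (co cm x) = 0); split.
- split.
  + by move=> x [].
  + by rewrite -(cm_0 cm); split=> //; rewrite elK (vlin0 pl).
  + move=> _ _ [/P[a ->] ha] [/P[b ->] hb]; rewrite -(cm_D cm); split=> //.
    by move: ha hb; rewrite !elK (vlinD pl) => -> ->; rewrite addr0.
  + move=> c _ [/P[a ->] ha]; rewrite -(cm_Z cm); split=> //.
    by move: ha; rewrite !elK (vlinZ pl) => ->; rewrite scaler0.
  move=> _ _ /P[a ->] [/P[b ->] hb]; rewrite -(cm_M cm); split=> //.
  move: hb; rewrite !elK pM => ->; apply: pr_ext => f.
  have l : lin (fun x => pr (pm mu a x) f) by lin_tac.
  by rewrite (lin0 l) (lin0 (lin_id_pr f)).
- move=> x Ix [/P[a ea]]; subst x; rewrite elK pid // => ->; exact: cm_0 cm.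
move=> _ /P[a ->]; exists (el (pi a)), (el (a - pi a)); split=> //.
  split=> //; rewrite elK -scaleN1r addrC pl scaleN1r.
  by rewrite (pid _ (pI a)) addNr.
by rewrite -(cm_D cm) addrC subrK.
Qed.
End SemisimpleModel.

(** Both algebras are modelled on one row space, with the tensors exchanged and the antipode
    transposed, so [pr] is the duality. *)
Lemma hopf_dual_model (k : fieldType) (A B : salg k) n (mu nu : 'I_n.+1 -> 'I_n.+1 -> 'rV[k]_n.+1)
    S elA elB (cmA : coord_model (X := A) mu elA) (cmB : coord_model (X := B) nu elB) :
  hopf_dual A B (copX nu cmA) (epsX cmA) (antX cmA S) (copX mu cmB) (epsX cmB) (antX cmB S^T)
    (fun a b => pr (co cmA a) (co cmB b)).
Proof.
have PA x : smem A x -> exists a, x = elA a by move=> hx; exists (co cmA x); rewrite coK.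
have PB x : smem B x -> exists a, x = elB a by move=> hx; exists (co cmB x); rewrite coK.
have sB a b c : \sum_(q <- copX mu cmB (elB c)) pr a (co cmB q.1) * pr b (co cmB q.2) =
    sw mu c (fun u v => pr u a * pr v b).
  apply: (@sum_copX _ _ _ _ _ _ cmB (fun x y => pr a (co cmB x) * pr b (co cmB y))) => [u v|v].
    by rewrite !elK !(prC _ u) !(prC _ v).
  lin_tac.
have sA a b c : \sum_(q <- copX nu cmA (elA c)) pr (co cmA q.1) a * pr (co cmA q.2) b =
    sw nu c (fun u v => pr u a * pr v b).
  apply: (@sum_copX _ _ _ _ _ _ cmA (fun x y => pr (co cmA x) a * pr (co cmA y) b)) => [u v|v].
    by rewrite !elK.
  lin_tac.
split.
- exact: fin_dim_model cmA.
- split=> [b _|a _]; first exact: pr_co_lin.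
  move=> x y c hx hy; have h := pr_co_lin cmB (co cmA a) c hx hy.
  by rewrite !(prC (co cmA a)).
- split=> [_ /PA[a ->] h|_ /PB[b ->] h].
    rewrite -(cm_0 cmA); congr elA; apply: pr_ext => f.
    have := h _ (cm_mem cmB f); rewrite !elK => ->; apply: esym; exact: lin0 (lin_id_pr f).
  rewrite -(cm_0 cmB); congr elB; apply: pr_ext => f.
  have := h _ (cm_mem cmA f); rewrite !elK prC => ->; apply: esym; exact: lin0 (lin_id_pr f).
- split=> [_ _ _ /PA[a ->] /PA[a' ->] /PB[b ->]|_ _ _ /PA[a ->] /PB[b ->] /PB[b' ->]].
    by rewrite -(cm_M cmA) sB !elK sw_pr prC.
  by rewrite -(cm_M cmB) sA !elK sw_pr.
split=> [_ _ /PA[a ->] /PB[b ->]|_ _ /PA[a ->] /PB[b ->]].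
  by rewrite -(cm_1 cmA) -(cm_1 cmB) !elK /epsX !elK; split; rewrite // prC.
by rewrite /antX !elK pr_mx.
Qed.

(** * The Hopf algebra B and the smash products *)

(** Applying S to the antipode axioms reverses the factors and leaves S^2 on one of them; S^2 = 1
    removes it. *)
Lemma sw_anti2 (k : fieldType) n (mu nu : 'I_n.+1 -> 'I_n.+1 -> 'rV[k]_n.+1) (S : 'M[k]_n.+1) a f :
  hopf mu nu S -> S *m S = 1%:M ->
  sw nu a (fun x y => pr (pm mu (y *m S) x) f) = pr a (ev k ord0) * pr (ev k ord0) f /\
  sw nu a (fun x y => pr (pm mu y (x *m S)) f) = pr a (ev k ord0) * pr (ev k ord0) f.
Proof.
move=> hh SS; have SK (v : 'rV[k]_n.+1) : v *m S *m S = v by rewrite -mulmxA SS mulmx1.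
have e : pr (ev k ord0) (f *m S^T) = pr (ev k ord0) f by rewrite -pr_mx (anti_one hh).
split; rewrite -e.
  rewrite -(antil hh a (f *m S^T)); apply: eq_sw => x y.
  by rewrite -pr_mx (anti_mul hh) SK.
rewrite -(antir hh a (f *m S^T)); apply: eq_sw => x y.
by rewrite -pr_mx (anti_mul hh) SK.
Qed.

Lemma ssum_M1 (k : fieldType) (M : algType k) (N : M -> Prop) (s : seq (M -> M)) c :
  ssum (M1alg N) s c = \sum_(f <- s) f c.
Proof. by elim: s => [|f s IH]; rewrite ?big_nil // big_cons -IH. Qed.

Lemma ssum_M2 (k : fieldType) (M : algType k) (N : M -> Prop) (s : seq ((M -> M) -> M -> M)) f c :
  ssum (M2alg N) s f c = \sum_(F <- s) F f c.
Proof. by elim: s => [|F s IH]; rewrite ?big_nil // big_cons -IH. Qed.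

Lemma ssum_M (k : fieldType) (M : algType k) (s : seq M) : ssum (Malg M) s = \sum_(a <- s) a.
Proof. by elim: s => [|a s IH]; rewrite ?big_nil // big_cons -IH. Qed.

Lemma lin_fun_ssum (k : fieldType) (R : salg k) phi (I : Type) (r : seq I) (g : I -> car R) (c : I -> k) :
  lin_fun R phi -> smem R (szero R) -> szero R = sscale R 0 (szero R) ->
  (forall u v, smem R u -> smem R v -> smem R (sadd R u v)) ->
  (forall t u, smem R u -> smem R (sscale R t u)) ->
  List.Forall (fun i => smem R (g i)) r ->
  phi (ssum R [seq sscale R (c i) (g i) | i <- r]) = \sum_(i <- r) c i * phi (g i).
Proof.
move=> hphi R0 R00 RD RZ.
have phi0 : phi (szero R) = 0 by rewrite R00 (hphi _ _ 0 R0 R0).2 mul0r.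
elim: r => [|i r IH] h; first by rewrite big_nil.
have hi : smem R (g i) by apply: (List.Forall_inv h).
have ht := List.Forall_inv_tail h.
have hs : smem R (ssum R [seq sscale R (c j) (g j) | j <- r]).
  elim: r ht {IH h} => [|j r IHr] h //=; apply: RD; first by apply: RZ; exact: List.Forall_inv h.
  exact: IHr (List.Forall_inv_tail h).
by rewrite /= big_cons (hphi _ _ 0 (RZ _ _ hi) hs).1 (hphi _ _ _ hi hi).2 IH.
Qed.

(** With the factors in H expanded in a basis e_j, the tensor is a sum of r_j (x) e_j, and the last
    hypothesis says that every r_j is 0. *)
Lemma tens_eq_nil (k : fieldType) (R H : salg k) n (mu : 'I_n.+1 -> 'I_n.+1 -> 'rV[k]_n.+1)
    (el : 'rV[k]_n.+1 -> car H) (cm : coord_model mu el) (t : seq (car R * car H)) :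
  smem R (szero R) -> szero R = sscale R 0 (szero R) ->
  (forall u v, smem R u -> smem R v -> smem R (sadd R u v)) ->
  (forall c u, smem R u -> smem R (sscale R c u)) ->
  tens_in R H t ->
  (forall j, ssum R [seq sscale R (co cm p.2 0 j) p.1 | p <- t] = szero R) ->
  tens_eq R H t [::].
Proof.
move=> R0 R00 RD RZ ht hz phi psi hphi /(lin_fun_el cm)[f hf].
have phi0 : phi (szero R) = 0 by rewrite R00 (hphi _ _ 0 R0 R0).2 mul0r.
have ht1 : List.Forall (fun p : car R * car H => smem R p.1) t.
  by apply: List.Forall_impl ht => p [].
have -> : \sum_(p <- t) phi p.1 * psi p.2 = \sum_(p <- t) \sum_j (co cm p.2 0 j * phi p.1) * f 0 j.
  elim: (t) ht => [|p r IH] h; first by rewrite !big_nil.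
  rewrite !big_cons IH; last exact: List.Forall_inv_tail h.
  congr (_ + _); have [_ hp2] := List.Forall_inv h.
  rewrite -{1}(coK cm hp2) hf mulr_sumr; apply: eq_bigr => j _.
  by rewrite mulrA [phi _ * _]mulrC.
rewrite big_nil exchange_big big1 // => j _ /=.
rewrite -mulr_suml -(lin_fun_ssum (fun p : car R * car H => co cm p.2 0 j) hphi R0 R00 RD RZ ht1).
by rewrite hz phi0 mul0r.
Qed.

(** * Elements of M_2 as right M-linear maps of M_1 *)

Section M2.
Variables (k : fieldType) (M : algType k) (N : M -> Prop) (E : M -> M) (m : nat) (x y : 'I_m -> M).
Hypothesis hE : expectation N E x y.

Lemma M1_zero : M1set N (@zero1 k M).
Proof. by split=> [a b|a u _]; rewrite /zero1 ?addr0 ?mul0r. Qed.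

Lemma M1_add f g : M1set N f -> M1set N g -> M1set N (fun c => f c + g c).
Proof.
move=> [fD fN] [gD gN]; split=> [a b|a u Nu]; first by rewrite fD gD addrACA.
by rewrite fN // gN // mulrDl.
Qed.

Lemma M1_scale1 t f : M1set N f -> M1set N (fun c => t *: f c).
Proof.
move=> [fD fN]; split=> [a b|a u Nu]; first by rewrite fD scalerDr.
by rewrite fN // scalerAl.
Qed.

Lemma M1_bigsum (I : Type) (r : seq I) (g : I -> M -> M) :
  (forall i, M1set N (g i)) -> M1set N (fun c => \sum_(i <- r) g i c).
Proof.
move=> hg; split=> [a b|a u Nu].
  by rewrite -big_split; apply: eq_bigr => i _; rewrite (hg i).1.
by rewrite mulr_suml; apply: eq_bigr => i _; rewrite (hg i).2.
Qed.

Lemma M2_zero F : M2set N F -> F (@zero1 k M) = @zero1 k M.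
Proof.
move=> [_ _ FD _]; apply/funext => c; have /(congr1 (fun f => f c)) := FD _ _ M1_zero M1_zero.
have -> : add1 (@zero1 k M) (@zero1 k M) = @zero1 k M.
  by apply/funext => b; rewrite /add1 /zero1 addr0.
by rewrite /add1 -[X in X = _]addr0 => /addrI <-.
Qed.

Lemma M2_sum F (I : Type) (r : seq I) (g : I -> M -> M) c : M2set N F ->
  (forall i, M1set N (g i)) -> F (fun c => \sum_(i <- r) g i c) c = \sum_(i <- r) F (g i) c.
Proof.
move=> hF hg; elim: r => [|i r IH].
  rewrite big_nil; have -> : (fun c => \sum_(i <- [::]) g i c) = @zero1 k M.
    by apply/funext => b; rewrite big_nil.
  by rewrite M2_zero.
rewrite big_cons -IH; case: (hF) => _ _ FD _.
have -> : (fun c => \sum_(j <- i :: r) g j c) = add1 (g i) (fun c => \sum_(j <- r) g j c).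
  by apply/funext => b; rewrite big_cons.
by rewrite FD //; apply: M1_bigsum.
Qed.

Lemma M2_R F f s c : M2set N F -> M1set N f -> F (fun c => f (s * c)) c = F f (s * c).
Proof. by move=> [_ _ _ FR] hf; have /(congr1 (fun g => g c)) := FR f s hf. Qed.

Lemma M2_M1 F f : M2set N F -> M1set N (F f).
Proof.
move=> [F0 F1 _ _]; have [hf|hf] := pselect (M1set N f); first exact: F1.
by rewrite F0 //; exact: M1_zero.
Qed.

Lemma L1_in r f : M1set N f -> L1 N r f = r \o f.
Proof. by move=> hf; rewrite /L1; case: ClassicalEpsilon.excluded_middle_informative. Qed.

Lemma L1_out r f : ~ M1set N f -> L1 N r f = @zero1 k M.
Proof. by move=> hf; rewrite /L1; case: ClassicalEpsilon.excluded_middle_informative. Qed.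

Lemma B_L F f s c : Bset N F -> M1set N f -> F (fun c => s * f c) c = s * F f c.
Proof.
move=> [hF FL] hf; have /(congr1 (fun G => G f c)) := FL s.
by rewrite /= !L1_in //; exact: M2_M1.
Qed.

End M2.

Section B.
Variables (k : fieldType) (M : algType k) (N : M -> Prop) (E : M -> M) (m : nat) (x y : 'I_m -> M).
Hypothesis hE : expectation N E x y.
Variables (n : nat) (w : 'I_n.+1 -> M -> M).
Hypotheses (hw : adapted_basis N w) (hs : right_span N).
Local Notation V := 'rV[k]_n.+1.
Local Notation o := (ev k (ord0 : 'I_n.+1)).
Local Notation opA := (opA w).
Local Notation lco := (lco hw).
Local Notation mu := (mul_tensor hE hw).
Local Notation nu := (cop_tensor hE hw).
Local Notation S := (antiA hE hw).

Let hi : hopf_int mu nu S (intA hE hw) (tauA hE hw) (lam hE) (lam hE)^-1 := hopf_int_A hE hw.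
Let hh := hint_hopf hi.
Let hb := hopf_bialg hh.
Let SS : S *m S = 1%:M := etingof_gelaki hi.

Lemma M1_compL f s : M1set N f -> M1set N (fun c => f (s * c)).
Proof. by move=> hf; exact: M1_comp hf (M1_Lmul N s). Qed.

Lemma M1_Lcomp f s : M1set N f -> M1set N (fun c => s * f c).
Proof. by move=> hf; exact: M1_comp (M1_Lmul N s) hf. Qed.

Lemma lco_D f g j : M1set N f -> M1set N g -> lco (fun c => f c + g c) j = lco f j + lco g j.
Proof.
move=> hf hg; refine (lco_uniq (c := fun j => lco f j + lco g j) _ _ _ j); first exact: M1_add.
by move=> b; rewrite (lcoE hw b hf) (lcoE hw b hg) -big_split; apply: eq_bigr => i _; rewrite mulrDl.
Qed.

Lemma lco_L f s j : M1set N f -> lco (fun c => s * f c) j = s * lco f j.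
Proof.
move=> hf; refine (lco_uniq (c := fun j => s * lco f j) _ _ _ j); first exact: M1_Lcomp.
by move=> b; rewrite (lcoE hw b hf) mulr_sumr; apply: eq_bigr => i _; rewrite mulrA.
Qed.

Lemma lco_R f u j : M1set N f -> N u -> lco (fun c => f (u * c)) j = lco f j * u.
Proof.
move=> hf Nu; refine (lco_uniq (c := fun j => lco f j * u) _ _ _ j); first exact: M1_compL.
move=> b; rewrite (lcoE hw _ hf); apply: eq_bigr => i _.
by rewrite (A_L _ (ab_A hw i)) // mulrA.
Qed.

Lemma lco_opA a j : lco (opA a) j = (a 0 j)%:A.
Proof.
refine (lco_uniq (c := fun j => (a 0 j)%:A) _ (opA_M1 hw a) _ j) => b.
by apply: eq_bigr => i _; rewrite -scalerAl mul1r.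
Qed.

Lemma lco_cop a s j : lco (fun c => opA a (s * c)) j = \sum_i pr a (nu i j) *: w i s.
Proof.
refine (lco_uniq (c := fun j => \sum_i pr a (nu i j) *: w i s) _ _ _ j).
  exact: M1_compL (opA_M1 hw a).
move=> b; rewrite (cop hE hw) exchange_big; apply: eq_bigr => i _ /=.
by rewrite mulr_suml; apply: eq_bigr => l _; rewrite scalerAl.
Qed.

(* The left [M]-linear extension of the functional [b] of [A] to [M_1]. *)
Definition bev (b : V) (f : M -> M) : M := \sum_j b 0 j *: lco f j.

Lemma bev_D b f g : M1set N f -> M1set N g -> bev b (fun c => f c + g c) = bev b f + bev b g.
Proof.
by move=> hf hg; rewrite -big_split; apply: eq_bigr => j _; rewrite lco_D // scalerDr.
Qed.

Lemma bev_L b f s : M1set N f -> bev b (fun c => s * f c) = s * bev b f.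
Proof.
by move=> hf; rewrite mulr_sumr; apply: eq_bigr => j _; rewrite lco_L // scalerAr.
Qed.

Lemma bev_R b f u : M1set N f -> N u -> bev b (fun c => f (u * c)) = bev b f * u.
Proof.
by move=> hf Nu; rewrite mulr_suml; apply: eq_bigr => j _; rewrite lco_R // scalerAl.
Qed.

Lemma bev_opA b a : bev b (opA a) = (pr a b)%:A.
Proof.
rewrite /pr scaler_suml; apply: eq_bigr => j _.
by rewrite lco_opA scalerA mulrC.
Qed.

Lemma bev_o f : M1set N f -> bev o f = f 1.
Proof.
move=> hf; rewrite (lcoE hw 1 hf) /bev (bigD1 ord0) //= [RHS](bigD1 ord0) //= evE (ab_one hw) eqxx.
rewrite scale1r mulr1 !big1 // => j /negPf j0; first by rewrite (ab_one hw) j0 mulr0.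
by rewrite evE j0 scale0r.
Qed.

Lemma bev_lin t b b' f : bev (t *: b + b') f = t *: bev b f + bev b' f.
Proof.
by rewrite scaler_sumr -big_split; apply: eq_bigr => j _; rewrite !mxE scalerDl scalerA.
Qed.

Lemma bev_ev j f : bev (ev k j) f = lco f j.
Proof.
rewrite /bev (bigD1 j) //= evE eqxx scale1r big1 ?addr0 // => i /negPf ij.
by rewrite evE ij scale0r.
Qed.

(* A bimodule endomorphism [F] of [M_1] satisfies [F f s = F (f o L_s) 1]. *)
Definition opB (b : V) (f : M -> M) : M -> M :=
  if pselect (M1set N f) is left _ then fun s => bev b (fun c => f (s * c)) else @zero1 k M.

Lemma opBE b f s : M1set N f -> opB b f s = bev b (fun c => f (s * c)).
Proof. by move=> hf; rewrite /opB; case: pselect. Qed.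

Lemma opB_out b f : ~ M1set N f -> opB b f = @zero1 k M.
Proof. by move=> hf; rewrite /opB; case: pselect. Qed.

Lemma opB_M1 b f : M1set N (opB b f).
Proof.
have [hf|hf] := pselect (M1set N f); last by rewrite opB_out //; exact: M1_zero.
have hc s : M1set N (fun c => f (s * c)) by exact: M1_compL.
split=> [s s'|s u Nu]; rewrite !opBE //.
  have -> : (fun c => f ((s + s') * c)) = fun c => f (s * c) + f (s' * c).
    by apply/funext => c; rewrite mulrDl hf.1.
  exact: bev_D.
rewrite -bev_R //; congr bev; apply/funext => c; by rewrite mulrA.
Qed.

Lemma opB_L b f r : M1set N f -> opB b (fun c => r * f c) = fun s => r * opB b f s.
Proof.
move=> hf; apply/funext => s; rewrite !opBE //; last exact: M1_Lcomp.
by rewrite bev_L //; exact: M1_compL.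
Qed.

Lemma opB_opA b a s : opB b (opA a) s = opA (ract nu b a) s.
Proof.
rewrite opBE; last exact: opA_M1 hw a.
rewrite /bev; under eq_bigr => j _ do rewrite lco_cop scaler_sumr.
rewrite exchange_big; apply: eq_bigr => i _ /=; rewrite -pr_evl pr_ract.
have l : lin (fun z => pr (pm nu (ev k i) z) a) by lin_tac.
rewrite (lin_ev l) scaler_suml; apply: eq_bigr => j _.
by rewrite scalerA pm_ev (prC a).
Qed.

Lemma opB_M2 b : M2set N (opB b).
Proof.
split=> [f|f _|f g hf hg|f s hf].
- exact: opB_out.
- exact: opB_M1.
- apply/funext => s; have hfg : M1set N (add1 f g) by exact: M1_add.
  by rewrite /add1 !opBE //; apply: bev_D; exact: M1_compL.
apply/funext => s'; rewrite /= opBE ?opBE //; last exact: M1_compL.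
by congr bev; apply/funext => c; rewrite /= /Lmul mulrA.
Qed.

Lemma opB_B b : Bset N (opB b).
Proof.
split=> [|s]; first exact: opB_M2.
apply/funext => f; rewrite /= [RHS]L1_in; last exact: opB_M1.
have [hf|hf] := pselect (M1set N f); first by rewrite L1_in //; exact: opB_L.
rewrite L1_out // (M2_zero (opB_M2 b)) opB_out //.
by apply/funext => c; rewrite /= /Lmul /zero1 mulr0.
Qed.

(** F commutes with left multiplication by M and is right M-linear, so F(w_j) is in A and F(w_j)(1)
    is a scalar; these scalars are the coordinates of b. The values of F follow by expanding f o L_s
    in the left basis and evaluating at 1. *)
Lemma B_surj F : Bset N F -> exists b, opB b = F.
Proof.
move=> hF; have hF2 : M2set N F by case: hF.
have wM j : M1set N (w j) by exact: A_M1 (ab_A hw j).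
have FA j : Aset N (F (w j)).
  apply: A_intro => [|u c Nu]; first exact: M2_M1.
  rewrite -(B_L _ _ hF) // -(M2_R _ _ hF2) //; congr (F _ c); apply/funext => d.
  by rewrite (A_L _ (ab_A hw j)).
exists (\row_j projT1 (cid (A_one hE (FA j)))); apply/funext => f.
have [hf|hf] := pselect (M1set N f); last by rewrite opB_out //; case: hF2 => ->.
apply/funext => s; rewrite opBE //.
have hfs := M1_compL s hf.
rewrite -[s in RHS]mulr1 -(M2_R _ _ hF2) //.
have -> : (fun c => f (s * c)) = fun c => \sum_j lco (fun c => f (s * c)) j * w j c.
  by apply/funext => c; rewrite -(lcoE hw _ hfs).
rewrite (M2_sum _ _ hF2); last by move=> j; exact: M1_Lcomp.
have <- : (fun c => f (s * c)) = fun c => \sum_j lco (fun c => f (s * c)) j * w j c.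
  by apply/funext => c; rewrite -(lcoE hw _ hfs).
apply: eq_bigr => j _; rewrite (B_L _ _ hF) // mxE; case: cid => c /= ->.
by rewrite -scalerAr mulr1.
Qed.

Lemma coord_model_A : coord_model (X := Aalg N) mu opA.
Proof.
split.
- exact: opA_A hw.
- move=> f hf; have [a ha] := opA_surj hE hw hf.
  by exists a; apply/funext => c; rewrite ha.
- by move=> a b e; apply: (opA_inj hw) => c; rewrite e.
- by move=> a b; apply/funext => c; apply: opA_D.
- by move=> t a; apply/funext => c; apply: opA_Z.
- by apply/funext => c; apply: opA_0.
- by move=> a b; apply/funext => c; apply: muA_opA.
by apply/funext => c; apply: opA_o hw c.
Qed.

Lemma opB_lin t b b' f s : opB (t *: b + b') f s = t *: opB b f s + opB b' f s.
Proof.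
have [hf|hf] := pselect (M1set N f); first by rewrite !opBE // bev_lin.
by rewrite !opB_out // /zero1 scaler0 addr0.
Qed.

Lemma opB_Z t b f s : opB (t *: b) f s = t *: opB b f s.
Proof.
have e0 : opB 0 f s = 0.
  by have := opB_lin (-1) 0 0 f s; rewrite scaler0 addr0 scaleN1r addNr.
by have := opB_lin t b 0 f s; rewrite addr0 e0 addr0.
Qed.


Lemma M1_lco f c : M1set N f -> f c = \sum_j lco f j * opA (ev k j) c.
Proof. by move=> hf; rewrite (lcoE hw c hf); apply: eq_bigr => j _; rewrite opA_ev. Qed.

Lemma bev_bigsum (I : Type) (r : seq I) b (g : I -> M -> M) : (forall i, M1set N (g i)) ->
  bev b (fun c => \sum_(i <- r) g i c) = \sum_(i <- r) bev b (g i).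
Proof.
move=> hg; elim: r => [|i r IH].
  have -> : (fun c => \sum_(i <- [::]) g i c) = fun c => 0 * c.
    by apply/funext => c; rewrite big_nil mul0r.
  by rewrite bev_L // mul0r big_nil.
rewrite big_cons -IH -bev_D //; last exact: M1_bigsum.
by congr bev; apply/funext => c; rewrite big_cons.
Qed.

Lemma bev_opB b b' f : M1set N f -> bev b (opB b' f) = bev (pm nu b b') f.
Proof.
move=> hf.
have -> : opB b' f = fun c => \sum_j lco f j * opA (ract nu b' (ev k j)) c.
  apply/funext => c; rewrite -[X in opB b' X](_ : (fun c => \sum_j lco f j * opA (ev k j) c) = f).
    rewrite (M2_sum _ _ (opB_M2 b')); last by move=> j; apply: M1_Lcomp; exact: opA_M1 hw _.
    apply: eq_bigr => j _; rewrite opB_L; last exact: opA_M1 hw _.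
    by rewrite opB_opA.
  by apply/funext => d; rewrite -M1_lco.
rewrite bev_bigsum; last by move=> j; apply: M1_Lcomp; exact: opA_M1 hw _.
apply: eq_bigr => j _; rewrite bev_L; last exact: opA_M1 hw _.
by rewrite bev_opA prC pr_ract -scalerAr mulr1 pr_evr.
Qed.

Lemma coord_model_B : coord_model (X := Balg N) nu opB.
Proof.
split.
- exact: opB_B.
- exact: B_surj.
- move=> b b' e; apply: pr_ext => a; apply: (@scalar_inj _ M).
  rewrite !(prC _ a) -!bev_opA.
  have h b'' : bev b'' (opA a) = opB b'' (opA a) 1.
    rewrite opBE; last exact: opA_M1 hw a.
    by congr bev; apply/funext => d; rewrite mul1r.
  by rewrite !h e.
- move=> b b'; apply/funext => f; apply/funext => s.
  by rewrite -[b]scale1r opB_lin /= /add2 /add1 !scale1r.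
- by move=> t b; apply/funext => f; apply/funext => s; apply: opB_Z.
- apply/funext => f; apply/funext => s.
  by rewrite -(scale0r (0 : V)) opB_Z scale0r.
- move=> b b'; apply/funext => f; rewrite /=.
  have [hf|hf] := pselect (M1set N f); last first.
    by rewrite !(@opB_out _ f) // (M2_zero (opB_M2 b)).
  apply/funext => s; rewrite opBE // (opBE _ s (opB_M1 b' f)) -bev_opB; last exact: M1_compL.
  congr bev; apply/funext => c; rewrite !opBE //; last exact: M1_compL.
  by congr bev; apply/funext => d; rewrite mulrA.
apply/funext => f; rewrite /= /one2.
have [hf|hf] := pselect (M1set N f); last by rewrite opB_out // L1_out.
apply/funext => s; rewrite opBE // L1_in // bev_o ?mulr1 //; exact: M1_compL.
Qed.

(** If g o L_s is the sum of h_j w_j and f o L_(h_j) the sum of f_ij w_i, then f o g o L_s is the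
    sum of f_ij w_i w_j. So b meets the product of A, whose transpose is the coproduct of B. *)
Lemma opB_comp b f g s : M1set N f -> M1set N g ->
  opB b (fun c => f (g c)) s =
  \sum_i \sum_j pr b (mu i j) *: opB (ev k i) f (opB (ev k j) g s).
Proof.
move=> hf hg; have hfg : M1set N (fun c => f (g c)) by exact: M1_comp hf hg.
have hgs := M1_compL s hg; set h := fun c => g (s * c) in hgs.
have fl t : M1set N (fun c => f (t * c)) by exact: M1_compL.
rewrite opBE //.
have e l : lco (fun c => f (h c)) l = \sum_i \sum_j mu i j 0 l *: lco (fun c => f (lco h j * c)) i.
  refine (lco_uniq (c := fun l => \sum_i \sum_j mu i j 0 l *: lco (fun c => f (lco h j * c)) i)
    hw (M1_comp hf hgs) _ l) => {l} c.
  rewrite /= (M1_lco c hgs) (M1_sum _ _ hf).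
  under [RHS]eq_bigr => l _ do rewrite mulr_suml.
  rewrite [RHS]exchange_big /=.
  under [RHS]eq_bigr => i _ do under eq_bigr => l _ do rewrite mulr_suml.
  under [RHS]eq_bigr => i _ do rewrite exchange_big /=.
  rewrite [RHS]exchange_big; apply: eq_bigr => j _ /=.
  rewrite (M1_lco _ (fl (lco h j))); apply: eq_bigr => i _ /=.
  rewrite -(muA_opA hE hw) pm_ev -[opA _ c]/(\sum_l mu i j 0 l *: w l c) mulr_sumr; apply: eq_bigr => l _.
  by rewrite -scalerAl -scalerAr.
rewrite /bev; under eq_bigr => l _ do rewrite e scaler_sumr.
rewrite exchange_big; apply: eq_bigr => i _ /=.
under eq_bigr => l _ do rewrite scaler_sumr.
rewrite exchange_big; apply: eq_bigr => j _ /=.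
rewrite opBE // bev_ev opBE // bev_ev /pr scaler_suml; apply: eq_bigr => l _.
by rewrite scalerA.
Qed.

Lemma opB_id b s : opB b (fun c => c) s = pr b o *: s.
Proof.
rewrite opBE // -[s in RHS]mulr1.
have -> : (fun c : M => s * c) = fun c => s * opA o c.
  by apply/funext => c; rewrite (opA_o hw).
by rewrite bev_L ?bev_opA -?scalerAr ?mulr1 1?(prC o) //; exact: opA_M1 hw o.
Qed.


Local Notation cmA := coord_model_A.
Local Notation cmB := coord_model_B.
Local Notation DA := (copX nu cmA).
Local Notation DB := (copX mu cmB).

Lemma A_el f : Aset N f -> exists a, f = opA a.
Proof. by move=> hf; exists (co cmA f); rewrite (coK cmA). Qed.

Lemma module_alg_A : module_alg (Aalg N) (Malg M) DA (epsX cmA) (fun a b => a b).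
Proof.
split=> //.
- by move=> a r r' c ha _ _; split; [exact: (A_M1 ha).1|exact: (M1_scale hE c r (A_M1 ha))].
split=> [_ r r' /A_el[a ->] _ _|_ /A_el[a ->]]; last by rewrite epsX_el; exact: opA_1 hw _.
rewrite ssum_M big_map (big_copX nu cmA (fun p q => p r * q r')).
rewrite [LHS](cop hE hw); apply: eq_bigr => i _; apply: eq_bigr => j _.
by rewrite opA_Z !opA_ev scalerAl.
Qed.

Lemma module_alg_B : module_alg (Balg N) (M1alg N) DB (epsX cmB) (fun F f => F f).
Proof.
have PB F : Bset N F -> exists b, F = opB b by move=> /B_surj[b <-]; exists b.
split=> //.
- by move=> _ f /PB[b ->] _; apply: opB_M1.
- move=> _ f g c /PB[b ->] hf hg; split.
    by case: (opB_M2 b) => _ _ h _; apply: h.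
  have hM : M1set N f by exact: hf.
  apply/funext => s; have := opB_L b c%:A hM => /(congr1 (fun F => F s)).
  rewrite -scalerAl mul1r /= /scale1 => <-; congr (opB b _ s); apply/funext => d.
  by rewrite -scalerAl mul1r.
- by split=> // f hf; rewrite /= /one2 L1_in.
split=> [_ f g /PB[b ->] hf hg|_ /PB[b ->]]; last first.
  by rewrite epsX_el; apply/funext => s; exact: opB_id.
apply/funext => s; rewrite ssum_M1 big_map (big_copX mu cmB (fun F G => F f (G g s))).
rewrite [LHS]opB_comp //; apply: eq_bigr => i _; apply: eq_bigr => j _.
by rewrite opB_Z.
Qed.

Lemma smash_A : smash_iso (Malg M) (Aalg N) (M1alg N) DA (fun a b => a b)
  (fun r a c => r * a c).
Proof.
have scl (a : M -> M) t u : Aset N a -> a (t *: u) = t *: a u.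
  by move=> ha; exact: (M1_scale hE t u (A_M1 ha)).
split.
- by move=> r a _ ha; apply: M1_Lcomp; exact: A_M1.
- move=> r r' a c _ _ _; split; apply/funext => b /=; first by rewrite mulrDl.
  by rewrite -scalerAl.
- move=> r a a' c _ _ _; split; apply/funext => b /=; first by rewrite /add1 mulrDr.
  by rewrite /scale1 -scalerAr.
- split=> [t ht hz|f hf].
    refine (tens_eq_nil (cm := cmA) _ _ _ _ ht _) => //; first by rewrite /= scale0r.
    move=> j; rewrite ssum_M big_map; move: j.
    refine (ab_free hw (c := fun j => \sum_(p <- t) co cmA p.2 0 j *: p.1) _) => b.
    transitivity (\sum_(p <- t) p.1 * p.2 b).
      under eq_bigr => j _ do rewrite mulr_suml.
      rewrite exchange_big /=.
      elim: (t) ht => [|p r IH] h; first by rewrite !big_nil.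
      rewrite !big_cons IH; last exact: List.Forall_inv_tail h.
      congr (_ + _); have [_ hp2] := List.Forall_inv h.
      rewrite -[in RHS](coK cmA hp2) mulr_sumr; apply: eq_bigr => j _.
      by rewrite -scalerAl scalerAr.
    have /(congr1 (fun f => f b)) := hz.
    by rewrite ssum_M1 big_map.
  exists [seq (lco f j, opA (ev k j)) | j <- enum 'I_n.+1]; split.
    by apply: Forall_map_all => j; split=> //; exact: opA_A hw _.
  apply/funext => b; rewrite -map_comp ssum_M1 big_map big_enum; exact: M1_lco.
split; last by apply/funext => b; rewrite /= mul1r.
move=> r _ r' _ _ /A_el[a ->] _ /A_el[a' ->]; apply/funext => b.
rewrite ssum_M1 big_map (big_copX nu cmA (fun p q => r * p r' * q (opA a' b))) /=.
rewrite (cop hE hw) mulr_sumr; apply: eq_bigr => i _; rewrite mulr_sumr.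
apply: eq_bigr => j _; rewrite opA_Z !opA_ev.
by rewrite -!scalerAr -scalerAl mulrA.
Qed.

(** By [right_span], M_1 is spanned by products of A with M on the right, and elements of M_2 are
    right M-linear. *)
Lemma M2_ext F G : M2set N F -> M2set N G -> (forall a c, F (opA a) c = G (opA a) c) -> F = G.
Proof.
move=> hF hG h; apply/funext => f.
have [hf|hf] := pselect (M1set N f); last by case: hF hG => F0 _ _ _ [G0 _ _ _]; rewrite F0 ?G0.
have [d [u [c [uA fE]]]] := hs hf; apply/funext => s.
have -> : f = fun b => \sum_j u j (c j * b) by apply/funext.
have uM j : M1set N (fun b => u j (c j * b)) by apply: M1_compL; exact: A_M1.
rewrite (M2_sum _ _ hF) // (M2_sum _ _ hG) //; apply: eq_bigr => j _.
rewrite (M2_R _ _ hF) ?(M2_R _ _ hG); try exact: A_M1 (uA j).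
by have [a ->] := A_el (uA j).
Qed.

Lemma M1_at0 r : M1set N r -> r 0 = 0.
Proof. by move=> hr; apply: (addrI (r 0)); rewrite -hr.1 !addr0. Qed.

Lemma M2_lcomp r F : M1set N r -> M2set N F -> M2set N (fun f => r \o F f).
Proof.
move=> hr [F0 F1 FD FR]; split=> [f hf|f hf|f g hf hg|f s hf].
- by rewrite F0 //; apply/funext => c; exact: M1_at0.
- exact: M1_comp hr (F1 _ hf).
- by rewrite FD //; apply/funext => c; exact: hr.1.
by rewrite FR.
Qed.

Lemma M2_bigsum (I : Type) (r : seq I) (F : I -> (M -> M) -> M -> M) :
  (forall i, M2set N (F i)) -> M2set N (fun f c => \sum_(i <- r) F i f c).
Proof.
move=> hF; split=> [f hf|f hf|f g hf hg|f s hf]; last 2 first.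
- apply/funext => c; rewrite /add1 -big_split; apply: eq_bigr => i _.
  by case: (hF i) => _ _ -> .
- by apply/funext => c; apply: eq_bigr => i _; case: (hF i) => _ _ _ ->.
- apply/funext => c; rewrite /zero1 big1 // => i _.
  by case: (hF i) => -> .
by apply: M1_bigsum => i; exact: M2_M1.
Qed.

Lemma M2_opA G a c : M2set N G -> G (opA a) c = \sum_v a 0 v *: G (w v) c.
Proof.
move=> hG; have wM v : M1set N (w v) by exact: A_M1 (ab_A hw v).
rewrite (M2_sum _ _ hG); last by move=> v; exact: M1_scale1.
apply: eq_bigr => v _.
have -> : (fun b => a 0 v *: w v b) = fun b => w v ((a 0 v)%:A * b).
  by apply/funext => b; rewrite -scalerAl mul1r (M1_scale hE _ _ (wM v)).
rewrite (M2_R _ _ hG) // -scalerAl mul1r (M1_scale hE) //; exact: M2_M1.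
Qed.

(** Both injectivity and surjectivity are tested on A, where b acts by a |-> a_(1) b(a_(2)). The
    resulting relations are inverted by the antipode; the factors appear in reversed order, hence
    [sw_anti2]. *)
Lemma smash_B : smash_iso (M1alg N) (Balg N) (M2alg N) DB (fun F f => F f)
  (fun r F f => r \o F f).
Proof.
have PB F : Bset N F -> exists b, F = opB b by move=> /B_surj[b <-]; exists b.
have scl r t u : M1set N r -> r (t *: u) = t *: r u by exact: (M1_scale hE t u).
split.
- by move=> r F hr /PB[b ->]; apply: M2_lcomp => //; exact: opB_M2.
- by [].
- move=> r F F' c hr _ _; split; apply/funext => f; apply/funext => s /=.
    by rewrite /add2 /add1 hr.1.
  by rewrite /scale2 /scale1 scl.
- split=> [t ht hz|G hG].
    refine (tens_eq_nil (cm := cmB) _ _ _ _ ht _) => //.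
    + exact: M1_zero.
    + by apply/funext => s; rewrite /= /scale1 scale0r.
    + by move=> u v hu hv; exact: M1_add.
    + by move=> c u hu; exact: M1_scale1.
    pose q j c := \sum_(p <- t) co cmB p.2 0 j *: p.1 c.
    have qM j : M1set N (q j).
      have h : M1set N (ssum (M1alg N) [seq sscale (M1alg N) (co cmB p.2 0 j) p.1 | p <- t]).
        elim: (t) ht => [|p r IH] h /=; first exact: M1_zero.
        apply: M1_add; last exact: IH (List.Forall_inv_tail h).
        by apply: M1_scale1; have [] := List.Forall_inv h.
      suff -> : q j = ssum (M1alg N) [seq sscale (M1alg N) (co cmB p.2 0 j) p.1 | p <- t] by [].
      by apply/funext => c; rewrite ssum_M1 big_map.
    have key a c : \sum_j q j (opA (ract nu (ev k j) a) c) = 0.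
      have e : \sum_(p <- t) p.1 (p.2 (opA a) c) = 0.
        by have /(congr1 (fun F => F (opA a) c)) := hz; rewrite ssum_M2 big_map.
      rewrite -[RHS]e exchange_big /=.
      elim: (t) ht => [|p r IH] h; first by rewrite !big_nil.
      rewrite !big_cons IH; last exact: List.Forall_inv_tail h.
      congr (_ + _); have [hp1 hp2] := List.Forall_inv h.
      rewrite -[in RHS](coK cmB hp2) /= opB_opA.
      have -> : ract nu (co cmB p.2) a = \sum_j co cmB p.2 0 j *: ract nu (ev k j) a.
        exact: (vlin_ev (vlin_ractl nu a (@vlin_id k n))).
      rewrite opA_sum (M1_sum _ _ hp1); apply: eq_bigr => j _.
      by rewrite opA_Z scl.
    move=> j; apply/funext => c; rewrite ssum_M1 big_map -/(q j c) /= /zero1.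
    (* For a = w_j, [Y l] is the sum of a_(2) S(a_(1)) applied to c, weighted by the l-th coordinate
       of a_(3); it is c for l = j and 0 otherwise. The relation [key] thus isolates [q j c]. *)
    pose Y l := \sum_u \sum_v nu u v 0 j *: opA (ract nu (ev k l) (ev k v)) (opA (ev k u *m S) c).
    have Y0 : \sum_l q l (Y l) = 0.
      under eq_bigr => l _ do rewrite (M1_sum _ _ (qM l)).
      rewrite exchange_big big1 //= => u _.
      under eq_bigr => l _ do rewrite (M1_sum _ _ (qM l)).
      rewrite exchange_big big1 //= => v _.
      under eq_bigr => l _ do rewrite (scl _ _ _ (qM l)).
      by rewrite -scaler_sumr key scaler0.
    have YE l : Y l = (l == j)%:R *: c.
      pose Z := vsw nu (ev k j) (fun u v => pm mu (ract nu (ev k l) v) (u *m S)).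
      have -> : Y l = opA Z c.
        rewrite (opA_vsw hE hw); apply: eq_bigr => u _; apply: eq_bigr => v _.
        by rewrite pr_evl (muA_opA hE hw).
      have -> : Z = (l == j)%:R *: o.
        apply: pr_ext => f; rewrite pr_vsw prZl.
        transitivity (sw nu (ev k j) (fun u v => sw nu v (fun v1 v2 =>
            pr (pm mu v1 (u *m S)) f * pr v2 (ev k l)))).
          apply: eq_sw => u v; rewrite -pr_ract prC pr_ract prC -sw_pr.
          by apply: eq_sw => v1 v2; rewrite pr_ract.
        rewrite -(sw_coassoc hb (ev k j) (fun u v1 v2 => pr (pm mu v1 (u *m S)) f * pr v2 (ev k l))).
        under eq_sw => r z do rewrite sw_mulr (sw_anti2 r f hh SS).2 -mulrA.
        rewrite (sw_counitl hb _ (g := fun z => pr o f * pr z (ev k l))); last by lin_tac.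
        by rewrite pr_evr evE mulrC.
      by rewrite opA_Z (opA_o hw).
    rewrite -[RHS]Y0 (bigD1 j) //= big1 ?addr0 => [|l /negPf lj]; rewrite YE.
      by rewrite eqxx scale1r.
    by rewrite lj scale0r (M1_at0 (qM l)).
  (* For a = w_j, [f j] is the sum of G(a_(2)) o S(a_(1)). The combination of the [f j] with the
     basis of B then sends a to the sum of G(a_(3)) o S(a_(2)) o a_(1), which is G(a). *)
  pose f j c := \sum_u \sum_v nu u v 0 j *: G (w v) (opA (ev k u *m S) c).
  have fM j : M1set N (f j).
    apply: M1_bigsum => u; apply: M1_bigsum => v; apply: M1_scale1.
    exact: M1_comp (M2_M1 _ hG) (opA_M1 hw _).
  exists [seq (f j, opB (ev k j)) | j <- enum 'I_n.+1]; split.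
    by apply: Forall_map_all => j; split; [exact: fM|exact: opB_B].
  have -> : ssum (M2alg N) [seq (fun g => p.1 \o p.2 g) | p <- [seq (f j, opB (ev k j)) | j <- enum 'I_n.+1]]
      = fun g c => \sum_j f j (opB (ev k j) g c).
    by apply/funext => g; apply/funext => c; rewrite ssum_M2 -map_comp big_map big_enum.
  refine (M2_ext hG _ _).
    by apply: M2_bigsum => j; apply: M2_lcomp => //; exact: opB_M2.
  move=> a c; rewrite M2_opA //.
  pose X v := \sum_u \sum_j nu u v 0 j *: pm mu (ev k u *m S) (ract nu (ev k j) a).
  have XE v : X v = a 0 v *: o.
    apply: pr_ext => g; rewrite prZl.
    have l : lin (fun u => pr u g) by lin_tac.
    transitivity (\sum_u pr a (pm nu (pm nu (lact mu g (ev k u *m S)) (ev k u)) (ev k v))).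
      rewrite (lin_sum l); apply: eq_bigr => u _; rewrite (lin_sum l) (nuA hb) pm_ev prC.
      have l2 : lin (fun z => pr (pm nu (lact mu g (ev k u *m S)) z) a) by lin_tac.
      rewrite (lin_ev l2); apply: eq_bigr => j _.
      by rewrite prZl -pr_lact prC pr_ract.
    under eq_bigr => u _ do rewrite -sw_pr.
    transitivity (sw nu a (fun z y => sw nu z (fun z1 z2 => pr (pm mu (z2 *m S) z1) g) * pr y (ev k v))).
      rewrite -sw_sum; apply: eq_sw => z r; rewrite -mulr_suml; congr (_ * _).
      under eq_bigr => u _ do rewrite -sw_pr.
      rewrite -sw_sum; apply: eq_sw => z1 z2.
      have l3 : lin (fun z => pr (pm mu (z *m S) z1) g) by lin_tac.
      rewrite (lin_ev l3); apply: eq_bigr => u _.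
      by rewrite pr_lact pr_evr mulrC.
    under eq_sw => z r do rewrite (sw_anti2 z g hh SS).1 -mulrA.
    rewrite (sw_counitl hb _ (g := fun z => pr o g * pr z (ev k v))); last by lin_tac.
    by rewrite pr_evr mulrC.
  transitivity (\sum_v G (w v) (opA (X v) c)).
    by apply: eq_bigr => v _; rewrite XE opA_Z (opA_o hw) (M1_scale hE _ _ (M2_M1 (w v) hG)).
  under [RHS]eq_bigr => j _ do rewrite opB_opA.
  rewrite /f [RHS]exchange_big /=.
  under [RHS]eq_bigr => u _ do rewrite exchange_big /=.
  rewrite [RHS]exchange_big; apply: eq_bigr => v _ /=.
  rewrite opA_sum (M1_sum _ _ (M2_M1 (w v) hG)); apply: eq_bigr => u _.
  rewrite opA_sum (M1_sum _ _ (M2_M1 (w v) hG)); apply: eq_bigr => j _.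
  by rewrite opA_Z (M1_scale hE _ _ (M2_M1 (w v) hG)) (muA_opA hE hw).
split=> [r F r' F' hr /PB[b ->] hr' /PB[b' ->]|]; last first.
  by apply/funext => g.
apply/funext => g; apply/funext => s.
rewrite ssum_M2 big_map (big_copX mu cmB (fun p q => r (p r' (q (opB b' g) s)))) /=.
rewrite -[LHS]/(r (opB b (fun c => r' (opB b' g c)) s)) opB_comp //; last exact: opB_M1.
rewrite (M1_sum _ _ hr); apply: eq_bigr => i _; rewrite (M1_sum _ _ hr).
by apply: eq_bigr => j _; rewrite opB_Z.
Qed.
End B.

Theorem theorem1p1 (k : fieldType) (M : algType k) (N : M -> Prop)
  (E : M -> M) (m : nat) (x y : 'I_m -> M) :
  is_unital_subalg N ->
  strongly_sep_irred N E x y ->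
  depth2 N ->
  exists (DA : (M -> M) -> seq ((M -> M) * (M -> M))) (epsA : (M -> M) -> k)
         (SA : (M -> M) -> (M -> M))
         (DB : ((M -> M) -> (M -> M)) ->
                 seq (((M -> M) -> (M -> M)) * ((M -> M) -> (M -> M))))
         (epsB : ((M -> M) -> (M -> M)) -> k)
         (SB : ((M -> M) -> (M -> M)) -> ((M -> M) -> (M -> M)))
         (p : (M -> M) -> ((M -> M) -> (M -> M)) -> k)
         (actB : ((M -> M) -> (M -> M)) -> (M -> M) -> (M -> M))
         (actA : (M -> M) -> M -> M)
         (f2 : (M -> M) -> ((M -> M) -> (M -> M)) -> ((M -> M) -> (M -> M)))
         (f1 : M -> (M -> M) -> (M -> M)),
    [/\ is_hopf (Aalg N) DA epsA SA /\ involutive_antipode (Aalg N) SA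
          /\ semisimple_alg (Aalg N),
        is_hopf (Balg N) DB epsB SB /\ involutive_antipode (Balg N) SB
          /\ semisimple_alg (Balg N),
        hopf_dual (Aalg N) (Balg N) DA epsA SA DB epsB SB p,
        module_alg (Balg N) (M1alg N) DB epsB actB /\
        module_alg (Aalg N) (Malg M) DA epsA actA
      & smash_iso (M1alg N) (Balg N) (M2alg N) DB actB f2 /\
        smash_iso (Malg M) (Aalg N) (M1alg N) DA actA f1].
Proof.
move=> hN hS hD; have [E' [y' hE]] := normalize_expectation hN hS.
have [hs [n [w hw]]] := depth2_basis hE hD.
have hi := hopf_int_A hE hw; have hh := hint_hopf hi; have SS := etingof_gelaki hi.
have SST : (antiA hE hw)^T *m (antiA hE hw)^T = 1%:M by rewrite -trmx_mul SS trmx1.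
pose cmA := coord_model_A hE hw; pose cmB := coord_model_B hE hw.
exists (copX (cop_tensor hE hw) cmA), (epsX cmA), (antX cmA (antiA hE hw)).
(* B has [cop_tensor] as its product, so [mul_tensor] gives its coproduct. *)
exists (copX (mul_tensor hE hw) cmB), (epsX cmB), (antX cmB (antiA hE hw)^T).
exists (fun a b => pr (co cmA a) (co cmB b)), (fun F f => F f), (fun a b => a b).
exists (fun r F f => r \o F f), (fun r a c => r * a c).
split.
- split; first exact: is_hopf_model hh.
  by split; [exact: involutive_model SS|refine (semisimple_model cmA hi)].
- split; first exact: is_hopf_model (hopf_swap hh).
  by split; [exact: involutive_model SST|refine (semisimple_model cmB (hopf_int_swap hi))].
- exact: hopf_dual_model.
- by split; [exact: module_alg_B|exact: module_alg_A].
by split; [exact: smash_B|exact: smash_A].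
Qed.
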